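(* Let $\Gamma$ be a countable set, let $m_k,\nu_k>0$ ($k\in\Gamma$) be constants, and let $V_{kl}:\mathbb{R}^d\to\mathbb{R}$ ($k,l\in\Gamma$) be functions satisfying the following conditions: (i) $V_{kl}(x)=V_{lk}(-x)$ for all $k,l\in\Gamma$, $x\in\mathbb{R}^d$; (ii) $V_{kl}\in C_0^\infty(\mathbb{R}^d,\mathbb{R})$ for all $k,l\in\Gamma$; (iii a) there exist constants $C\ge 0$ and $C_{kl}\ge 0$ ($k,l\in\Gamma$) such that $\|\partial^\beta V_{kl}\|_\infty\le C_{kl}C^{|\beta|}$ for all multi-indices $\beta:\{1,\dots,d\}\to\mathbb{Z}_{\ge0}$; (iii b) $\sup_{k\in\Gamma}\sum_{l\in\Gamma}C_{kl}<\infty$; (iv) $\sup_{k\in\Gamma}\{m_k\nu_k,\,1/(m_k\nu_k)\}<\infty$. For $t\in\mathbb{R}$ and finite $\Lambda\subset\Gamma$ let $\alpha_\Lambda^t$ be the local time evolution, $\alpha_\Lambda^t(f\circ\pi_\Lambda)=f\circ\Phi^t_{H_\Lambda}\circ\pi_\Lambda$ for $f\in C_{\mathcal R}(\Omega_\Lambda)$. Then for every $t\in\mathbb{R}$ there exists a unique $*$-isomorphism $\alpha^t:C_{\mathcal R}(\Omega)\to C_{\mathcal R}(\Omega)$ satisfying $$\alpha^t(f)=\lim_{\Lambda\nearrow\Gamma}\alpha^t_\Lambda(f)$$ for all finite $\Lambda_0\subset\Gamma$ and all $f\in\pi_{\Lambda_0}^*C_{\mathcal R}(\Omega_{\Lambda_0})$.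 Moreover, the collection $(\alpha^t)_{t\in\mathbb{R}}$ is a one-parameter group.
   Context: $d\ge1$ is a fixed integer. $C_0^\infty(\mathbb{R}^d,\mathbb{R})$ denotes the smooth real-valued functions vanishing at infinity. Phase space: $\Omega$ is the space of pairs $(p,q)$ of finitely supported sequences $p=(p_k)_{k\in\Gamma}$, $q=(q_k)_{k\in\Gamma}$ with $p_k,q_k\in\mathbb{R}^d$, with the inner product inherited from $\ell^2(\Gamma,\mathbb{R}^{2d})$. For finite $\Lambda\subset\Gamma$, $\Omega_\Lambda=\{(p,q)\in\Omega: p_k=q_k=0 \text{ for } k\notin\Lambda\}\cong\mathbb{R}^{2|\Lambda|d}$, and $\pi_\Lambda:\Omega\to\Omega_\Lambda$ is the orthogonal projection. $\pi_\Lambda^*$ denotes pull-back, $\pi_\Lambda^*f=f\circ\pi_\Lambda$. Commutative resolvent algebra: for a real inner product space $X$, $C_{\mathcal R}(X)$ is the C*-subalgebra of $C_b(X)$ (bounded continuous complex functions, sup norm) generated by the functions $h_x^\lambda(y)=1/(i\lambda-x\cdot y)$, $x\in X$, $\lambda\in\mathbb{R}\setminus\{0\}$. One has $\pi_\Lambda^*C_{\mathcal R}(\Omega_\Lambda)\subset C_{\mathcal R}(\Omega)$, and $C_{\mathcal R}(\Omega)$ is the norm closure of $\bigcup_{\Lambda}\pi_\Lambda^*C_{\mathcal R}(\Omega_\Lambda)$ over finite $\Lambda\subset\Gamma$. Local Hamiltonians: for finite $\Lambda\subset\Gamma$, $$H_\Lambda(p,q)=\sum_{k\in\Lambda}\Big(\frac{\|p_k\|^2}{2m_k}+\frac{\nu_k\|q_k\|^2}{2}\Big)+\sum_{k,l\in\Lambda}V_{kl}(q_k-q_l),$$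 regarded as a function on $\Omega_\Lambda$. $\Phi^t_{H_\Lambda}:\Omega_\Lambda\to\Omega_\Lambda$ is its (globally defined) Hamiltonian flow: $\frac{d}{dt}\Phi^t_{H_\Lambda}(p,q)=\big(-\nabla_qH_\Lambda(\Phi^t_{H_\Lambda}(p,q)),\nabla_pH_\Lambda(\Phi^t_{H_\Lambda}(p,q))\big)$, $\Phi^0_{H_\Lambda}(p,q)=(p,q)$. The map $\alpha_\Lambda^t$ sends $\pi_\Lambda^*C_{\mathcal R}(\Omega_\Lambda)$ into itself. Limits: $\lim_{\Lambda\nearrow\Gamma}$ is the limit in sup norm of the net indexed by finite subsets $\Lambda\subset\Gamma$ ordered by inclusion. For $f\in\pi_{\Lambda_0}^*C_{\mathcal R}(\Omega_{\Lambda_0})$, $\alpha^t_\Lambda(f)$ is considered for $\Lambda\supseteq\Lambda_0$, where $\pi_{\Lambda_0}^*C_{\mathcal R}(\Omega_{\Lambda_0})\subseteq\pi_\Lambda^*C_{\mathcal R}(\Omega_\Lambda)$. One-parameter group means $\alpha^0=\mathrm{id}$ and $\alpha^{t+t'}=\alpha^t\circ\alpha^{t'}$ for all $t,t'\in\mathbb{R}$. *)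

(* Defs.v *)
From HB Require Import structures.
From mathcomp Require Import all_boot all_order all_algebra finmap.
From mathcomp Require Import complex ring lra.
From mathcomp Require Import all_classical all_reals all_analysis.
From mathcomp Require Import summability.

Set Implicit Arguments.
Unset Strict Implicit.
Unset Printing Implicit Defensive.
Import Order.TTheory GRing.Theory Num.Theory.
Import numFieldNormedType.Exports.

Local Open Scope classical_set_scope.
Local Open Scope ring_scope.
Local Open Scope complex_scope.

(* The usual topology of the complex plane, given by the modulus. *)
HB.instance Definition _ (R : rcfType) := NormedModule.copy R[i] (R[i])^o.

(* Real inner product spaces, not assumed complete. *)
HB.mixin Record NormedModule_hasInner (R : realType) X
    & NormedModule R X := {
  inner : X -> X -> R;
  innerC : forall x y, inner x y = inner y x;
  innerDl : forall x y z, inner (x + y) z = inner x z + inner y z;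
  innerZl : forall a x y, inner (a *: x) y = a * inner x y;
  inner_norm : forall x, inner x x = `|x| ^+ 2
}.

#[short(type="innerProductType")]
HB.structure Definition InnerProduct (R : realType) :=
  {X of NormedModule R X & NormedModule_hasInner R X}.

HB.factory Record Lmodule_isInner (R : realType) X & GRing.Lmodule R X := {
  form : X -> X -> R;
  formC : forall x y, form x y = form y x;
  formDl : forall x y z, form (x + y) z = form x z + form y z;
  formZl : forall a x y, form (a *: x) y = a * form x y;
  form_ge0 : forall x, 0 <= form x x;
  form_eq0 : forall x, form x x = 0 -> x = 0
}.

HB.builders Context R X & Lmodule_isInner R X.

Let norm (x : X) : R := Num.sqrt (form x x).

Let formDr x y z : form x (y + z) = form x y + form x z.
Proof. by rewrite formC formDl !(formC x). Qed.

Let formZr a x y : form x (a *: y) = a * form x y.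
Proof. by rewrite formC formZl formC. Qed.

Let sqr_norm x : norm x ^+ 2 = form x x.
Proof. by rewrite /norm sqr_sqrtr// form_ge0. Qed.

Let normrZ (l : R) (x : X) : norm (l *: x) = `|l| * norm x.
Proof.
by rewrite /norm formZl formZr mulrA -expr2 sqrtrM ?sqr_ge0// sqrtr_sqr.
Qed.

Let norm_eq0 x : norm x = 0 -> x = 0.
Proof.
move=> /eqP; rewrite sqrtr_eq0 => x0; apply: form_eq0.
by apply/eqP; rewrite eq_le x0 form_ge0.
Qed.

Let cauchy_schwarz x y : form x y <= norm x * norm y.
Proof.
have nx : 0 <= norm x by apply: sqrtr_ge0.
have ny : 0 <= norm y by apply: sqrtr_ge0.
have [/norm_eq0 ->|x0] := eqVneq (norm x) 0.
  by rewrite -(scale0r 0) formZl mul0r mulr_ge0// sqrtr_ge0.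
have [/norm_eq0 ->|y0] := eqVneq (norm y) 0.
  by rewrite -(scale0r 0) formZr mul0r mulr_ge0// sqrtr_ge0.
have := form_ge0 (norm y *: x - norm x *: y).
rewrite -scaleNr !(formDl, formDr, formZl, formZr) -!sqr_norm (formC y x).
have xy : 0 < norm x * norm y by rewrite mulr_gt0// lt0r ?x0 ?y0.
move: (norm x) (norm y) (form x y) xy => a b c ab H.
rewrite -(ler_pM2l ab); nra.
Qed.

Let ler_normD x y : norm (x + y) <= norm x + norm y.
Proof.
have nx : 0 <= norm x by apply: sqrtr_ge0.
have ny : 0 <= norm y by apply: sqrtr_ge0.
rewrite -(@ler_pXn2r _ 2%N) ?nnegrE ?addr_ge0 ?sqrtr_ge0//.
rewrite sqr_norm !(formDl, formDr) (formC y x) sqrrD -!sqr_norm.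
have := cauchy_schwarz x y; lra.
Qed.

HB.instance Definition _ :=
  Lmodule_isNormed.Build R X ler_normD normrZ norm_eq0.

Let form_norm x : form x x = `|x| ^+ 2.
Proof. by rewrite -sqr_norm. Qed.

HB.instance Definition _ :=
  NormedModule_hasInner.Build R X formC formDl formZl form_norm.

HB.end.

Section resolvent_algebra.
Context {R : realType} (X : innerProductType R).
Implicit Types (f g : X -> R[i]).

(* Bounded continuous complex functions; the sup norm topology on them is the
   one induced by {uniform X -> R[i]}. *)
Definition Cb : set (X -> R[i]) :=
  [set f | continuous f /\ [bounded f x | x in setT]].

Definition fconj f : X -> R[i] := fun x => conjc (f x).

Definition cstar_subalgebra (A : set (X -> R[i])) :=
  [/\ A `<=` Cb,
      A 0 /\ (forall (a : R[i]) f g, A f -> A g -> A (a *: f + g)),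
      forall f g, A f -> A g -> A (f * g),
      forall f, A f -> A (fconj f) &
      closed (A : set {uniform X -> R[i]})].

Definition resolvent (x : X) (lambda : R) : X -> R[i] :=
  fun y => ('i * lambda%:C - (inner x y)%:C)^-1.

Definition resolvents : set (X -> R[i]) :=
  [set f | exists x lambda, lambda != 0 /\ f = resolvent x lambda].

(* The commutative resolvent algebra of X, as a set of functions; CR X is the
   corresponding type, with the inherited linear and ring structures. *)
Definition CR_set : set (X -> R[i]) := smallest cstar_subalgebra resolvents.

Definition CR_pred : {pred X -> R[i]} := mem CR_set.

Record CR := MkCR { CR_fun :> X -> R[i]; CR_funP : CR_fun \in CR_pred }.

HB.instance Definition _ := [isSub for CR_fun].
HB.instance Definition _ := [Choice of CR by <:].

Lemma CR_submod_subproof : GRing.submod_closed CR_pred.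
Proof.
split.
  rewrite /CR_pred; apply/mem_set => A [[_ [A0 _] _ _ _] _]; exact: A0.
move=> a f g /set_mem fA /set_mem gA; apply/mem_set => A HA.
have [[_ [_ AD] _ _ _] _] := HA.
by apply: AD; [exact: fA|exact: gA].
Qed.

HB.instance Definition _ :=
  GRing.isSubmodClosed.Build R[i] (X -> R[i]) CR_pred CR_submod_subproof.


Lemma CR_conj_subproof f : f \in CR_pred -> fconj f \in CR_pred.
Proof.
move=> /set_mem fA; apply/mem_set => A HA.
by have [[_ _ _ Aconj _] _] := HA; apply: Aconj; exact: fA.
Qed.

Lemma resolvent_CR x lambda : lambda != 0 -> resolvent x lambda \in CR_pred.
Proof.
move=> l0; apply/mem_set => A [_ resA]; apply: resA.
by exists x, lambda.
Qed.

Lemma CR_subring_subproof : GRing.subring_closed CR_pred.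
Proof.
have [h0 hD] := CR_submod_subproof.
split.
- have -> : (1 : X -> R[i]) = 'i *: resolvent 0 1 + 0.
    apply/funext => y; rewrite addr0 /resolvent scalrfctE /=.
    have -> : inner 0 y = 0 by rewrite -(scale0r 0) innerZl mul0r.
    by rewrite subr0 mulr1 -[_ *: _]/(_ * _) divff// neq0Ci.
  by apply: hD => //; apply: resolvent_CR; exact: oner_neq0.
- move=> f g hf hg; rewrite addrC -scaleN1r; exact: hD.
- move=> f g /set_mem fA /set_mem gA; apply/mem_set => A HA.
  have [[_ _ AM _ _] _] := HA.
  by apply: AM; [exact: fA|exact: gA].
Qed.

HB.instance Definition _ :=
  GRing.isSubringClosed.Build (X -> R[i]) CR_pred CR_subring_subproof.

HB.instance Definition _ := [SubChoice_isSubLmodule of CR by <:].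
HB.instance Definition _ :=
  GRing.SubZmodule_isSubPzRing.Build _ _ CR (GRing.subringClosedP _).

Definition CR_conj (f : CR) : CR := MkCR (CR_conj_subproof (CR_funP f)).

End resolvent_algebra.

(* CR X is a genuine algebra of bounded continuous functions: the intersection
   defining CR_set ranges over a nonempty family. *)
Section CR_sub_Cb.
Context {R : realType} (X : innerProductType R).

Lemma inner_continuous (x : X) : continuous (inner x : X -> R).
Proof.
have -> : (inner x : X -> R) = fun y => 2^-1 * (`|x + y| ^+ 2 - `|x| ^+ 2 - `|y| ^+ 2).
  apply/funext => y; rewrite -!inner_norm innerDl !(innerC _ (x + y)) !innerDl (innerC y x).
  lra.
move=> y; apply: cvgM; first exact: cvg_cst.
have ny : `|z| @[z --> y] --> `|y| by exact: norm_continuous.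
have nxy : `|x + z| @[z --> y] --> `|x + y|.
  by apply: cvg_norm; apply: cvgD; [exact: cvg_cst|exact: cvg_id].
apply: cvgB; [apply: cvgB; [exact: (cvgM nxy nxy)|exact: cvg_cst]|exact: (cvgM ny ny)].
Qed.

Lemma real_complex_continuous : continuous (fun r : R => r%:C : R[i]).
Proof.
move=> r; apply/cvgrPdist_lt => e e0.
have [e' ee'] : exists e' : R, e = e'%:C.
  by exists (complex.Re e); case: e e0 => a b; rewrite ltcE /= => /andP[/eqP -> _].
have e'0 : 0 < e' by move: e0; rewrite ee' ltcR.
rewrite ee'.
near=> s.
rewrite -rmorphB normc_def /= expr0n addr0 sqrtr_sqr ltcR.
by near: s; apply: cvgr_dist_lt => //; exact: cvg_id.
Unshelve. all: by end_near. Qed.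

Lemma resolvents_Cb : @resolvents R X `<=` @Cb R X.
Proof.
move=> _ [x [l [l0 ->]]].
have nz y : 'i * l%:C - (inner x y)%:C != 0 :> R[i].
  apply/eqP => /(congr1 (@complex.Im R)) /=.
  by rewrite !(mul0r, mulr0, mul1r, addr0, add0r, subr0, oppr0) => /eqP; rewrite (negbTE l0).
split.
  move=> y; apply: cvgV => //; apply: cvgB; first exact: cvg_cst.
  apply: (@continuous_comp _ _ _ (inner x) (fun r : R => r%:C : R[i])).
    exact: inner_continuous.
  exact: real_complex_continuous.
exists (`|l|^-1)%:C; split; first by rewrite complex_real.
move=> M lM y _ /=; apply: le_trans (ltW lM).
rewrite /resolvent normfV.
have -> : (`|l|^-1)%:C = (`|l|%:C)^-1 :> R[i] by rewrite fmorphV.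
rewrite lef_pV2 ?posrE ?normr_gt0//; last by rewrite ltcR normr_gt0.
rewrite normc_def /= lecR !(mul0r, mulr0, mul1r, addr0, add0r, subr0, oppr0, sub0r).
rewrite -[leLHS]sqrtr_sqr; apply: ler_wsqrtr.
by rewrite ?sqrrN lerDr sqr_ge0.
Qed.

Lemma CbP (f : X -> R[i]) : Cb f <->
  continuous f /\ exists M : R, forall x, `|f x| <= M%:C.
Proof.
split=> -[cf]; last first.
  case=> M fM; split=> //; exists M%:C; split; first by rewrite complex_real.
  by move=> N MN y _ /=; apply: le_trans (ltW MN).
move=> [M [Mr fM]]; split=> //; exists (complex.Re M + 1) => x.
apply: fM => //; case: M Mr => a b /=; rewrite complex_real /= => /eqP ->.
by rewrite ltcR ltrDl.
Qed.

Lemma Cb_cstar_subalgebra : cstar_subalgebra (@Cb R X).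
Proof.
have normconj (z : R[i]) : `|conjc z| = `|z|.
  by rewrite !normc_def; case: z => a b /=; rewrite sqrrN.
have normE (z : R[i]) : exists r : R, `|z| = r%:C.
  by rewrite normc_def; eexists.
split=> //.
- split; first by split; [move=> x; exact: cvg_cst|exact: bounded_cst].
  move=> a f g /CbP[cf [M fM]] /CbP[cg [N gN]]; apply/CbP; split.
    by move=> x; apply: cvgD; [apply: cvgZr; exact: cf|exact: cg].
  have [r ar] := normE a; exists (r * M + N) => x.
  rewrite rmorphD rmorphM /= -ar (le_trans (ler_normD _ _))// lerD//.
  by rewrite normrM ler_wpM2l.
- move=> f g /CbP[cf [M fM]] /CbP[cg [N gN]]; apply/CbP; split.
    by move=> x; apply: cvgM; [exact: cf|exact: cg].
  by exists (M * N) => x; rewrite rmorphM normrM ler_pM.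
- move=> f /CbP[cf [M fM]]; apply/CbP; split.
    move=> x; apply/cvgrPdist_lt => e e0.
    have := cf x; move/cvgrPdist_lt => /(_ _ e0); apply: filterS => y.
    by rewrite /fconj -rmorphB normconj.
  by exists M => y; rewrite /fconj normconj.
- move=> f clf; apply/CbP; split.
    move: (clf); rewrite closureEcvg => -[G PG [Gf CbG]].
    by apply: (uniform_limit_continuous (V := R[i]) PG) => //; apply: CbG => g [].
  have [g [/CbP[_ [M gM]] fg]] : @Cb R X `&`
      [set g | forall y, `|f y - g y| < 1] !=set0.
    apply: clf; apply/uniform_nbhs.
    exists [set xy | `|xy.1 - xy.2| < 1]; split; last first.
      by move=> h /= hf y; exact: hf.
    by rewrite -entourage_ballE; exists 1 => //= -[a b] /=; rewrite -ball_normE.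
  exists (1 + M) => x; rewrite rmorphD -(subrK (g x) (f x)).
  by rewrite (le_trans (ler_normD _ _))// lerD// ltW// fg.
Qed.
Lemma CR_sub_Cb (f : CR X) : Cb (f : X -> R[i]).
Proof.
have /set_mem := CR_funP f; apply; split; last exact: resolvents_Cb.
exact: Cb_cstar_subalgebra.
Qed.

End CR_sub_Cb.

Section phase_space.
Context (R : realType) (d : nat) (Gamma : countType).
Local Notation E := ('rV[R]_d * 'rV[R]_d)%type.
Implicit Types (k l : Gamma) (L : {fset Gamma}).

(* The norm that MathComp-Analysis puts on 'rV[R]_d is the sup norm; the
   Euclidean structure is given by dotrv. *)
Definition dotrv (u v : 'rV[R]_d) : R := \sum_i u ord0 i * v ord0 i.

Lemma dotrvC u v : dotrv u v = dotrv v u.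
Proof. by apply: eq_bigr => i _; rewrite mulrC. Qed.

Lemma dotrvDl u v w : dotrv (u + v) w = dotrv u w + dotrv v w.
Proof. by rewrite -big_split; apply: eq_bigr => i _; rewrite mxE mulrDl. Qed.

Lemma dotrvZl a u v : dotrv (a *: u) v = a * dotrv u v.
Proof. by rewrite mulr_sumr; apply: eq_bigr => i _; rewrite mxE mulrA. Qed.

Lemma dotrv_ge0 u : 0 <= dotrv u u.
Proof. by apply: sumr_ge0 => i _; rewrite -expr2 sqr_ge0. Qed.

Lemma dotrv_eq0 u : dotrv u u = 0 -> u = 0.
Proof.
move=> /eqP; rewrite psumr_eq0 => [/allP u0|i _]; last by rewrite -expr2 sqr_ge0.
apply/rowP => i; rewrite mxE; apply/eqP.
by have := u0 i (mem_index_enum i); rewrite mulf_eq0 orbb.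
Qed.

Definition dotE (u v : E) : R := dotrv u.1 v.1 + dotrv u.2 v.2.

Lemma dotE_ge0 u : 0 <= dotE u u.
Proof. by rewrite addr_ge0 ?dotrv_ge0. Qed.

Lemma dotE_eq0 u : dotE u u = 0 -> u = 0.
Proof.
move=> /eqP; rewrite paddr_eq0 ?dotrv_ge0// => /andP[/eqP u1 /eqP u2].
by case: u u1 u2 => a b /= /dotrv_eq0 -> /dotrv_eq0 ->.
Qed.

Lemma dotE0 u : dotE 0 u = 0.
Proof.
by rewrite /dotE /dotrv !big1 ?addr0// => i _; rewrite mxE mul0r.
Qed.

Definition finsupp_pred : {pred Gamma -> E} :=
  fun x => `[< finite_set [set k | x k != 0] >].

(* A pair (p, q) of finitely supported sequences in R^d is represented by the
   finitely supported sequence of pairs k |-> (p_k, q_k). *)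
Record Omega := MkOmega {
  Omega_fun :> Gamma -> E;
  Omega_funP : Omega_fun \in finsupp_pred }.

HB.instance Definition _ := [isSub for Omega_fun].
HB.instance Definition _ := [Choice of Omega by <:].

Lemma finsupp_submod_subproof : GRing.submod_closed finsupp_pred.
Proof.
split=> [|a x y /asboolP fx /asboolP fy]; apply/asboolP.
  rewrite (_ : [set _ | _] = set0)//; apply/seteqP; split=> // k /=.
  by rewrite eqxx.
apply: (@sub_finite_set _ _ ([set k | x k != 0] `|` [set k | y k != 0])).
  move=> k axy; have [xk|xk] := eqVneq (x k) 0; [right|by left].
  apply: contra axy => /eqP yk.
  by rewrite -[X in X == _]/(a *: x k + y k) xk yk scaler0 addr0.
by rewrite finite_setU.
Qed.

HB.instance Definition _ :=
  GRing.isSubmodClosed.Build R (Gamma -> E) finsupp_pred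
    finsupp_submod_subproof.
HB.instance Definition _ := [SubChoice_isSubLmodule of Omega by <:].

Definition Omega_p (x : Omega) k : 'rV[R]_d := (x k).1.
Definition Omega_q (x : Omega) k : 'rV[R]_d := (x k).2.

(* The inner product of l^2(Gamma, R^(2d)); the sum has finite support. *)
Definition Omega_form (x y : Omega) : R :=
  \sum_(k \in [set: Gamma])
    (dotrv (Omega_p x k) (Omega_p y k) + dotrv (Omega_q x k) (Omega_q y k)).

Definition Omega_supp (x : Omega) : {fset Gamma} := fset_set [set k | x k != 0].

Lemma Omega_suppP x k : k \notin Omega_supp x -> x k = 0.
Proof.
rewrite in_fset_set; last exact/asboolP/(Omega_funP x).
by rewrite notin_setE /= => /negP; rewrite negbK => /eqP.
Qed.

Lemma Omega_formE L (x y : Omega) : (forall k, k \notin L -> x k = 0) ->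
  Omega_form x y = \sum_(k <- L) dotE (x k) (y k).
Proof.
move=> xL; rewrite /Omega_form -(fsbig_widen [set` L])//.
  by rewrite fsbig_finite ?set_fsetK//; exact: finite_fset.
by move=> k [_ /= /negP /xL xk]; rewrite -[LHS]/(dotE (x k) (y k)) xk dotE0.
Qed.

Lemma Omega_formC x y : Omega_form x y = Omega_form y x.
Proof. by apply: eq_fsbigr => k _; rewrite (dotrvC (Omega_p x k)) (dotrvC (Omega_q x k)). Qed.

Lemma Omega_formDl x y z :
  Omega_form (x + y) z = Omega_form x z + Omega_form y z.
Proof.
pose L := (Omega_supp x `|` Omega_supp y)%fset.
have xL k : k \notin L -> x k = 0.
  by rewrite inE negb_or => /andP[/Omega_suppP].
have yL k : k \notin L -> y k = 0.
  by rewrite inE negb_or => /andP[_ /Omega_suppP].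
have xyL k : k \notin L -> (x + y) k = 0.
  by move=> kL; rewrite -[LHS]/(x k + y k) xL// yL// addr0.
rewrite !(Omega_formE (L := L))// -big_split; apply: eq_bigr => k _.
by rewrite -[LHS]/(dotE (x k + y k) (z k)) /dotE !dotrvDl addrACA.
Qed.

Lemma Omega_formZl a x y : Omega_form (a *: x) y = a * Omega_form x y.
Proof.
have xL := @Omega_suppP x.
have axL k : k \notin Omega_supp x -> (a *: x) k = 0.
  by move=> kL; rewrite -[LHS]/(a *: x k) xL// scaler0.
rewrite (Omega_formE _ axL) (Omega_formE _ xL) mulr_sumr.
apply: eq_bigr => k _.
by rewrite -[LHS]/(dotE (a *: x k) (y k)) /dotE !dotrvZl mulrDr.
Qed.

Lemma Omega_form_ge0 x : 0 <= Omega_form x x.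
Proof.
rewrite (Omega_formE _ (@Omega_suppP x)).
by apply: sumr_ge0 => k _; exact: dotE_ge0.
Qed.

Lemma Omega_form_eq0 x : Omega_form x x = 0 -> x = 0.
Proof.
rewrite (Omega_formE _ (@Omega_suppP x)) => /eqP.
rewrite psumr_eq0 => [/allP x0|k _]; last exact: dotE_ge0.
apply/val_inj/funext => k; rewrite -[LHS]/(x k) -[RHS]/(0 : E).
have [kx|/Omega_suppP//] := boolP (k \in Omega_supp x).
by apply: dotE_eq0; apply/eqP; exact: x0.
Qed.

HB.instance Definition _ := Lmodule_isInner.Build R Omega
  Omega_formC Omega_formDl Omega_formZl Omega_form_ge0 Omega_form_eq0.

Section local.
Variable L : {fset Gamma}.

Definition local_pred : {pred Omega} :=
  fun x => `[< forall k, k \notin L -> x k = 0 >].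

Record Omega_loc := MkOmega_loc {
  Omega_incl :> Omega;
  Omega_inclP : Omega_incl \in local_pred }.

HB.instance Definition _ := [isSub for Omega_incl].
HB.instance Definition _ := [Choice of Omega_loc by <:].

Lemma local_submod_subproof : GRing.submod_closed local_pred.
Proof.
split=> [|a x y /asboolP xL /asboolP yL]; apply/asboolP => // k kL.
by rewrite -[LHS]/(a *: x k + y k) xL// yL// scaler0 addr0.
Qed.

HB.instance Definition _ :=
  GRing.isSubmodClosed.Build R Omega local_pred local_submod_subproof.
HB.instance Definition _ := [SubChoice_isSubLmodule of Omega_loc by <:].

Definition Omega_loc_form (x y : Omega_loc) : R :=
  inner (Omega_incl x) (Omega_incl y).

Lemma Omega_loc_formC x y : Omega_loc_form x y = Omega_loc_form y x.
Proof. exact: innerC. Qed.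

Lemma Omega_loc_formDl x y z :
  Omega_loc_form (x + y) z = Omega_loc_form x z + Omega_loc_form y z.
Proof. exact: innerDl. Qed.

Lemma Omega_loc_formZl a x y :
  Omega_loc_form (a *: x) y = a * Omega_loc_form x y.
Proof. exact: innerZl. Qed.

Lemma Omega_loc_form_ge0 x : 0 <= Omega_loc_form x x.
Proof. exact: Omega_form_ge0. Qed.

Lemma Omega_loc_form_eq0 x : Omega_loc_form x x = 0 -> x = 0.
Proof. by move=> /Omega_form_eq0 x0; exact: val_inj. Qed.

HB.instance Definition _ := Lmodule_isInner.Build R Omega_loc
  Omega_loc_formC Omega_loc_formDl Omega_loc_formZl
  Omega_loc_form_ge0 Omega_loc_form_eq0.

Definition restr_fun (F : Gamma -> E) : Gamma -> E :=
  fun k => if k \in L then F k else 0.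

Lemma restr_fun_finsupp F : restr_fun F \in finsupp_pred.
Proof.
apply/asboolP; apply: (@sub_finite_set _ _ [set` L]); last exact: finite_fset.
by move=> k /=; rewrite /restr_fun; case: ifP => // _; rewrite eqxx.
Qed.

Lemma restr_fun_local F : MkOmega (restr_fun_finsupp F) \in local_pred.
Proof. by apply/asboolP => k kL /=; rewrite /restr_fun (negbTE kL). Qed.

Definition restr (F : Gamma -> E) : Omega_loc := MkOmega_loc (restr_fun_local F).

(* Orthogonal projection onto Omega_loc, see proj_orthogonal. *)
Definition proj (x : Omega) : Omega_loc := restr x.

Lemma proj_orthogonal (x : Omega) (y : Omega_loc) :
  inner (x - Omega_incl (proj x)) (Omega_incl y) = 0.
Proof.
rewrite innerC -[LHS]/(Omega_form _ _) (@Omega_formE L).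
  rewrite big_seq big1// => k kL.
  rewrite -[LHS]/(dotE (y k) (x k - (if k \in L then x k else 0))) kL subrr.
  by rewrite /dotE !(dotrvC (_ (y k))) -[LHS]/(dotE 0 (y k)) dotE0.
by move=> k kL; move/asboolP: (Omega_inclP y) => /(_ k kL).
Qed.

Lemma Omega_inclK : cancel Omega_incl proj.
Proof.
move=> y; apply/val_inj/val_inj/funext => k /=; rewrite /restr_fun.
by case: ifPn => // kL; move/asboolP: (Omega_inclP y) => /(_ k kL).
Qed.

End local.
End phase_space.

Section smooth.
Context (R : realType) (d : nat).
Implicit Types f : 'rV[R]_d -> R.

Definition partial (i : 'I_d) f : 'rV[R]_d -> R :=
  fun x => 'D_(delta_mx ord0 i) f x.

Definition mpartial (beta : {ffun 'I_d -> nat}) f : 'rV[R]_d -> R :=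
  foldr (fun i g => iter (beta i) (partial i) g) f (enum 'I_d).

(* Functions of class C^n: all iterated partial derivatives up to order n exist
   everywhere and are continuous. *)
Fixpoint Ck (n : nat) f : Prop :=
  if n is n'.+1 then
    continuous f /\
    forall i, (forall x, derivable f x (delta_mx ord0 i)) /\ Ck n' (partial i f)
  else continuous f.

Definition smooth f := forall n, Ck n f.

Definition vanishes_at_infinity f :=
  forall e : R, 0 < e -> compact [set x | e <= `|f x|].

Definition C0_smooth f := smooth f /\ vanishes_at_infinity f.

End smooth.

Section hamiltonian_flow.
Context (R : realType) (d : nat) (Gamma : countType) (L : {fset Gamma}).
Local Notation OmegaL := (Omega_loc R d L).
Implicit Types (H : OmegaL -> R) (x : OmegaL).

(* The coordinate directions of p_k and q_k in Omega_loc, for k in L. *)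
Definition dir_p (k : Gamma) (i : 'I_d) : OmegaL :=
  restr L (fun l => if l == k then (delta_mx ord0 i, 0) else 0).

Definition dir_q (k : Gamma) (i : 'I_d) : OmegaL :=
  restr L (fun l => if l == k then (0, delta_mx ord0 i) else 0).

Definition grad_p H x (k : Gamma) : 'rV[R]_d := \row_i 'D_(dir_p k i) H x.
Definition grad_q H x (k : Gamma) : 'rV[R]_d := \row_i 'D_(dir_q k i) H x.

(* Sign convention: dp/dt = - grad_q H and dq/dt = grad_p H. *)
Definition hamiltonian_field H x : OmegaL :=
  restr L (fun k => (- grad_q H x k, grad_p H x k)).

Definition hamiltonian_curve H x : set (R -> OmegaL) :=
  [set c | c 0 = x /\
    forall s : R, is_derive s (1 : R) c (hamiltonian_field H (c s))].

(* The value at time t of the global solution starting at x; the default value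
   cst x is only taken when no global solution exists. *)
Definition hamiltonian_flow H (t : R) x : OmegaL :=
  xget (cst x) (hamiltonian_curve H x) t.

End hamiltonian_flow.

Section dynamics.
Context (R : realType) (d : nat) (Gamma : countType).
Variables (m nu : Gamma -> R) (V : Gamma -> Gamma -> 'rV[R]_d -> R).
Local Notation Omega := (Omega R d Gamma).

Definition local_hamiltonian (L : {fset Gamma}) (x : Omega_loc R d L) : R :=
  \sum_(k <- L) (dotrv (Omega_p x k) (Omega_p x k) / (2 * m k)
                 + nu k * dotrv (Omega_q x k) (Omega_q x k) / 2)
  + \sum_(k <- L) \sum_(l <- L) V k l (Omega_q x k - Omega_q x l).

(* On functions of the form f \o proj L this is the local time evolution
   (local_evolutionE); other values are irrelevant. *)
Definition local_evolution (L : {fset Gamma}) (t : R) (f : Omega -> R[i]) :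
    Omega -> R[i] :=
  fun x => f (hamiltonian_flow (@local_hamiltonian L) t (proj L x)).

Lemma local_evolutionE (L : {fset Gamma}) t (f : Omega_loc R d L -> R[i]) :
  local_evolution L t (f \o proj L) =
  f \o hamiltonian_flow (@local_hamiltonian L) t \o proj L.
Proof. by apply/funext => x; rewrite /local_evolution /= Omega_inclK. Qed.

(* The filter totally is the one of the net of finite subsets of Gamma ordered
   by inclusion; the sets L that do not contain L0 do not matter for it. *)
Definition is_limit_of_local_evolutions (t : R) (alpha : CR Omega -> CR Omega) :=
  forall (L0 : {fset Gamma}) (g : CR (Omega_loc R d L0)) (f : CR Omega),
    f = g \o proj L0 :> (Omega -> R[i]) ->
    {uniform, local_evolution L t f @[L --> totally]
      --> (alpha f : Omega -> R[i])}.

End dynamics.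

Definition star_isomorphism (R : realType) (X Y : innerProductType R)
    (phi : CR X -> CR Y) :=
  [/\ linear phi, {morph phi : f g / f * g},
      {morph phi : f / CR_conj f} & bijective phi].

Definition one_parameter_group (R : realType) (T : Type) (alpha : R -> T -> T) :=
  alpha 0 = id /\ forall t t', alpha (t + t') = alpha t \o alpha t'.

(* Main.v *)
(* In the interaction picture, where the harmonic motion is factored out, each
   coordinate moves only under the bounded interaction forces. Two facts drive
   the proof.

   1. A bounded function [F] on an inner product space lies in the resolvent
   algebra as soon as, for every error, finitely many functionals control it:
   [F x] and [F x'] are close whenever [inner y x] and [inner y x'] are
   relatively close for these [y]. For a local evolution at small times, take
   for [y] the derivatives up to order three, at time [0], of the free relative
   motions q_k - q_l. If one of them is large, the relative motion is fast and,
   by van der Corput's lemma, spends little time where the vanishing force is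
   not small; if all are small, the two free relative motions are uniformly
   close. In both cases the accumulated forces are close.

   2. By summability of the couplings, the motion of finitely many sites over a
   short time depends, uniformly in the initial state, only up to a small error
   on the sites outside a large finite set. Hence the local evolutions of
   resolvents form Cauchy nets.

   Both facts extend from resolvents to the algebra and, by the group law, to
   all times, which makes the limits a one-parameter group. Star-isomorphisms
   are contractive (a Neumann series inverts [phi f x - f]), so they are
   determined by their values on resolvents, which are local functions. *)
Require Import Defs.
From HB Require Import structures.
From mathcomp Require Import all_boot all_order all_algebra finmap.
From mathcomp Require Import complex ring lra.
From mathcomp Require Import all_classical all_reals all_analysis.
From mathcomp Require Import summability.

Set Implicit Arguments.
Unset Strict Implicit.
Unset Printing Implicit Defensive.
Import Order.TTheory GRing.Theory Num.Theory.
Import numFieldNormedType.Exports.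

Local Open Scope classical_set_scope.
Local Open Scope ring_scope.
Local Open Scope complex_scope.

Section real_derivatives.
Context {R : realType}.
Implicit Types (f g : R -> R) (a b s t : R).

Lemma is_derive_fun_cst a s : is_derive s (1 : R) (fun _ : R => a) 0.
Proof. exact: is_derive_cst. Qed.

Lemma is_derive_fun_id s : is_derive s (1 : R) (fun u : R => u) 1.
Proof. exact: is_derive_id. Qed.

Lemma is_derive_funD f g s a b : is_derive s 1 f a -> is_derive s 1 g b ->
  is_derive s 1 (fun u => f u + g u) (a + b).
Proof. by move=> fa gb; exact: is_deriveD. Qed.

Lemma is_derive_funN f s a : is_derive s 1 f a ->
  is_derive s 1 (fun u => - f u) (- a).
Proof. by move=> fa; exact: is_deriveN. Qed.

Lemma is_derive_funB f g s a b : is_derive s 1 f a -> is_derive s 1 g b ->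
  is_derive s 1 (fun u => f u - g u) (a - b).
Proof. by move=> fa gb; exact: is_deriveB. Qed.

Lemma is_derive_funM f g s a b : is_derive s 1 f a -> is_derive s 1 g b ->
  is_derive s 1 (fun u => f u * g u) (a * g s + f s * b).
Proof.
move=> fa gb; apply: (@is_derive_eq _ _ _ _ _ _ _ _ (is_deriveM fa gb)).
by rewrite addrC [g s *: a]mulrC.
Qed.

Lemma is_derive_funZ k f s a : is_derive s 1 f a ->
  is_derive s 1 (fun u => k * f u) (k * a).
Proof. by move=> fa; exact: is_deriveZ. Qed.

Lemma is_derive_fun_sum (I : Type) (r : seq I) (F : I -> R -> R) (dF : I -> R) s :
  (forall i, is_derive s 1 (F i) (dF i)) ->
  is_derive s 1 (fun u => \sum_(i <- r) F i u) (\sum_(i <- r) dF i).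
Proof.
move=> dFi; elim: r => [|i r ih].
  rewrite big_nil (_ : (fun _ => _) = fun=> 0) //; last by apply/funext => u; rewrite big_nil.
  exact: is_derive_cst.
rewrite big_cons (_ : (fun _ => _) = fun u => F i u + \sum_(j <- r) F j u).
  exact: is_derive_funD.
by apply/funext => u; rewrite big_cons.
Qed.

Lemma is_derive_continuous f f' : (forall s, is_derive s 1 f (f' s)) -> continuous f.
Proof.
by move=> df s; apply/differentiable_continuous/derivable1_diffP; have [] := df s.
Qed.

Lemma ge0_derive_le f f' a b : a <= b ->
  (forall s, is_derive s 1 f (f' s)) -> (forall s, a <= s <= b -> 0 <= f' s) ->
  f a <= f b.
Proof.
move=> ab df f0; have [|c cab e] := MVT_segment (f := f) (df := f') ab (fun s _ => df s).
  by apply/continuous_subspaceT; exact: is_derive_continuous df.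
by rewrite -subr_ge0 e mulr_ge0 ?subr_ge0// f0// -in_itv.
Qed.

Lemma ler_dist_derive f g f' g' a b : a <= b ->
  (forall s, is_derive s 1 f (f' s)) -> (forall s, is_derive s 1 g (g' s)) ->
  (forall s, a <= s <= b -> `|f' s| <= g' s) ->
  `|f b - f a| <= g b - g a.
Proof.
move=> ab df dg fg.
have h1 := ge0_derive_le ab (fun s => is_derive_funB (dg s) (df s)).
have h2 := ge0_derive_le ab (fun s => is_derive_funD (dg s) (df s)).
have {}h1 : g a - f a <= g b - f b.
  by apply: h1 => s /fg; rewrite subr_ge0; apply: le_trans; exact: ler_norm.
have {}h2 : g a + f a <= g b + f b.
  by apply: h2 => s /fg; rewrite ler_norml => /andP[+ _]; lra.
by rewrite ler_norml; apply/andP; split; lra.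
Qed.

(* The form of Gronwall's argument used on short time intervals: it avoids
   suprema, since an a priori bound is all that is needed. *)
Lemma halving (P : R -> Prop) (c a0 e : R) : 0 < e -> P a0 ->
  (forall a, P a -> P (c + a / 2)) -> (forall a b, a <= b -> P a -> P b) ->
  P (2 * c + e).
Proof.
move=> e0 Pa0 Pc Pm.
have Pn n : P (2 * c + (a0 - 2 * c) / 2 ^+ n).
  elim: n => [|n /Pc]; first by rewrite expr0 divr1 addrC subrK.
  by congr P; rewrite exprS; field; rewrite expf_neq0.
have [N hN] : exists n, (a0 - 2 * c) / 2 ^+ n <= e.
  have [n hn] : exists n : nat, (a0 - 2 * c) / e < n%:R.
    exists (Num.bound `|(a0 - 2 * c) / e|).
    by apply: le_lt_trans (ler_norm _) _; exact: archi_boundP.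
  exists n; rewrite ler_pdivrMr ?exprn_gt0// [leRHS]mulrC -ler_pdivrMr//.
  apply/ltW/(lt_le_trans hn).
  by rewrite -natrX ler_nat ltnW// ltn_expl.
by apply: Pm (Pn N); rewrite lerD2l.
Qed.

End real_derivatives.

Section antiderivatives.
Context {R : realType}.

Lemma half_line_primitive (f : R -> R) : continuous f ->
  exists F : R -> R, forall s : R, -1 < s -> is_derive s 1 F (f s).
Proof.
move=> cf; exists (fun x => \int[lebesgue_measure]_(t in `[-1, x]) f t)%R => s s1.
have fi : (lebesgue_measure (R := R)).-integrable `[-1, s + 1] (EFin \o f).
  apply: continuous_compact_integrable; first exact: segment_compact.
  exact: continuous_subspaceT.
have ss1 : s < s + 1 by lra.
have [dF F'] := continuous_FTC1_closed ss1 fi s1 (cf s).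
by apply: DeriveDef; [exact: dF|rewrite -derive1E; exact: F'].
Qed.

Lemma continuous_primitive (f : R -> R) : continuous f ->
  exists F : R -> R, F 0 = 0 /\ forall s : R, is_derive s 1 F (f s).
Proof.
move=> cf.
have [G dG] := half_line_primitive cf.
have cf' : continuous (fun s => - f (- s)).
  by move=> s; apply: cvgN; apply: continuous_comp; [exact: opp_continuous|exact: cf].
have [K dK] := half_line_primitive cf'.
have dKN (s : R) : s < 1 -> is_derive s 1 (fun u => K (- u)) (f s).
  move=> s1; have dK' : is_derive (- s) 1 K (- f (- - s)) by apply: dK; lra.
  have := is_derive1_comp dK' (is_deriveNid s 1).
  by move/is_derive_eq; apply; rewrite opprK mulrN1 opprK.
pose F s := if 0 <= s then G s - G 0 else K (- s) - K 0.
have FG (s : R) : -1 < s -> F s = G s - G 0.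
  move=> s1; rewrite /F; case: ifPn => //; rewrite -ltNge => s0.
  have dH u : u \in `]s, 0[ -> is_derive u 1 (fun v => K (- v) - G v) 0.
    rewrite in_itv /= => /andP[su u0]; rewrite -(subrr (f u)).
    by apply: is_derive_funB; [apply: dKN; lra|apply: dG; lra].
  have cH : {within `[s, 0], continuous (fun v => K (- v) - G v)}.
    apply: derivable_within_continuous => u; rewrite in_itv /= => /andP[su u0].
    have d1 : is_derive u 1 (fun v => K (- v)) (f u) by apply: dKN; lra.
    have d2 : is_derive u 1 G (f u) by apply: dG; lra.
    by have [] := is_derive_funB d1 d2.
  have [c _] := MVT_segment (df := fun=> 0) (ltW s0) dH cH.
  by rewrite mul0r oppr0; lra.
exists F; split; first by rewrite FG ?subrr//; lra.
move=> s; have [s0|s0] := leP 0 s.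
  have s1 : -1 < s by lra.
  apply: (@near_eq_is_derive _ _ _ (fun u => G u - G 0)).
    by near=> u; rewrite FG//; near: u; exact: lt_nbhsr.
  by have := is_derive_funB (dG _ s1) (is_derive_fun_cst (G 0) s); rewrite subr0.
apply: (@near_eq_is_derive _ _ _ (fun u => K (- u) - K 0)).
  near=> u; rewrite /F ifF//; apply/negbTE; rewrite -ltNge; near: u.
  exact: lt_nbhsl.
have s1 : s < 1 by lra.
by have := is_derive_funB (dKN _ s1) (is_derive_fun_cst (K 0) s); rewrite subr0.
Unshelve. all: by end_near. Qed.

End antiderivatives.

Section picard.
Context {R : realType}.

Lemma geometric_limit (u : nat -> R) a : (forall n, `|u n.+1 - u n| <= a / 2 ^+ n) ->
  exists l, forall n, `|l - u n| <= 2 * a / 2 ^+ n.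
Proof.
move=> ua.
pose v n := u n - 2 * a / 2 ^+ n; pose w n := u n + 2 * a / 2 ^+ n.
have halve n : 2 * a / 2 ^+ n.+1 = a / 2 ^+ n.
  by rewrite exprS; field; rewrite expf_neq0.
have dbl n : 2 * a / 2 ^+ n = a / 2 ^+ n + a / 2 ^+ n by rewrite -mulrA mulr_natl mulr2n.
have vS n : v n <= v n.+1.
  by have := ua n; rewrite ler_norml /v halve dbl; lra.
have wS n : w n.+1 <= w n.
  by have := ua n; rewrite ler_norml /w halve dbl; lra.
have a0 : 0 <= a by have := ua 0%N; rewrite expr0 divr1; exact: le_trans.
have vw n : v n <= w n.
  have q0 : 0 <= a / 2 ^+ n by rewrite divr_ge0 ?exprn_ge0.
  by rewrite /v /w dbl; lra.
have vle m n : (m <= n)%N -> v m <= v n.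
  by move=> /subnK <-; elim: (n - m)%N => // k /le_trans; apply; rewrite addSn.
have wle m n : (m <= n)%N -> w n <= w m.
  by move=> /subnK <-; elim: (n - m)%N => // k /(le_trans _); apply; rewrite addSn.
have vw' m n : v m <= w n.
  have h1 := vle _ _ (leq_maxl m n); have h2 := wle _ _ (leq_maxr m n).
  exact: le_trans h1 (le_trans (vw _) h2).
have hs : has_sup (range v).
  by split; [exists (v 0%N); exists 0%N|exists (w 0%N) => _ [m _ <-]].
exists (sup (range v)) => n; rewrite ler_norml.
have h1 : v n <= sup (range v) by apply: ub_le_sup; [case: hs|exists n].
have h2 : sup (range v) <= w n by apply: ge_sup; [case: hs|move=> _ [m _ <-]].
by move: h1 h2; rewrite /v /w; lra.
Qed.

Lemma le_geometric_eq0 (x b : R) : (forall n, `|x| <= b / 2 ^+ n) -> x = 0.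
Proof.
move=> xb; apply/eqP; rewrite -normr_le0; apply/ler_addgt0Pr => e e0.
have [N /ltW hn] : exists n : nat, b / e < n%:R.
  exists (Num.bound `|b / e|); apply: le_lt_trans (ler_norm _) _; exact: archi_boundP.
rewrite add0r (le_trans (xb N))// ler_pdivrMr ?exprn_gt0// [leRHS]mulrC -ler_pdivrMr//.
by apply: le_trans hn _; rewrite -natrX ler_nat ltnW// ltn_expl.
Qed.

Lemma is_derive_expRM (k s : R) : is_derive s 1 (fun u => expR (k * u)) (expR (k * s) * k).
Proof.
have := is_derive1_comp (is_derive_expR (k * s)) (is_derive_funZ k (is_derive_fun_id s)).
by rewrite mulr1.
Qed.

Lemma weighted_primitive_bound (f f' : R -> R) (k b : R) : 0 < k ->
  f 0 = 0 -> (forall s : R, is_derive s 1 f (f' s)) ->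
  (forall s, `|f' s| <= b * expR (k * `|s|)) ->
  forall s, `|f s| <= b / k * expR (k * `|s|).
Proof.
move=> k0 f0 df fb s.
have b0 : 0 <= b.
  by have := le_trans (normr_ge0 _) (fb 0); rewrite normr0 mulr0 expR0 mulr1.
have bk : 0 <= b / k by rewrite divr_ge0// ltW.
have [s0|s0] := leP 0 s.
  have dg (u : R) : is_derive u 1 (fun v => b / k * expR (k * v)) (b * expR (k * u)).
    apply: (is_derive_eq (is_derive_funZ (b / k) (is_derive_expRM k u))).
    by field; rewrite gt_eqF.
  have := ler_dist_derive s0 df dg; rewrite f0 subr0 => h.
  apply: le_trans (h _) _ => [u /andP[u0 _]|]; first by rewrite -{2}(ger0_norm u0).
  by rewrite ger0_norm// gerBl mulr_ge0// expR_ge0.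
have dg (u : R) : is_derive u 1 (fun v => - (b / k * expR (- k * v))) (b * expR (- k * u)).
  apply: (is_derive_eq (is_derive_funN (is_derive_funZ (b / k) (is_derive_expRM (- k) u)))).
  by field; rewrite gt_eqF.
have := ler_dist_derive (ltW s0) df dg; rewrite f0 sub0r normrN => h.
apply: le_trans (h _) _ => [u /andP[_ u0]|].
  by rewrite -[in leRHS](opprK u) mulrNN -(ler0_norm u0).
rewrite (ler0_norm (ltW s0)) (_ : k * - s = - k * s); last by ring.
by rewrite opprK addrC gerBl mulr_ge0// expR_ge0.
Qed.

Variables (I : finType) (F : (I -> R) -> I -> R) (K : R).
Hypothesis K_gt0 : 0 < K.
Hypothesis F_lipschitz : forall x y (e : R), (forall j, `|x j - y j| <= e) ->
  forall i, `|F x i - F y i| <= K * e.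

Lemma lipschitz_field_continuous (c : R -> I -> R) i :
  (forall j, continuous (c^~ j)) -> continuous (fun s => F (c s) i).
Proof.
move=> cc s; apply/cvgrPdist_le => /= e e0.
have eK : 0 < e / K by rewrite divr_gt0.
have : \forall t \near s, forall j, `|c s j - c t j| <= e / K.
  have H j : \forall t \near s, `|c s j - c t j| <= e / K.
    by have /cvgrPdist_le := cc j s; exact.
  exact: (@filter_forall _ _ _ (nbhs s) _ H).
by apply: filterS => t /F_lipschitz /(_ i); rewrite mulrCA divff ?gt_eqF// mulr1.
Qed.

Let primitives (f : R -> R) : set (R -> R) :=
  [set G | G 0 = 0 /\ forall s : R, is_derive s 1 G (f s)].

Let prim (f : R -> R) : R -> R := xget (fun=> 0) (primitives f).

Let primP f : continuous f -> prim f 0 = 0 /\ forall s : R, is_derive s 1 (prim f) (f s).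
Proof.
move=> /continuous_primitive [G GP].
by have : primitives f (prim f) by apply: xgetPex; exists G.
Qed.

Variable x0 : I -> R.

Let picard (n : nat) : R -> I -> R :=
  iter n (fun c s i => x0 i + prim (fun u => F (c u) i) s) (fun=> x0).

Let picard_continuous n j : continuous ((picard n)^~ j).
Proof.
elim: n j => [|n ih] j /=; first exact: cst_continuous.
have [_ dG] := primP (lipschitz_field_continuous (i := j) ih).
by move=> s; apply: cvgD; [exact: cvg_cst|exact: is_derive_continuous dG s].
Qed.

Let picard0 n i : picard n 0 i = x0 i.
Proof.
case: n => //= n.
have [-> _] := primP (lipschitz_field_continuous (i := i) (@picard_continuous n)).
exact: addr0.
Qed.

Let picard_derive n i (s : R) : is_derive s 1 ((picard n.+1)^~ i) (F (picard n s) i).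
Proof.
have [_ /(_ s) dG] := primP (lipschitz_field_continuous (i := i) (@picard_continuous n)).
by have := is_derive_funD (is_derive_fun_cst (x0 i) s) dG; rewrite add0r.
Qed.

Let a := (\sum_i `|F x0 i|) / (2 * K).

Let a_ge0 : 0 <= a.
Proof. by apply: divr_ge0; [exact: sumr_ge0|rewrite mulr_ge0 ?ltW]. Qed.

Let picard_step n i (s : R) :
  `|picard n.+1 s i - picard n s i| <= a * expR (2 * K * `|s|) / 2 ^+ n.
Proof.
have K2 : 0 < 2 * K by rewrite mulr_gt0.
elim: n i s => [|n ih] i s.
  have d0 (u : R) : is_derive u 1 (fun v => picard 1 v i - picard 0 v i) (F x0 i).
    by have := is_derive_funB (picard_derive 0 i u) (is_derive_fun_cst (x0 i) u); rewrite subr0.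
  rewrite expr0 divr1.
  apply: (weighted_primitive_bound K2 _ d0) => [|u]; first by rewrite !picard0 subrr.
  have Fi : `|F x0 i| <= \sum_j `|F x0 j| by rewrite (bigD1 i)//= lerDl sumr_ge0.
  apply: le_trans Fi _; rewrite ler_peMr ?sumr_ge0//.
  by rewrite -[leLHS]expR0 ler_expR mulr_ge0// ltW.
have d0 (u : R) := is_derive_funB (picard_derive n.+1 i u) (picard_derive n i u).
rewrite (_ : a * _ / _ = K * (a / 2 ^+ n) / (2 * K) * expR (2 * K * `|s|)); last first.
  by rewrite exprS; field; rewrite (gt_eqF K_gt0) ?expf_neq0.
apply: (weighted_primitive_bound K2 _ d0) => [|u]; first by rewrite !picard0 subrr.
apply: le_trans (F_lipschitz (ih^~ u) i) _.
by rewrite -!mulrA [expR _ * _]mulrC.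
Qed.

Theorem lipschitz_flow_exists : exists c : R -> I -> R,
  c 0 = x0 /\ forall i (s : R), is_derive s 1 (c^~ i) (F (c s) i).
Proof.
have /choice [c cP] (si : R * I) : exists l, forall n,
    `|l - picard n si.1 si.2| <= 2 * (a * expR (2 * K * `|si.1|)) / 2 ^+ n.
  by apply: geometric_limit => n; exact: picard_step.
have {}cP s i n : `|c (s, i) - picard n s i| <= 2 * (a * expR (2 * K * `|s|)) / 2 ^+ n.
  exact: cP (s, i) n.
pose C s i := c (s, i).
have CC i : continuous (C^~ i).
  move=> s; apply/cvgrPdist_le => /= e e0.
  pose b := 2 * (a * expR (2 * K * (`|s| + 1))).
  have [n hn] : exists n, b / 2 ^+ n <= e / 3.
    have [N /ltW hn] : exists n : nat, b / (e / 3) < n%:R.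
      exists (Num.bound `|b / (e / 3)|); apply: le_lt_trans (ler_norm _) _; exact: archi_boundP.
    exists N; rewrite ler_pdivrMr ?exprn_gt0// [leRHS]mulrC -ler_pdivrMr ?divr_gt0//.
    by apply: le_trans hn _; rewrite -natrX ler_nat ltnW// ltn_expl.
  have cb t : `|s - t| <= 1 -> `|C t i - picard n t i| <= e / 3.
    move=> st; apply: le_trans (cP t i n) (le_trans _ hn).
    rewrite ler_wpM2r ?invr_ge0 ?exprn_ge0// ler_wpM2l// ler_wpM2l// ler_expR.
    rewrite ler_wpM2l ?mulr_ge0 ?(ltW K_gt0)// -[t](subrK s) addrC.
    by rewrite (le_trans (ler_normD _ _))// lerD2l distrC.
  near=> t.
  have h1 := cb s; rewrite subrr normr0 in h1; have {}h1 := h1 ler01.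
  have h2 : `|C t i - picard n t i| <= e / 3.
    by apply: cb; near: t; apply: cvgr_dist_le => //; exact: cvg_id.
  have h3 : `|picard n s i - picard n t i| <= e / 3.
    near: t; apply: cvgr_dist_le; first exact: (@picard_continuous n i s).
    by rewrite divr_gt0.
  by move: h1 h2 h3; rewrite !ler_norml; lra.
have CE i s : C s i = x0 i + prim (fun u => F (C u) i) s.
  have [P0 dP] := primP (lipschitz_field_continuous (i := i) CC).
  apply/eqP; rewrite -subr_eq0; apply/eqP.
  pose b := 2 * (a * expR (2 * K * `|s|)).
  apply: (@le_geometric_eq0 _ b) => n.
  have d0 (u : R) := is_derive_funB (picard_derive n i u)
    (is_derive_funD (is_derive_fun_cst (x0 i) u) (dP u)).
  have K2 : 0 < 2 * K by rewrite mulr_gt0.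
  have : `|picard n.+1 s i - (x0 i + prim (fun u => F (C u) i) s)| <=
      K * (2 * a / 2 ^+ n) / (2 * K) * expR (2 * K * `|s|).
    apply: (weighted_primitive_bound K2 _ d0) => [|u]; first by rewrite picard0 P0 addr0 subrr.
    rewrite add0r distrC; apply: le_trans (F_lipschitz (fun j => cP u j n) i) _.
    by rewrite le_eqVlt; apply/orP; left; apply/eqP; ring.
  rewrite (_ : K * _ / _ * _ = b / 2 ^+ n.+1); last first.
    by rewrite /b exprS; field; rewrite (gt_eqF K_gt0) ?expf_neq0.
  have := cP s i n.+1; rewrite -/(C s i) -/b.
  have -> : b / 2 ^+ n = b / 2 ^+ n.+1 + b / 2 ^+ n.+1.
    by rewrite exprS; field; rewrite expf_neq0.
  by rewrite !ler_norml; lra.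
exists C; split.
  apply/funext => i; rewrite CE.
  by have [-> _] := primP (lipschitz_field_continuous (i := i) CC); exact: addr0.
move=> i s; have [_ /(_ s) dP] := primP (lipschitz_field_continuous (i := i) CC).
have := is_derive_funD (is_derive_fun_cst (x0 i) s) dP; rewrite add0r.
by rewrite (_ : (fun _ => _ + _) = C^~ i)//; apply/funext => u; rewrite -CE.
Unshelve. all: by end_near. Qed.

Theorem lipschitz_flow_unique (c1 c2 : R -> I -> R) :
  (forall i (s : R), is_derive s 1 (c1^~ i) (F (c1 s) i)) ->
  (forall i (s : R), is_derive s 1 (c2^~ i) (F (c2 s) i)) ->
  c1 0 = c2 0 -> c1 = c2.
Proof.
move=> d1 d2 c0.
pose D i s := c1 s i - c2 s i; pose D' i s := F (c1 s) i - F (c2 s) i.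
have dD i (s : R) : is_derive s 1 (D i) (D' i s) by exact: is_derive_funB.
pose f s := \sum_i (D i s * D i s).
pose f' s := \sum_i (D' i s * D i s + D i s * D' i s).
have df (s : R) : is_derive s 1 f (f' s) by apply: is_derive_fun_sum => i; exact: is_derive_funM.
have Dle i s : `|D i s| <= Num.sqrt (f s).
  rewrite -sqrtr_sqr ler_wsqrtr// expr2 /f (bigD1 i)//= lerDl sumr_ge0// => j _.
  by rewrite -expr2 sqr_ge0.
have f_ge0 s : 0 <= f s by apply: sumr_ge0 => i _; rewrite -expr2 sqr_ge0.
pose M := (2 * K) *+ #|I|.
have f'M s : `|f' s| <= M * f s.
  rewrite /M mulrnAl -sumr_const; apply: le_trans (ler_norm_sum _ _ _) _.
  apply: ler_sum => i _; rewrite [_ * D' i s]mulrC -mulr2n normrMn normrM.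
  rewrite -[2 * K * f s]mulrA mulr_natl lerMn2r /=.
  rewrite -[X in K * X]sqr_sqrtr// expr2 mulrA ler_pM//.
  exact: F_lipschitz (fun j => Dle j s) i.
have f0 : f 0 = 0 by rewrite /f big1// => i _; rewrite /D c0 subrr mulr0.
have fz s : f s = 0.
  apply/eqP; rewrite eq_le f_ge0 andbT.
  have [s0|s0] := leP 0 s.
    have := ge0_derive_le s0
      (fun u => is_derive_funN (is_derive_funM (df u) (is_derive_expRM (- M) u))).
    rewrite f0 mul0r oppr0 oppr_ge0 pmulr_lle0 ?expR_gt0//; apply=> u _.
    rewrite oppr_ge0 mulrCA mulrC -mulrDr pmulr_rle0 ?expR_gt0//.
    by have := f'M u; rewrite ler_norml; lra.
  have := ge0_derive_le (ltW s0)
    (fun u => is_derive_funM (df u) (is_derive_expRM M u)).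
  rewrite f0 mul0r pmulr_lle0 ?expR_gt0//; apply=> u _.
  rewrite mulrCA mulrC -mulrDr pmulr_rge0 ?expR_gt0//.
  by have := f'M u; rewrite ler_norml; lra.
apply/funext => s; apply/funext => i; apply/eqP; rewrite -subr_eq0 -normr_le0.
by apply: le_trans (Dle i s) _; rewrite fz sqrtr0.
Qed.

End picard.

Section sublevel_sets.
Context {R : realType}.

Definition upper_integral_le (tau eta : R) (phi : R -> R) :=
  exists W w : R -> R, [/\ forall s : R, is_derive s 1 W (w s), forall s, 0 <= w s,
    forall s, `|s| <= tau -> phi s <= w s & W tau - W (- tau) <= eta].

(* [S] has measure at most [eta], witnessed by a smooth majorant of its
   indicator function. *)
Definition small_set (S : set R) (eta : R) :=
  exists W w : R -> R, [/\ forall s : R, is_derive s 1 W (w s), forall s, 0 <= w s,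
    forall s, S s -> 1 <= w s & forall a b, a <= b -> W b - W a <= eta].

Lemma small_set0 eta : 0 <= eta -> small_set set0 eta.
Proof.
move=> eta0; exists (fun=> 0), (fun=> 0); split=> // [s|a b _]; last by rewrite subrr.
exact: is_derive_fun_cst.
Qed.

Lemma small_setU (A B : set R) a b : small_set A a -> small_set B b ->
  small_set (A `|` B) (a + b).
Proof.
move=> [W [w [dW w0 wA Wa]]] [X [x [dX x0 xB Xb]]].
exists (fun s => W s + X s), (fun s => w s + x s); split=> [s|s|s [/wA ws|/xB xs]|u v uv].
- exact: is_derive_funD.
- exact: addr_ge0.
- by rewrite (le_trans ws)// lerDl.
- by rewrite (le_trans xs)// lerDr.
- by have := Wa _ _ uv; have := Xb _ _ uv; lra.
Qed.

Lemma small_set_sub (A B : set R) a b : A `<=` B -> a <= b -> small_set B a -> small_set A b.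
Proof.
move=> AB ab [W [w [dW w0 wB Wa]]]; exists W, w; split=> // [s /AB/wB//|u v uv].
exact: le_trans (Wa _ _ uv) ab.
Qed.

Lemma small_set_ball (c r : R) : 0 < r -> small_set [set s | `|s - c| <= r] (2 * pi * r).
Proof.
move=> r0; pose x (s : R) := (s - c) / r.
have dx (s : R) : is_derive s 1 x r^-1.
  apply: (is_derive_eq (is_derive_funM (is_derive_funB (is_derive_fun_id s)
    (is_derive_fun_cst c s)) (is_derive_fun_cst r^-1 s))).
  by rewrite mulr0 addr0 subr0 mul1r.
have x1 s : 0 < 1 + x s ^+ 2 by rewrite ltr_pwDl// sqr_ge0.
exists (fun s => 2 * r * atan (x s)), (fun s => 2 / (1 + x s ^+ 2)); split.
- move=> s; have := is_derive_funZ (2 * r) (is_derive1_comp (is_derive1_atan (x s)) (dx s)).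
  move/is_derive_eq; apply.
  by field; rewrite (gt_eqF r0) (gt_eqF (x1 s)).
- by move=> s; rewrite divr_ge0// ltW.
- move=> s /= sr; rewrite ler_pdivlMr// mul1r -[2]/(1 + 1) lerD2l.
  rewrite -real_normK ?num_real// expr_le1// /x normf_div (gtr0_norm r0).
  by rewrite ler_pdivrMr// mul1r.
- move=> u v _; rewrite -mulrBr -mulrA [pi * _]mulrC mulrA ler_wpM2l ?mulr_ge0 ?(ltW r0)//.
  have := atan_gtNpi2 (x u); have := atan_ltpi2 (x v); lra.
Qed.

Lemma derive_expands (f f' : R -> R) l a b x y :
  (forall s : R, is_derive s 1 f (f' s)) -> (forall s, a <= s <= b -> l <= `|f' s|) ->
  a <= x <= b -> a <= y <= b -> l * `|x - y| <= `|f x - f y|.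
Proof.
move=> df fl.
wlog xy : x y / x <= y.
  move=> H ax ay; have [/H|/ltW yx] := leP x y; first exact.
  by rewrite distrC [leRHS]distrC; exact: H.
move=> /andP[ax _] /andP[_ yb].
have [|c cxy e] := MVT_segment (f := f) (df := f') xy (fun s _ => df s).
  by apply/continuous_subspaceT; exact: is_derive_continuous df.
move: cxy; rewrite in_itv /= => /andP[xc cy].
rewrite distrC [leRHS]distrC e normrM ler_wpM2r// fl//.
by rewrite (le_trans ax xc) (le_trans cy yb).
Qed.

(* Van der Corput: the set where [U j] is below a suitable threshold lies in a
   short interval since [|U j.+1|] is large; off it, induct. *)
Lemma sublevel_small j (M eta : R) : 0 < M -> 0 < eta -> exists l, 0 < l /\
  forall (U : nat -> R -> R) a b, (forall i (s : R), is_derive s 1 (U i) (U i.+1 s)) ->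
  (forall s, a <= s <= b -> l <= `|U j s|) ->
  small_set [set s | a <= s <= b /\ `|U 0%N s| <= M] eta.
Proof.
move=> M0; elim: j eta => [|j ih] eta eta0.
  exists (M + 1); split=> [|U a b dU lU]; first by rewrite addr_gt0.
  apply: small_set_sub (lexx _) (small_set0 (ltW eta0)) => s [/lU h1 h2].
  by move: (le_trans h1 h2); rewrite gerDl ler10.
have eta3 : 0 < eta / 3 by rewrite divr_gt0.
have [l [l0 lP]] := ih _ eta3.
have pi0 := pi_gt0 R.
have fE (p : R) : 0 < p -> 2 * p * (3 * l / (18 * p * l / eta)) = eta / 3.
  by move=> p0; field; rewrite (gt_eqF p0) (gt_eqF l0) (gt_eqF eta0).
pose l' := 18 * pi * l / eta.
have l'0 : 0 < l' by rewrite /l' divr_gt0 ?mulr_gt0.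
exists l'; split=> // U a b dU lU.
have [[c [acb cl]]|noc] := pselect (exists c, a <= c <= b /\ `|U j c| <= l); last first.
  apply: (@small_set_sub _ [set s | a <= s <= b /\ `|U 0%N s| <= M] (eta / 3)) => //.
    by lra.
  apply: lP => // s sab; rewrite leNgt; apply/negP => /ltW sl; apply: noc.
  by exists s.
pose r := 3 * l / l'.
have r0 : 0 < r by apply: divr_gt0 => //; exact: mulr_gt0.
have far s : a <= s <= b -> r <= `|s - c| -> l <= `|U j s|.
  move=> sab rs; rewrite leNgt; apply/negP => sl.
  have := derive_expands (dU j) lU sab acb.
  have : l' * r <= l' * `|s - c| by rewrite ler_pM2l.
  rewrite {1}/r mulrCA divff ?gt_eqF// mulr1.
  have := ler_normB (U j s) (U j c); lra.
apply: (@small_set_sub _ ([set s | a <= s <= c - r /\ `|U 0%N s| <= M] `|`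
    ([set s | c + r <= s <= b /\ `|U 0%N s| <= M] `|` [set s | `|s - c| <= r]))
    (eta / 3 + (eta / 3 + 2 * pi * r))).
- move=> s [/andP[sa sb] sM].
  have [h|h] := leP s (c - r); first by left; rewrite /= sa h.
  have [h'|h'] := leP (c + r) s; first by right; left; rewrite /= sb h'.
  by right; right; rewrite /= ler_norml; apply/andP; split; lra.
- rewrite (_ : 2 * pi * r = eta / 3); first lra.
  exact: fE.
- case/andP: acb => ac cb.
  apply: small_setU; first apply: lP => // s /andP[sa sc].
    by apply: far; [apply/andP; split; lra|rewrite distrC ler_normr; apply/orP; left; lra].
  apply: small_setU; last exact: small_set_ball.
  apply: lP => // s /andP[cs sb].
  by apply: far; [apply/andP; split; lra|rewrite ler_normr; apply/orP; left; lra].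
Qed.

End sublevel_sets.

Section oscillators.
Context {R : realType}.

Lemma ler_dist_origin (f f' : R -> R) c tau s :
  (forall u : R, is_derive u 1 f (f' u)) -> (forall u, `|u| <= tau -> `|f' u| <= c) ->
  `|s| <= tau -> `|f s - f 0| <= c * `|s|.
Proof.
move=> df fc stau.
have dg (u : R) : is_derive u 1 (fun v => c * v) c.
  by apply: (is_derive_eq (is_derive_funZ c (is_derive_fun_id u))); rewrite mulr1.
have [s0|s0] := leP 0 s.
  have := ler_dist_derive s0 df dg; rewrite mulr0 subr0 (ger0_norm s0); apply=> u /andP[u0 us].
  by apply: fc; rewrite ger0_norm// (le_trans us)// -(ger0_norm s0).
have := ler_dist_derive (ltW s0) df dg.
rewrite mulr0 sub0r (ltr0_norm s0) mulrN distrC; apply=> u /andP[us u0].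
by apply: fc; rewrite ler0_norm// (le_trans _ stau)// ltr0_norm// lerN2.
Qed.

(* A scalar function [U 0] with its successive derivatives [U i], solving a
   linear equation of order four; the boundedness clause is only used
   qualitatively. *)
Definition oscillator (al be : R) (U : nat -> R -> R) :=
  [/\ forall i (s : R), is_derive s 1 (U i) (U i.+1 s),
      forall s, U 4%N s = - al * U 2%N s - be * U 0%N s &
      exists B, forall j s, (j < 4)%N -> `|U j s| <= B].

Variables (al be tau : R).
Hypotheses (al_ge0 : 0 <= al) (be_ge0 : 0 <= be).
Hypothesis tau_small : (1 + al + be) * tau <= 1 / 4.
Implicit Types (U : nat -> R -> R).

Lemma oscillator_derivative_le U a j s : oscillator al be U -> 0 <= a ->
  (forall i, (i < 4)%N -> `|U i s| <= a) -> (j < 4)%N ->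
  `|U j.+1 s| <= (1 + al + be) * a.
Proof.
move=> [_ U4 _] a0 Ua j4.
have [j3|] := boolP (j.+1 < 4)%N.
  apply: le_trans (Ua _ j3) _; rewrite -{1}[a]mul1r ler_wpM2r// -addrA lerDl.
  exact: addr_ge0.
rewrite -leqNgt => j3; have -> : j = 3%N by apply/eqP; rewrite eqn_leq -ltnS j4.
have u2 := Ua 2%N isT; have u0 := Ua 0%N isT.
rewrite U4 (le_trans (ler_normB _ _))// !normrM normrN (ger0_norm al_ge0) (ger0_norm be_ge0).
have := ler_wpM2l al_ge0 u2; have := ler_wpM2l be_ge0 u0; nra.
Qed.

Lemma oscillator_bound U N : oscillator al be U -> 0 <= N ->
  (forall j, (j < 4)%N -> `|U j 0| <= N) ->
  forall j s, (j < 4)%N -> `|s| <= tau -> `|U j s| <= 2 * N.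
Proof.
move=> oU N0 UN j s j4 stau; have [dU _ [B UB]] := oU.
apply/ler_addgt0Pr => e e0.
pose P a := 0 <= a /\ forall j s, (j < 4)%N -> `|s| <= tau -> `|U j s| <= a.
suff [_ ->//] : P (2 * N + e) by [].
apply: (halving (a0 := B) e0) => [|a [a0 Pa]|a b ab [a0 Pa]].
- split; first exact: le_trans (UB 0%N 0 isT).
  by move=> i u i4 _; exact: UB.
- split; first by rewrite addr_ge0// divr_ge0.
  move=> i u i4 utau.
  have h : `|U i u - U i 0| <= (1 + al + be) * a * `|u|.
    apply: (ler_dist_origin (dU i) _ utau) => v vtau.
    by apply: oscillator_derivative_le => // k k4; exact: Pa.
  have h' : (1 + al + be) * a * `|u| <= a / 4.
    have ab0 : 0 <= 1 + al + be by rewrite !addr_ge0.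
    apply: le_trans (ler_wpM2l (mulr_ge0 ab0 a0) utau) _.
    by have := ler_wpM2l a0 tau_small; lra.
  have := UN _ i4; rewrite -[U i u](subrK (U i 0)) => h''.
  by apply: le_trans (ler_normD _ _) _; lra.
- by split; [exact: le_trans ab|move=> i u i4 ut; exact: le_trans (Pa _ _ i4 ut) ab].
Qed.

Lemma oscillator_sublevel (M eta : R) : 0 < M -> 0 < eta -> exists N0, 0 < N0 /\
  forall U j, oscillator al be U -> (j < 4)%N -> N0 <= `|U j 0| ->
  small_set [set s | `|s| <= tau /\ `|U 0%N s| <= M] eta.
Proof.
move=> M0 eta0.
have /choice [l lP] (j : 'I_4) := sublevel_small j M0 eta0.
have l0 j : 0 < l j by have [] := lP j.
pose N0 := 2 * \sum_j l j.
have lN j : 2 * l j <= N0.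
  by rewrite /N0 ler_wpM2l// (bigD1 j)//= lerDl sumr_ge0// => i _; exact: ltW.
exists N0; split=> [|U j oU j4 UN]; first by apply: lt_le_trans (lN ord0); rewrite mulr_gt0.
have [i _ iP] := @arg_maxP _ R 'I_4 (Ordinal j4) xpredT (fun k : 'I_4 => `|U k 0|) isT.
have {}iP k (k4 : (k < 4)%N) : `|U k 0| <= `|U i 0| := iP (Ordinal k4) isT.
have [dU _ _] := oU.
have Ub := oscillator_bound oU (normr_ge0 (U i 0)) iP.
have Ul s : - tau <= s <= tau -> l i <= `|U i s|.
  rewrite -ler_norml => stau.
  have h : `|U i s - U i 0| <= (1 + al + be) * (2 * `|U i 0|) * `|s|.
    apply: (ler_dist_origin (dU i) _ stau) => v vtau.
    by apply: oscillator_derivative_le; rewrite ?mulr_ge0// => k k4; exact: Ub.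
  have h' : (1 + al + be) * (2 * `|U i 0|) * `|s| <= `|U i 0| / 2.
    have ab0 : 0 <= 1 + al + be by rewrite !addr_ge0.
    have U0 : 0 <= 2 * `|U i 0| by rewrite mulr_ge0.
    apply: le_trans (ler_wpM2l (mulr_ge0 ab0 U0) stau) _.
    by have := ler_wpM2l U0 tau_small; lra.
  have := iP j j4; have := lN i; have := ler_normB (U i s) (U i s - U i 0).
  by rewrite subKr; lra.
apply: small_set_sub (lexx _) ((lP i).2 U (- tau) tau dU Ul) => s [stau sM].
by split=> //; rewrite -ler_norml.
Qed.

Definition close (delta u v : R) := `|u - v| <= delta * ((1 + `|u|) * (1 + `|v|)).

Lemma close_le d1 d2 u v : d1 <= d2 -> close d1 u v -> close d2 u v.
Proof. by move=> d12 /le_trans; apply; rewrite ler_wpM2r// mulr_ge0// addr_ge0. Qed.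

Lemma close_far delta N u v : 0 <= N -> delta * (1 + N) <= 1 / 4 -> close delta u v ->
  2 * N + 1 < `|u| -> N <= `|v|.
Proof.
move=> N0 dN uv uN; rewrite leNgt; apply/negP => vN.
have h : delta * ((1 + `|u|) * (1 + `|v|)) <= (1 + `|u|) / 4.
  have [d0|d0] := leP 0 delta; last first.
    apply: (@le_trans _ _ 0); last by rewrite divr_ge0// addr_ge0.
    by rewrite nmulr_rle0// mulr_ge0// addr_ge0.
  have : delta * (1 + `|v|) <= delta * (1 + N) by rewrite ler_wpM2l// lerD2l ltW.
  have := normr_ge0 u; nra.
have := ler_normB u (u - v); rewrite subKr => h2.
have := le_trans uv h; have := ler_dist_dist u v; have := ler_normD (u - v) v.
rewrite subrK; lra.
Qed.

Lemma close_near delta N u v : 0 <= N -> 0 <= delta -> delta * (1 + N) <= 1 / 2 ->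
  close delta u v -> `|u| <= N -> `|u - v| <= 2 * delta * (1 + N) ^+ 2.
Proof.
move=> N0 d0 dN uv uN.
have hv : `|v| <= N + `|u - v|.
  by have := ler_normB u (u - v); rewrite subKr => /le_trans; apply; rewrite lerD2r.
have h1 : delta * ((1 + `|u|) * (1 + `|v|)) <= delta * ((1 + N) * (1 + N + `|u - v|)).
  by rewrite ler_wpM2l// ler_pM ?addr_ge0// ?lerD2l// -addrA lerD2l.
have := le_trans uv h1; have := ler_wpM2r (normr_ge0 (u - v)) dN; nra.
Qed.

End oscillators.

Section relative_motion.
Context {R : realType}.

Lemma is_derive_fun_cos (w p s : R) :
  is_derive s 1 (fun u => cos (w * u + p)) (- w * sin (w * s + p)).
Proof.
have := is_derive1_comp (g := fun u => w * u + p) (is_derive_cos (w * s + p)) (is_derive_funD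
  (is_derive_funZ w (is_derive_fun_id s)) (is_derive_fun_cst p s)).
move/is_derive_eq; apply.
by rewrite addr0 mulr1 mulNr mulNr mulrC.
Qed.

Lemma is_derive_fun_sin (w p s : R) :
  is_derive s 1 (fun u => sin (w * u + p)) (w * cos (w * s + p)).
Proof.
have := is_derive1_comp (g := fun u => w * u + p) (is_derive_sin (w * s + p)) (is_derive_funD
  (is_derive_funZ w (is_derive_fun_id s)) (is_derive_fun_cst p s)).
move/is_derive_eq; apply.
by rewrite addr0 mulr1 mulrC.
Qed.

(* The [i]-th derivative of [a cos (w s) + b sin (w s)]. *)
Definition wave (w a b : R) (i : nat) (s : R) : R :=
  w ^+ i * (a * cos (w * s + i%:R * (pi / 2)) + b * sin (w * s + i%:R * (pi / 2))).

Lemma wave0 w a b s : wave w a b 0 s = a * cos (w * s) + b * sin (w * s).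
Proof. by rewrite /wave expr0 mul1r mul0r addr0. Qed.

Lemma wave_shift (w s : R) i :
  cos (w * s + i.+1%:R * (pi / 2)) = - sin (w * s + i%:R * (pi / 2)) /\
  sin (w * s + i.+1%:R * (pi / 2)) = cos (w * s + i%:R * (pi / 2)).
Proof.
have -> : w * s + i.+1%:R * (pi / 2) = (w * s + i%:R * (pi / 2)) + pi / 2.
  by rewrite -natr1 mulrDl mul1r addrA.
by rewrite cosDpihalf sinDpihalf.
Qed.

Lemma wave_derive w a b i (s : R) : is_derive s 1 (wave w a b i) (wave w a b i.+1 s).
Proof.
apply: (is_derive_eq (is_derive_funZ (w ^+ i) (is_derive_funD
  (is_derive_funZ a (is_derive_fun_cos w (i%:R * (pi / 2)) s))
  (is_derive_funZ b (is_derive_fun_sin w (i%:R * (pi / 2)) s))))).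
rewrite /wave (wave_shift w s i).1 (wave_shift w s i).2 exprS.
by move: (cos _) (sin _) => c e; ring.
Qed.

Lemma waveSS w a b i s : wave w a b i.+2 s = - w ^+ 2 * wave w a b i s.
Proof.
rewrite /wave (wave_shift w s i.+1).1 (wave_shift w s i.+1).2.
rewrite (wave_shift w s i).1 (wave_shift w s i).2 !exprS.
by move: (cos _) (sin _) => c e; ring.
Qed.

Lemma wave_bound w a b i s : `|wave w a b i s| <= `|w| ^+ i * (`|a| + `|b|).
Proof.
rewrite normrM normrX ler_wpM2l ?exprn_ge0// (le_trans (ler_normD _ _))// !normrM lerD//.
  by rewrite ler_piMr// ler_norml cos_geN1 cos_le1.
by rewrite ler_piMr// ler_norml sin_geN1 sin_le1.
Qed.

Definition relative_wave (w1 w2 a1 b1 a2 b2 : R) (i : nat) (s : R) : R :=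
  wave w1 a1 b1 i s - wave w2 a2 b2 i s.

Lemma relative_wave_oscillator (w1 w2 a1 b1 a2 b2 : R) :
  oscillator (w1 ^+ 2 + w2 ^+ 2) (w1 ^+ 2 * w2 ^+ 2) (relative_wave w1 w2 a1 b1 a2 b2).
Proof.
split=> [i s|s|].
- by apply: is_derive_funB; exact: wave_derive.
- rewrite /relative_wave !waveSS; ring.
- exists ((1 + `|w1|) ^+ 4 * (`|a1| + `|b1|) + (1 + `|w2|) ^+ 4 * (`|a2| + `|b2|)) => j s j4.
  have h (w : R) : `|w| ^+ j <= (1 + `|w|) ^+ 4.
    apply: (@le_trans _ _ ((1 + `|w|) ^+ j)).
      by apply: lerXn2r; rewrite ?nnegrE ?addr_ge0// lerDr.
    by rewrite ler_weXn2l ?lerDl// ltnW.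
  apply: le_trans (ler_normB _ _) _; apply: lerD.
    by apply: le_trans (wave_bound _ _ _ _ _) _; rewrite ler_wpM2r// addr_ge0.
  by apply: le_trans (wave_bound _ _ _ _ _) _; rewrite ler_wpM2r// addr_ge0.
Qed.

Section averaged_force.
Variables (d : nat) (g : 'rV[R]_d -> R) (c1 c2 : R).
Hypothesis c2_ge0 : 0 <= c2.
Hypothesis g_bound : forall x, `|g x| <= c1.
Hypothesis g_lipschitz : forall (x y : 'rV[R]_d) (e : R), (forall i, `|x ord0 i - y ord0 i| <= e) ->
  `|g x - g y| <= c2 * e.
Hypothesis g_vanish : forall e : R, 0 < e -> exists M : R, forall x : 'rV[R]_d,
  (exists i, M <= `|x ord0 i|) -> `|g x| <= e.

Variables (al be tau : R).
Hypotheses (al_ge0 : 0 <= al) (be_ge0 : 0 <= be) (tau_gt0 : 0 < tau).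
Hypothesis tau_small : (1 + al + be) * tau <= 1 / 4.

Let point (U : 'I_d -> nat -> R -> R) (s : R) : 'rV[R]_d := \row_i U i 0%N s.

(* A fast relative motion leaves the range of the interaction except for a
   short time; slow ones are close to each other uniformly in time. *)
Lemma averaged_force_close (B e : R) : 0 < e -> exists delta, 0 < delta /\
  forall U U' : 'I_d -> nat -> R -> R,
  (forall i, oscillator al be (U i)) -> (forall i, oscillator al be (U' i)) ->
  (forall i j, (j < 4)%N -> close delta (U i j 0) (U' i j 0)) ->
  forall b : R -> 'rV[R]_d, (forall s i, `|s| <= tau -> `|b s ord0 i| <= B) ->
  upper_integral_le tau e (fun s => `|g (point U s + b s) - g (point U' s + b s)|).
Proof.
move=> e0.
have c1_ge0 : 0 <= c1 by exact: le_trans (g_bound 0).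
pose e1 := e / (8 * tau).
have e1_gt0 : 0 < e1 by rewrite divr_gt0// mulr_gt0.
have [M0 MP] := g_vanish e1_gt0.
pose M : R := `|M0| + `|B| + 1.
have M_gt0 : 0 < M by rewrite ltr_wpDl// addr_ge0.
pose e2 := e / (8 * (c1 + 1)).
have c11 : 0 < c1 + 1 by rewrite ltr_wpDl.
have e2_gt0 : 0 < e2 by rewrite divr_gt0// mulr_gt0.
have [N0 [N0_gt0 NP]] := oscillator_sublevel al_ge0 be_ge0 tau_small M_gt0 e2_gt0.
pose N := 2 * N0 + 1.
have N_gt0 : 0 < N by rewrite ltr_wpDl// mulr_ge0// ltW.
pose e3 := e / (8 * tau * (c2 + 1)).
have c21 : 0 < c2 + 1 by rewrite ltr_wpDl.
have e3_gt0 : 0 < e3 by rewrite divr_gt0// !mulr_gt0.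
have N1 : 0 < 1 + N by rewrite addr_gt0.
pose delta := Num.min (1 / (4 * (1 + N))) (e3 / (2 * (1 + N) ^+ 2)).
have delta_gt0 : 0 < delta.
  by rewrite lt_min !divr_gt0 ?mulr_gt0 ?exprn_gt0.
have d1 : delta * (1 + N) <= 1 / 4.
  have : delta <= 1 / (4 * (1 + N)) by rewrite ge_min lexx.
  move=> /(ler_wpM2r (ltW N1)) /le_trans; apply.
  by rewrite le_eqVlt; apply/orP; left; apply/eqP; field; rewrite gt_eqF.
have d2 : 2 * delta * (1 + N) ^+ 2 <= e3.
  have : delta <= e3 / (2 * (1 + N) ^+ 2) by rewrite ge_min lexx orbT.
  have X : 0 < 2 * (1 + N) ^+ 2 by rewrite mulr_gt0 ?exprn_gt0.
  by rewrite ler_pdivlMr// mulrCA mulrA.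
exists delta; split=> // U U' oU oU' UU' b bB.
have [[i [j [j4 big]]]|nobig] := pselect (exists i j, (j < 4)%N /\ N < `|U i j 0|).
  have big' : N0 <= `|U' i j 0|.
    apply: (close_far (ltW N0_gt0) _ (UU' i j j4) big).
    by apply: le_trans d1; rewrite ler_wpM2l ?(ltW delta_gt0)// lerD2l /N; lra.
  have bigU : N0 <= `|U i j 0| by apply: le_trans (ltW big); rewrite /N; lra.
  have [W [w [dW w0 wP WP]]] := small_setU (NP _ _ (oU i) j4 bigU) (NP _ _ (oU' i) j4 big').
  exists (fun s => 2 * c1 * W s + 2 * e1 * s), (fun s => 2 * c1 * w s + 2 * e1); split.
  - move=> s; have := is_derive_funD (is_derive_funZ (2 * c1) (dW s))
      (is_derive_funZ (2 * e1) (is_derive_fun_id s)).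
    by rewrite mulr1.
  - by move=> s; apply: addr_ge0; apply: mulr_ge0 => //; [exact: mulr_ge0|exact: ltW].
  - move=> s stau; rewrite (le_trans (ler_normB _ _))//.
    have [[sM|sM]|sM] := pselect (([set s | `|s| <= tau /\ `|U i 0%N s| <= M] `|`
        [set s | `|s| <= tau /\ `|U' i 0%N s| <= M]) s).
    + have := wP s (or_introl sM); have := g_bound (point U s + b s).
      have := g_bound (point U' s + b s) => ga gb w1.
      have : 2 * c1 * 1 <= 2 * c1 * w s by rewrite ler_wpM2l// mulr_ge0.
      lra.
    + have := wP s (or_intror sM); have := g_bound (point U s + b s).
      have := g_bound (point U' s + b s) => ga gb w1.
      have : 2 * c1 * 1 <= 2 * c1 * w s by rewrite ler_wpM2l// mulr_ge0.
      lra.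
    + have small (X : 'I_d -> nat -> R -> R) :
          ~ (`|s| <= tau /\ `|X i 0%N s| <= M) -> `|g (point X s + b s)| <= e1.
        move=> nX; apply: MP; exists i; rewrite !mxE.
        have XM : M < `|X i 0%N s| by rewrite ltNge; apply/negP => XM; exact: nX.
        have := bB s i stau; have := ler_norm M0; have := ler_norm B; move: XM; rewrite /M.
        have := ler_normB (X i 0%N s + b s ord0 i) (b s ord0 i); rewrite addrK; lra.
      have ga : `|g (point U s + b s)| <= e1 by apply: small => H; apply: sM; left.
      have gb : `|g (point U' s + b s)| <= e1 by apply: small => H; apply: sM; right.
      have : 0 <= 2 * c1 * w s by rewrite mulr_ge0// mulr_ge0.
      lra.
  - have tt : - tau <= tau by rewrite -subr_ge0 opprK addr_ge0// ltW.
    have h1 : 2 * c1 * (W tau - W (- tau)) <= 2 * c1 * (e2 + e2).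
      by rewrite ler_wpM2l ?mulr_ge0// WP.
    have h2 : 2 * e1 * (tau - - tau) = e / 2.
      by rewrite /e1; field; rewrite gt_eqF.
    have h3 : 2 * c1 * (e2 + e2) <= e / 2.
      have : 4 * (c1 + 1) * e2 = e / 2 by rewrite /e2; field; rewrite gt_eqF.
      by move: e2_gt0; lra.
    by move: h1 h2 h3; lra.
have Ule i j : (j < 4)%N -> `|U i j 0| <= N.
  by move=> j4; rewrite leNgt; apply/negP => bigN; apply: nobig; exists i, j.
have near i j : (j < 4)%N -> `|U i j 0 - U' i j 0| <= e3.
  move=> j4; apply: le_trans d2.
  apply: (close_near (ltW N_gt0) (ltW delta_gt0) _ (UU' i j j4) (Ule i j j4)).
  by apply: le_trans d1 _; lra.
have oD i : oscillator al be (fun j s => U i j s - U' i j s).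
  have [dU U4 [Bu UB]] := oU i; have [dU' U'4 [Bu' UB']] := oU' i; split=> [j s|s|].
  - exact: is_derive_funB.
  - rewrite U4 U'4; ring.
  - by exists (Bu + Bu') => j s j4; rewrite (le_trans (ler_normB _ _))// lerD ?UB ?UB'.
have nearS s i : `|s| <= tau -> `|U i 0%N s - U' i 0%N s| <= 2 * e3.
  by move=> st; exact: (oscillator_bound al_ge0 be_ge0 tau_small (oD i) (ltW e3_gt0) (near i) (j := 0)).
exists (fun s => c2 * (2 * e3) * s), (fun=> c2 * (2 * e3)); split.
- by move=> s; apply: (is_derive_eq (is_derive_funZ _ (is_derive_fun_id s))); rewrite mulr1.
- by move=> s; apply: mulr_ge0 => //; apply: mulr_ge0 => //; exact: ltW.
- move=> s st; apply: g_lipschitz => i; rewrite !mxE.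
  rewrite (_ : _ - _ = U i 0%N s - U' i 0%N s); first exact: nearS.
  by ring.
- have : 4 * tau * (c2 + 1) * e3 = e / 2.
    by rewrite /e3; field; rewrite (gt_eqF c21) (gt_eqF tau_gt0).
  have : 0 < tau * e3 by rewrite mulr_gt0.
  by move: e0; lra.
Qed.

End averaged_force.

End relative_motion.

Section directional_derivatives.
Context {R : realType} {X : normedModType R}.
Implicit Types (f : X -> R) (x v : X).

Lemma is_derive_line f f' v : (forall x, is_derive x v f (f' x)) ->
  forall x (s : R), is_derive s 1 (fun t => f (t *: v + x)) (f' (s *: v + x)).
Proof.
move=> df x s.
suff e : (fun h => h^-1 *: (((fun t : R => f (t *: v + x)) \o shift s) (h *: 1)
      - f (s *: v + x))) =
    (fun h => h^-1 *: ((f \o shift (s *: v + x)) (h *: v) - f (s *: v + x))).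
  have [d1 d2] := df (s *: v + x).
  by split; [rewrite /derivable e|rewrite /derive e].
apply/funext => h /=; congr (_ *: (f _ - _)).
by rewrite [h *: 1]mulr1 scalerDl addrA.
Qed.

Lemma is_derive_line0 f v x a :
  is_derive (0 : R) 1 (fun t => f (t *: v + x)) a -> is_derive x v f a.
Proof.
suff e : (fun h => h^-1 *: (((fun t : R => f (t *: v + x)) \o shift 0) (h *: 1)
      - f (0 *: v + x))) =
    (fun h => h^-1 *: ((f \o shift x) (h *: v) - f x)).
  by move=> [d1 d2]; split; [rewrite /derivable -e|rewrite /derive -e].
apply/funext => h /=; congr (_ *: (f _ - f _)); last by rewrite scale0r add0r.
by rewrite [h *: 1]mulr1 addr0.
Qed.

Lemma directional_lipschitz f f' v c x h : (forall x, is_derive x v f (f' x)) ->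
  (forall x, `|f' x| <= c) -> `|f (h *: v + x) - f x| <= c * `|h|.
Proof.
move=> df fc.
have := ler_dist_origin (c := c) (tau := `|h|) (is_derive_line df x) _ (lexx _).
by rewrite scale0r add0r; apply=> u _; exact: fc.
Qed.

Lemma derive_le_lipschitz (phi : R -> R) a L : is_derive (0 : R) 1 phi a ->
  (forall t, `|phi t - phi 0| <= L * `|t|) -> `|a| <= L.
Proof.
move=> [dphi <-] phiL.
have cv : (fun h : R => h^-1 *: ((phi \o shift 0) (h *: 1) - phi 0)) @ 0^' --> 'D_1 phi 0.
  exact: dphi.
have cvn : `|h^-1 *: ((phi \o shift 0) (h *: 1) - phi 0)| @[h --> 0^'] --> `|'D_1 phi 0|.
  exact: cvg_norm.
rewrite -(cvg_lim _ cvn)//; apply: limr_le; first by apply/cvg_ex; eexists; exact: cvn.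
near=> h; rewrite /= addr0 [h *: 1]mulr1 normrM normfV ler_pdivrMl ?normr_gt0 1?mulrC//.
by near: h; exact: nbhs_dnbhs_neq.
Unshelve. all: by end_near. Qed.

(* Bounding a double difference in either order replaces Schwarz's theorem on
   mixed partial derivatives. *)
Lemma mixed_lipschitz f f1 f2 f12 (v w : X) c x h :
  (forall x, is_derive x v f (f1 x)) -> (forall x, is_derive x w f (f2 x)) ->
  (forall x, is_derive x v f2 (f12 x)) -> (forall x, `|f12 x| <= c) ->
  `|f1 (h *: w + x) - f1 x| <= c * `|h|.
Proof.
move=> df1 df2 df12 f12c.
have dphi := is_derive_funB (is_derive_line df1 (h *: w + x) 0) (is_derive_line df1 x 0).
rewrite !scale0r !add0r in dphi.
apply: (derive_le_lipschitz dphi) => t.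
have dpsi (s : R) := is_derive_funB (is_derive_line df2 (t *: v + x) s) (is_derive_line df2 x s).
have := ler_dist_origin (c := c * `|t|) (tau := `|h|) dpsi _ (lexx _).
rewrite !scale0r !add0r mulrAC.
rewrite (_ : h *: w + (t *: v + x) = t *: v + (h *: w + x)); last by rewrite addrCA.
rewrite (_ : f _ - f (h *: w + x) - (f (t *: v + x) - f x) =
  f (t *: v + (h *: w + x)) - f (t *: v + x) - (f (h *: w + x) - f x)); last by ring.
apply=> u _; rewrite addrCA; exact: directional_lipschitz.
Qed.

End directional_derivatives.

Section gradient_estimates.
Context {R : realType} {d : nat}.
Implicit Types (f : 'rV[R]_d -> R) (x y : 'rV[R]_d) (i j : 'I_d).

Lemma coordinatewise_lipschitz f c x y e : 0 <= c ->
  (forall i h x, `|f (h *: delta_mx ord0 i + x) - f x| <= c * `|h|) ->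
  (forall i, `|x ord0 i - y ord0 i| <= e) -> `|f x - f y| <= d%:R * c * e.
Proof.
move=> c0 fc xy.
pose z k : 'rV[R]_d := \row_i (if (i < k)%N then y ord0 i else x ord0 i).
have h k : (k <= d)%N -> `|f (z k) - f (z 0%N)| <= k%:R * c * e.
  elim: k => [_|k ih kd]; first by rewrite subrr normr0 !mul0r.
  pose K := Ordinal kd.
  have -> : z k.+1 = (y ord0 K - x ord0 K) *: delta_mx ord0 K + z k.
    apply/rowP => i; rewrite !mxE eqxx /= ltnS leq_eqVlt -val_eqE /=.
    case: (ltngtP i k) => [ik|ik|ik]; rewrite ?mulr0 ?add0r//.
    have -> : i = K by exact: val_inj.
    by rewrite mulr1 subrK.
  rewrite -[X in X - _](subrK (f (z k))) -addrA.
  apply: le_trans (ler_normD _ _) _.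
  rewrite -natr1 !mulrDl mul1r [leRHS]addrC lerD// ?(ih (ltnW kd))//.
  by apply: le_trans (fc _ _ _) _; rewrite ler_wpM2l// distrC.
have := h d (leqnn d); rewrite distrC.
have -> : z 0%N = x by apply/rowP => i; rewrite mxE.
by have -> : z d = y by apply/rowP => i; rewrite mxE ltn_ord.
Qed.

Lemma vanishes_at_infinity_coord f e : vanishes_at_infinity f -> 0 < e ->
  exists M : R, forall x, (exists i, M <= `|x ord0 i|) -> `|f x| < e.
Proof.
move=> fv e0.
have /choice [M MP] i : exists M : R, forall x, e <= `|f x| -> `|x ord0 i| <= M.
  have ci : {within [set x | e <= `|f x|], continuous (fun x : 'rV[R]_d => x ord0 i)}.
    by apply: continuous_subspaceT => x; exact: coord_continuous.
  have [M [_ MP]] := compact_bounded (continuous_compact ci (fv _ e0)).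
  exists (M + 1) => x fx; apply: (MP (M + 1)); first by rewrite ltrDl.
  by exists x.
exists (1 + \sum_i `|M i|) => x [i ix]; rewrite ltNge; apply/negP => /(MP i) xM.
have : `|M i| <= \sum_i `|M i| by rewrite (bigD1 i)//= lerDl sumr_ge0.
by have := ler_norm (M i); lra.
Qed.

Lemma partial_vanishes f f' i c : (forall x, is_derive x (delta_mx ord0 i) f (f' x)) ->
  (forall x h, `|f' (h *: delta_mx ord0 i + x) - f' x| <= c * `|h|) ->
  vanishes_at_infinity f -> forall e, 0 < e ->
  exists M : R, forall x, (exists i, M <= `|x ord0 i|) -> `|f' x| <= e.
Proof.
move=> df f'c fv e e0.
have c0 : 0 <= c by have := le_trans (normr_ge0 _) (f'c 0 1); rewrite normr1 mulr1.
have [h [h0 ch]] : exists h, 0 < h /\ c * h <= e / 2.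
  have c1 : 0 < c + 1 by rewrite ltr_wpDl.
  have h0 : 0 < e / (2 * (c + 1)) by apply: divr_gt0 => //; exact: mulr_gt0.
  exists (e / (2 * (c + 1))); split=> //.
  have : (c + 1) * (e / (2 * (c + 1))) = e / 2 by field; rewrite gt_eqF.
  by move: h0; lra.
have eh : 0 < e * h / 4 by apply: divr_gt0 => //; exact: mulr_gt0.
have [M MP] := vanishes_at_infinity_coord fv eh.
exists (M + h) => x [j jx].
have fx : `|f x| < e * h / 4 by apply: MP; exists j; have := h0; lra.
have fy : `|f (h *: delta_mx ord0 i + x)| < e * h / 4.
  apply: MP; exists j; rewrite !mxE /=.
  have : `|h * (j == i)%:R| <= h.
    by rewrite normrM (gtr0_norm h0) ler_piMr ?(ltW h0)//; case: (j == i); rewrite ?normr1 ?normr0.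
  have := ler_normB (h * (j == i)%:R + x ord0 j) (h * (j == i)%:R).
  by rewrite [X in `|X - _|]addrC addrK; lra.
have dg (s : R) : is_derive s 1 (fun t => f (t *: delta_mx ord0 i + x) - f' x * t)
    (f' (s *: delta_mx ord0 i + x) - f' x).
  have := is_derive_funB (is_derive_line df x s) (is_derive_funZ (f' x) (is_derive_fun_id s)).
  by rewrite mulr1.
have := ler_dist_origin (c := c * h) (tau := h) dg (s := h).
rewrite mulr0 subr0 scale0r add0r (gtr0_norm h0) => H.
have {}H := H _ (lexx _).
have {H} : `|f (h *: delta_mx ord0 i + x) - f' x * h - f x| <= c * h * h.
  by apply: H => u uh; rewrite (le_trans (f'c _ _))// ler_wpM2l.
have chh : c * h * h <= e / 2 * h by rewrite ler_wpM2r// ltW.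
move=> H; have fh : `|f' x * h| <= e * h.
  by move: fx fy H chh; rewrite !ltr_norml !ler_norml; lra.
by move: fh; rewrite normrM (gtr0_norm h0) ler_pM2r.
Qed.

Lemma partial_reflection f g f' g' i :
  (forall x, is_derive x (delta_mx ord0 i) f (f' x)) ->
  (forall x, is_derive x (delta_mx ord0 i) g (g' x)) ->
  (forall x, f x = g (- x)) -> forall x, f' x = - g' (- x).
Proof.
move=> df dg fg x.
have h1 := is_derive_line df x 0; rewrite scale0r add0r in h1.
have dl : is_derive (- 0 : R) 1 (fun t => g (t *: delta_mx ord0 i + (- x))) (g' (- x)).
  by rewrite -{2}[- x]add0r -[X in g' (X + _)](scale0r (delta_mx ord0 i)) -{2}oppr0; exact: is_derive_line.
have := is_derive1_comp dl (is_deriveNid (0 : R) 1); rewrite mulrN1 => h2.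
have e : (fun t => g (t *: delta_mx ord0 i - x)) \o -%R = fun t : R => f (t *: delta_mx ord0 i + x).
  by apply/funext => t /=; rewrite fg opprD scaleNr.
rewrite e in h2.
by have [_ <-] := h1; have [_ <-] := h2.
Qed.

Local Notation mp beta s f := (foldr (fun i g => iter (beta i) (partial i) g) f s).

Lemma foldr_partial0 (beta : 'I_d -> nat) s f : (forall k, k \in s -> beta k = 0%N) -> mp beta s f = f.
Proof.
elim: s => //= k s ih bs; rewrite bs ?mem_head//= ih// => l ls.
by rewrite bs// inE ls orbT.
Qed.

Lemma foldr_partial1 (beta : 'I_d -> nat) j s f : uniq s -> j \in s -> beta j = 1%N ->
  (forall k, k \in s -> k != j -> beta k = 0%N) -> mp beta s f = partial j f.
Proof.
move=> + + bj; elim: s => //= k s ih /andP[ks us]; rewrite inE => /orP[/eqP jk|js] bs.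
  rewrite -jk bj /= foldr_partial0// => l ls; apply: bs; first by rewrite inE ls orbT.
  by apply: contraNneq ks => lj; rewrite -jk -lj.
have kj : k != j by apply: contraNneq ks => ->.
rewrite bs ?mem_head//= ih// => l ls lj.
by rewrite bs// inE ls orbT.
Qed.

Lemma mpartial1 i f : mpartial [ffun k => (k == i)%N : nat] f = partial i f.
Proof.
apply: foldr_partial1; rewrite ?enum_uniq ?mem_enum ?ffunE ?eqxx// => k _ ki.
by rewrite ffunE (negbTE ki).
Qed.

Lemma mpartial2 i j f : (i <= j)%N ->
  mpartial [ffun k => ((k == i) + (k == j))%N] f = partial i (partial j f).
Proof.
move=> ij; rewrite /mpartial -(cat_take_drop i (enum 'I_d)) foldr_cat.
have di : (i < size (enum 'I_d))%N by rewrite size_enum_ord.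
have vd k : k \in drop i.+1 (enum 'I_d) -> (i < k)%N.
  move=> kd; have : nat_of_ord k \in map val (drop i.+1 (enum 'I_d)) by exact: map_f.
  by rewrite map_drop val_enum_ord drop_iota add0n mem_iota => /andP[].
have vt k : k \in take i (enum 'I_d) -> (k < i)%N.
  move=> kd; have : nat_of_ord k \in map val (take i (enum 'I_d)) by exact: map_f.
  by rewrite map_take val_enum_ord take_iota mem_iota => /andP[_]; rewrite add0n leq_min => /andP[].
rewrite foldr_partial0; last first.
  move=> k /vt ki; rewrite ffunE; have kj := leq_trans ki ij.
  by rewrite -!val_eqE !ltn_eqF.
rewrite (drop_nth i di) nth_ord_enum /=.
have [eij|nij] := eqVneq i j.
  rewrite -eij ffunE eqxx /= foldr_partial0// => k /vd ik.
  by rewrite ffunE -!val_eqE -?eij !gtn_eqF.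
have lij : (i < j)%N by rewrite ltn_neqAle ij andbT.
rewrite ffunE eqxx (negbTE nij) addn0 /=; congr (partial i _).
apply: foldr_partial1.
- by rewrite drop_uniq// enum_uniq.
- have : j \in take i (enum 'I_d) ++ drop i (enum 'I_d) by rewrite cat_take_drop mem_enum.
  rewrite mem_cat (drop_nth i di) nth_ord_enum inE.
  case/orP => [/vt ji|/orP[/eqP ji|//]]; first by move: ji; rewrite ltnNge ij.
  by rewrite ji eqxx in nij.
- by rewrite ffunE eqxx eq_sym (negbTE nij).
- by move=> k /vd ik kj; rewrite ffunE (negbTE kj) -val_eqE gtn_eqF.
Qed.

Lemma C0_smooth_partial f (c C : R) :
  C0_smooth f -> 0 <= c -> 0 <= C ->
  (forall (beta : {ffun 'I_d -> nat}) x, `|mpartial beta f x| <= c * C ^+ (\sum_i beta i)%N) ->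
  forall i,
  [/\ forall x, is_derive x (delta_mx ord0 i) f (partial i f x),
      forall x, `|partial i f x| <= c * C,
      forall x y e, (forall i, `|x ord0 i - y ord0 i| <= e) ->
        `|partial i f x - partial i f y| <= d%:R * (c * C ^+ 2) * e &
      forall e, 0 < e -> exists M : R, forall x, (exists i, M <= `|x ord0 i|) ->
        `|partial i f x| <= e].
Proof.
move=> [sf fv] c0 C0 fb i; have [_ s2] := sf 2%N.
have df j x : is_derive x (delta_mx ord0 j) f (partial j f x).
  by have [/(_ x) h _] := s2 j; exact: derivableP.
have ddf j k x : is_derive x (delta_mx ord0 k) (partial j f) (partial k (partial j f) x).
  by have [_ [_ /(_ k) [/(_ x) h _]]] := s2 j; exact: derivableP.
have sum1 (k : 'I_d) : (\sum_l (l == k) = 1)%N.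
  by rewrite (bigD1 k)//= eqxx big1 ?addn0// => l /negbTE ->.
have fb2 (j k : 'I_d) x : (j <= k)%N -> `|partial j (partial k f) x| <= c * C ^+ 2.
  move=> jk; rewrite -(mpartial2 _ jk); apply: le_trans (fb _ _) _.
  rewrite (eq_bigr (fun l => (l == j) + (l == k))%N) => [|l _]; last by rewrite ffunE.
  by rewrite big_split /= !sum1.
have lip j h x : `|partial i f (h *: delta_mx ord0 j + x) - partial i f x| <= c * C ^+ 2 * `|h|.
  have [ji|ij] := leqP j i.
    by apply: (directional_lipschitz _ _ (ddf i j)) => z; exact: fb2.
  apply: (mixed_lipschitz _ _ (df i) (df j) (ddf j i)) => z; apply: fb2.
  exact: ltnW.
split=> //.
- move=> x; rewrite -(mpartial1 i); apply: le_trans (fb _ _) _.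
  rewrite (eq_bigr (fun l => (l == i) : nat)) => [|l _]; last by rewrite ffunE.
  by rewrite sum1 expr1.
- move=> x y e xy; apply: coordinatewise_lipschitz xy => //.
  by rewrite mulr_ge0// exprn_ge0.
- exact: partial_vanishes (df i) (fun x h => lip i h x) fv.
Qed.

End gradient_estimates.

Section uniform_closeness.
Context {R : realType} {X : choiceType}.
Implicit Types (f g : X -> R[i]).

Lemma nbhs_uniformP f (P : set (X -> R[i])) :
  nbhs (f : {uniform X -> R[i]}) P <->
  exists e : R, 0 < e /\ forall h, (forall x, `|f x - h x| <= e%:C) -> P h.
Proof.
split=> [/uniform_nbhs [E [entE EP]]|[e [e0 eP]]].
  move: entE; rewrite -entourage_ballE => -[/= e e0 eE].
  have [r er] : exists r : R, e = r%:C.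
    by exists (complex.Re e); case: e e0 {eE} => a b; rewrite ltcE /= => /andP[/eqP -> _].
  have r0 : 0 < r by move: e0; rewrite er ltcR.
  exists (r / 2); split; first by rewrite divr_gt0.
  move=> h hf; apply: EP => y _ /=; apply: eE; rewrite /= -ball_normE /= er.
  by apply: le_lt_trans (hf y) _; rewrite ltcR; lra.
apply/uniform_nbhs; exists [set xy | `|xy.1 - xy.2| < e%:C]; split; last first.
  by move=> h /= hf; apply: eP => x; apply/ltW/hf.
rewrite -entourage_ballE; exists e%:C => /=; first by rewrite ltcR.
by move=> -[a b] /=; rewrite -ball_normE.
Qed.

Lemma uniform_cvgP (I : Type) (F : set_system I) (u : I -> X -> R[i]) f : Filter F ->
  {uniform, u i @[i --> F] --> f} <->
  forall e : R, 0 < e -> \forall i \near F, forall x, `|f x - u i x| <= e%:C.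
Proof.
move=> FF; split=> [uf e e0|H P /nbhs_uniformP [e [e0 eP]]].
  apply: (uf [set h | forall x, `|f x - h x| <= e%:C]).
  by apply/nbhs_uniformP; exists e.
by have := H e e0; apply: filterS => i; exact: eP.
Qed.

Lemma closed_uniformP (A : set (X -> R[i])) :
  closed (A : set {uniform X -> R[i]}) <->
  forall f, (forall e : R, 0 < e -> exists2 g, A g & forall x, `|f x - g x| <= e%:C) -> A f.
Proof.
split=> [clA f fA|H f clf].
  apply: clA => P /nbhs_uniformP [e [e0 eP]].
  by have [g Ag fg] := fA e e0; exists g; split=> //; exact: eP.
apply: H => e e0.
have nf : nbhs (f : {uniform X -> R[i]}) [set h | forall x, `|f x - h x| <= e%:C].
  by apply/nbhs_uniformP; exists e.
by have [g [Ag fg]] := clf _ nf; exists g.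
Qed.

End uniform_closeness.

Section resolvent_algebra_closure.
Context {R : realType} {X : innerProductType R}.
Implicit Types (f g : X -> R[i]).

Lemma CR_set_cstar : cstar_subalgebra (@CR_set R X).
Proof.
have h := CR_submod_subproof X.
have CbR : cstar_subalgebra (@Cb R X) := Cb_cstar_subalgebra X.
split.
- by move=> f; apply; split=> //; exact: resolvents_Cb.
- split; first by apply/set_mem; exact: h.1.
  by move=> a f g fA gA; apply/set_mem; apply: h.2; exact: mem_set.
- move=> f g fA gA A HA; have [[_ _ AM _ _] _] := HA.
  by apply: AM; [exact: fA|exact: gA].
- by move=> f fA; apply/set_mem/CR_conj_subproof; exact: mem_set.
- apply/closed_uniformP => f fA A HA; have [[_ _ _ _ /closed_uniformP AC] _] := HA.
  by apply: AC => e /fA [g gA fg]; exists g => //; exact: gA.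
Qed.

Lemma CR_set_resolvent x l : l != 0 -> CR_set (resolvent x l : X -> R[i]).
Proof. by move=> l0; apply/set_mem; exact: resolvent_CR. Qed.

Lemma CR_set_ind (P : set (X -> R[i])) : cstar_subalgebra P ->
  (forall x l, l != 0 -> P (resolvent x l)) -> @CR_set R X `<=` P.
Proof. by move=> HP Pr f; apply; split=> // _ [x [l [l0 ->]]]; exact: Pr. Qed.

Lemma CR_set_closed f : (forall e : R, 0 < e ->
  exists2 g, CR_set g & forall x, `|f x - g x| <= e%:C) -> CR_set f.
Proof. by have [_ _ _ _ /closed_uniformP] := CR_set_cstar; apply. Qed.

Lemma CR_setZ a f : CR_set f -> CR_set (a *: f).
Proof.
have [_ [C0 CD] _ _ _] := CR_set_cstar.
by move=> Cf; rewrite -[_ *: _]addr0; exact: CD.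
Qed.

Lemma CR_setD f g : CR_set f -> CR_set g -> CR_set (f + g).
Proof.
have [_ [C0 CD] _ _ _] := CR_set_cstar.
by move=> Cf Cg; rewrite -[f]scale1r; exact: CD.
Qed.

Lemma CR_set1 : CR_set (1 : X -> R[i]).
Proof. by apply/set_mem; have [] := CR_subring_subproof X. Qed.

Lemma CR_setM f g : CR_set f -> CR_set g -> CR_set (f * g).
Proof. by have [_ _ CM _ _] := CR_set_cstar; exact: CM. Qed.

Lemma CR_set_conj f : CR_set f -> CR_set (fconj f).
Proof. by have [_ _ _ Cc _] := CR_set_cstar; exact: Cc. Qed.

Lemma CR_set_bounded f : CR_set f -> exists2 M : R, 0 < M & forall x, `|f x| <= M%:C.
Proof.
move=> Cf; have [CRCb _ _ _ _] := CR_set_cstar.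
have /CbP [_ [M fM]] := CRCb _ Cf; exists (`|M| + 1); first by rewrite ltr_wpDl.
by move=> x; apply: le_trans (fM x) _; rewrite lecR; have := ler_norm M; lra.
Qed.

End resolvent_algebra_closure.

Section resolvent_uniformity.
Context {R : realType} {X : innerProductType R}.
Implicit Types (f g h : X -> R) (F : X -> R[i]).

Definition real_CR f := CR_set (fun x => (f x)%:C : R[i]).

Lemma real_CR_ext f g : (forall x, f x = g x) -> real_CR f -> real_CR g.
Proof. by move=> /funext ->. Qed.

Lemma real_CRZ a f : real_CR f -> real_CR (fun x => a * f x).
Proof.
move=> /(CR_setZ a%:C); congr CR_set; apply/funext => x.
by rewrite rmorphM.
Qed.

Lemma real_CR_cst a : real_CR (fun=> a).
Proof.
have /(CR_setZ a%:C) := @CR_set1 R X; congr CR_set; apply/funext => x.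
by rewrite -[LHS]/(a%:C * 1) mulr1.
Qed.

Lemma real_CRD f g : real_CR f -> real_CR g -> real_CR (fun x => f x + g x).
Proof.
move=> Cf Cg; have := CR_setD Cf Cg; congr CR_set; apply/funext => x.
by rewrite rmorphD.
Qed.

Lemma real_CRB f g : real_CR f -> real_CR g -> real_CR (fun x => f x - g x).
Proof.
move=> Cf Cg; apply: real_CR_ext (real_CRD Cf (real_CRZ (-1) Cg)) => x.
by rewrite mulN1r.
Qed.

Lemma real_CRM f g : real_CR f -> real_CR g -> real_CR (fun x => f x * g x).
Proof.
move=> Cf Cg; have := CR_setM Cf Cg; congr CR_set; apply/funext => x.
by rewrite rmorphM.
Qed.

Lemma real_CR_sum (I : Type) (r : seq I) (f : I -> X -> R) :
  (forall i, real_CR (f i)) -> real_CR (fun x => \sum_(i <- r) f i x).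
Proof.
move=> Cf; elim: r => [|i r ih].
  by apply: real_CR_ext (real_CR_cst 0) => x; rewrite big_nil.
by apply: real_CR_ext (real_CRD (Cf i) ih) => x; rewrite big_cons.
Qed.

Lemma real_CR_closed f :
  (forall e : R, 0 < e -> exists2 g, real_CR g & forall x, `|f x - g x| <= e) -> real_CR f.
Proof.
move=> fA; apply: CR_set_closed => e /fA [g Cg fg].
exists (fun x => (g x)%:C) => // x.
by rewrite -rmorphB normc_def /= expr0n addr0 sqrtr_sqr lecR.
Qed.

Lemma real_CR_bounded f : real_CR f -> exists2 M, 0 < M & forall x, `|f x| <= M.
Proof.
move=> /CR_set_bounded [M M0 fM]; exists M => // x.
by have := fM x; rewrite normc_def /= expr0n addr0 sqrtr_sqr lecR.
Qed.

Lemma real_CR_Re F : CR_set F -> real_CR (fun x => complex.Re (F x)).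
Proof.
move=> CF; have := CR_setZ (2^-1) (CR_setD CF (CR_set_conj CF)).
congr CR_set; apply/funext => x.
by rewrite -[LHS]/(2^-1 * (F x + conjc (F x))) ReJ_add mulrC.
Qed.

Lemma real_CR_Im F : CR_set F -> real_CR (fun x => complex.Im (F x)).
Proof.
move=> CF; have := CR_setZ ('i / 2) (CR_setD (CR_set_conj CF) (CR_setZ (-1) CF)).
congr CR_set; apply/funext => x.
rewrite -[LHS]/('i / 2 * (conjc (F x) + (-1) * F x)) ImJ_sub mulN1r.
by rewrite mulrC mulrA mulrAC.
Qed.

Lemma abs_approximation (t : R) : `|t| <= 1 ->
  forall n, let p := iter n (fun p => p + (t ^+ 2 - p ^+ 2) / 2) 0 in
  0 <= p <= `|t| /\ (`|t| - p) * n.+1%:R <= 2.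
Proof.
move=> t1 n; rewrite -(@real_normK _ t) ?num_real//.
move: `|t| (normr_ge0 t) t1 => {}t t0 t1.
elim: n => [|n [/andP[p0 pt] ih]] /=; first by rewrite lexx t0 subr0 mulr1; split=> //; lra.
move: p0 pt ih; set p := iter n _ _; clearbody p; move=> p0 pt ih.
have h1 : 0 <= (t - p) * (t + p) by rewrite mulr_ge0// ?subr_ge0// addr_ge0.
have h2 : 0 <= (t - p) * (2 - (t + p)) by rewrite mulr_ge0 ?subr_ge0//; lra.
split; first by apply/andP; split; lra.
have -> : t - (p + (t ^+ 2 - p ^+ 2) / 2) = (t - p) * (1 - (t + p) / 2) by field.
have e1 : (t - p) * (1 - (t + p) / 2) <= (t - p) * (1 - (t - p) / 2).
  by rewrite ler_wpM2l ?subr_ge0//; lra.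
apply: le_trans (ler_wpM2r (ler0n _ _) e1) _.
have e0 : 0 <= t - p by rewrite subr_ge0.
have e11 : t - p <= 1 by lra.
rewrite -[n.+2%:R]natr1; move: (t - p) (n.+1%:R : R) ih e0 e11 => e N ih e0 e11.
have e2 : 0 <= (2 - e * N) * (2 - e) by rewrite mulr_ge0 ?subr_ge0//; lra.
rewrite -subr_ge0; have := sqr_ge0 e; lra.
Qed.

Lemma real_CR_norm f : real_CR f -> real_CR (fun x => `|f x|).
Proof.
have unit g : real_CR g -> (forall x, `|g x| <= 1) -> real_CR (fun x => `|g x|).
  move=> Cg g1.
  pose p n x := iter n (fun p => p + (g x ^+ 2 - p ^+ 2) / 2) 0.
  have Cp n : real_CR (p n).
    elim: n => [|n ih]; first exact: real_CR_cst.
    apply: real_CR_ext (real_CRD ih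
      (real_CRZ 2^-1 (real_CRB (real_CRM Cg Cg) (real_CRM ih ih)))) => x.
    by rewrite /p /= -!expr2 mulrC.
  apply: real_CR_closed => e e0.
  have [n hn] : exists n : nat, 2 / e < n%:R.
    exists (Num.bound `|2 / e|); apply: le_lt_trans (ler_norm _) _; exact: archi_boundP.
  exists (p n) => // x; have [/andP[p0 pg] h] := abs_approximation (g1 x) n.
  rewrite ger0_norm ?subr_ge0//.
  have n0 : 0 < n.+1%:R :> R by [].
  rewrite -(ler_pM2r n0) (le_trans h)// mulrC -ler_pdivrMr// ltW// (lt_le_trans hn)//.
  by rewrite ler_nat.
move=> Cf; have [M M0 fM] := real_CR_bounded Cf.
have g1 x : `|M^-1 * f x| <= 1.
  by rewrite normrM gtr0_norm ?invr_gt0// ler_pdivrMl// mulr1.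
apply: real_CR_ext (real_CRZ M (unit _ (real_CRZ M^-1 Cf) g1)) => x.
by rewrite normrM gtr0_norm ?invr_gt0// mulrA divff ?gt_eqF// mul1r.
Qed.

Lemma real_CR_max f g : real_CR f -> real_CR g -> real_CR (fun x => Num.max (f x) (g x)).
Proof.
move=> Cf Cg.
apply: real_CR_ext (real_CRZ 2^-1 (real_CRD (real_CRD Cf Cg) (real_CR_norm (real_CRB Cf Cg)))) => x.
by rewrite maxr_absE mulrC.
Qed.

Lemma real_CR_bigmax (I : Type) (r : seq I) (f : I -> X -> R) a :
  (forall i, real_CR (f i)) -> real_CR (fun x => \big[Num.max/a]_(i <- r) f i x).
Proof.
move=> Cf; elim: r => [|i r ih].
  by apply: real_CR_ext (real_CR_cst a) => x; rewrite big_nil.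
by apply: real_CR_ext (real_CR_max (Cf i) ih) => x; rewrite big_cons.
Qed.

Lemma totally_bounded_net (I : finType) (G : I -> X -> R) (M eta : R) :
  0 < eta -> (forall i x, `|G i x| <= M) ->
  exists xs : seq X, forall x, exists2 z, z \in xs & forall i, `|G i x - G i z| <= eta.
Proof.
move=> eta0 GM.
pose K := Num.truncn (2 * M / eta).
pose code x : {ffun I -> 'I_K.+1} := [ffun i => inord (Num.truncn ((G i x + M) / eta))].
exists [seq xget 0 [set x | code x = c] | c <- enum {ffun I -> 'I_K.+1}] => x.
exists (xget 0 [set z | code z = code x]); first by apply/mapP; exists (code x); rewrite ?mem_enum.
have : [set z | code z = code x] (xget 0 [set z | code z = code x]) by apply: xgetPex; exists x.
move: (xget _ _) => z /= zx i.
have G0 y : 0 <= (G i y + M) / eta.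
  by rewrite divr_ge0 ?(ltW eta0)//; have := GM i y; rewrite ler_norml; lra.
have GK y : (Num.truncn ((G i y + M) / eta) < K.+1)%N.
  rewrite ltnS le_truncn// ler_pM2r ?invr_gt0//.
  by have := GM i y; rewrite ler_norml; lra.
have : code z i = code x i by rewrite zx.
rewrite !ffunE => /(congr1 val); rewrite /= !inordK// => tr.
have /andP[x1 x2] := truncn_itv (G0 x); have /andP[] := truncn_itv (G0 z).
move: x1 x2; rewrite tr -natr1 => x1 x2 z1 z2.
have : `|(G i x + M) / eta - (G i z + M) / eta| <= 1 by rewrite ler_norml; lra.
rewrite -mulrBl normrM normfV (gtr0_norm eta0) ler_pdivrMr// mul1r.
by rewrite opprD addrACA subrr addr0.
Qed.

(* McShane extension: up to a small error [f] is the maximum over a finite net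
   of cones built from the generators that control it. *)
Lemma real_CR_of_controlled (I : finType) (G : I -> X -> R) f B :
  (forall i, real_CR (G i)) -> (forall x, `|f x| <= B) ->
  forall e eta, 0 < e -> 0 < eta ->
  (forall x x', (forall i, `|G i x - G i x'| <= eta) -> `|f x - f x'| <= e) ->
  exists2 g, real_CR g & forall x, `|f x - g x| <= 2 * e.
Proof.
move=> CG fB e eta e0 eta0 fG.
have B0 : 0 <= B by exact: le_trans (fB 0).
have /choice [M MP] i : exists M, forall x, `|G i x| <= M.
  by have [M _] := real_CR_bounded (CG i); exists M.
pose D x z := \sum_i `|G i x - G i z|.
pose L := 2 * B / eta.
have L0 : 0 <= L by rewrite divr_ge0 ?mulr_ge0// ltW.
pose n1 : R := #|I|%:R + 1.
have n10 : 0 < n1 by rewrite ltr_wpDl.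
have L10 : 0 < L + 1 by rewrite ltr_wpDl.
pose mu := Num.min eta (e / (L + 1)) / n1.
have mu0 : 0 < mu by rewrite divr_gt0// lt_min eta0 divr_gt0.
have GM i x : `|G i x| <= \sum_j `|M j|.
  apply: le_trans (MP i x) (le_trans (ler_norm _) _).
  by rewrite (bigD1 i)//= lerDl sumr_ge0.
have [xs xsP] := totally_bounded_net mu0 GM.
exists (fun x => \big[Num.max/- B]_(z <- xs) (f z - L * D x z)).
  apply: real_CR_bigmax => z; apply: real_CRB; first exact: real_CR_cst.
  apply: real_CRZ; apply: real_CR_sum => i; apply: real_CR_norm.
  by apply: real_CRB => //; exact: real_CR_cst.
move=> x; rewrite ler_norml; apply/andP; split.
  suff : \big[Num.max/- B]_(z <- xs) (f z - L * D x z) <= f x + e by lra.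
  elim: xs {xsP} => [|z xs ih]; rewrite ?big_nil ?big_cons.
    by have := fB x; rewrite ler_norml; lra.
  rewrite ge_max ih andbT.
  have D0 : 0 <= D x z by apply: sumr_ge0.
  have [Dle|Dgt] := leP (D x z) eta.
    have : `|f x - f z| <= e.
      by apply: fG => i; apply: le_trans Dle; rewrite /D (bigD1 i)//= lerDl sumr_ge0.
    have : 0 <= L * D x z by rewrite mulr_ge0.
    by rewrite ler_norml; lra.
  have : L * eta <= L * D x z by rewrite ler_wpM2l// ltW.
  rewrite {1}/L divfK ?gt_eqF//.
  by have := fB x; have := fB z; rewrite !ler_norml; lra.
have [z zxs zP] := xsP x.
have hz : f z - L * D x z <= \big[Num.max/- B]_(z <- xs) (f z - L * D x z).
  exact: (le_bigmax_seq (- B) z xpredT (fun z => f z - L * D x z) zxs isT).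
have Dmu : D x z <= Num.min eta (e / (L + 1)).
  apply: le_trans (ler_sum _ (fun i _ => zP i)) _.
  rewrite sumr_const /mu -mulr_natr -mulrA ler_piMr//.
    by rewrite le_min (ltW eta0) divr_ge0// ltW.
  by rewrite mulrC ler_pdivrMr// mul1r lerDl.
have : `|f x - f z| <= e.
  apply: fG => i; apply: le_trans (_ : D x z <= _); first by rewrite /D (bigD1 i)//= lerDl sumr_ge0.
  by apply: le_trans Dmu _; rewrite ge_min lexx.
have : (L + 1) * D x z <= e.
  have : D x z <= e / (L + 1) by apply: le_trans Dmu _; rewrite ge_min lexx orbT.
  by rewrite ler_pdivlMr// mulrC.
have : 0 <= D x z by apply: sumr_ge0.
by move: hz; rewrite ler_norml; lra.
Qed.

Definition resolvent_uniform (F : X -> R[i]) := forall e : R, 0 < e ->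
  exists (ys : seq X) (delta : R), 0 < delta /\ forall x x',
  (forall y, y \in ys -> close delta (inner y x) (inner y x')) ->
  `|F x - F x'| <= e%:C.

Lemma resolventE (y x : X) : resolvent y 1 x =
  - (inner y x / (1 + inner y x ^+ 2)) +i* - ((1 + inner y x ^+ 2)^-1).
Proof.
rewrite /resolvent; set u := inner y x.
have u1 : 1 + u ^+ 2 != 0 by rewrite gt_eqF// ltr_pwDl// sqr_ge0.
have zw : ('i * 1%:C - u%:C) * (- (u / (1 + u ^+ 2)) +i* - ((1 + u ^+ 2)^-1)) = 1 :> R[i].
  by apply/eqP; rewrite eq_complex /=; apply/andP; split; apply/eqP; field.
have z0 : 'i * 1%:C - u%:C != 0 :> R[i].
  by apply: contraTneq (oner_neq0 R[i]) => z0; rewrite -zw z0 mul0r eqxx.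
by rewrite -[LHS]mulr1 -zw mulKf.
Qed.

Lemma close_of_resolvents (eta u v : R) : 0 <= eta ->
  `|u / (1 + u ^+ 2) - v / (1 + v ^+ 2)| <= eta ->
  `|(1 + u ^+ 2)^-1 - (1 + v ^+ 2)^-1| <= eta -> close (2 * eta) u v.
Proof.
move=> eta0 h1 h2.
have u1 : 0 < 1 + u ^+ 2 by rewrite ltr_pwDl// sqr_ge0.
have v1 : 0 < 1 + v ^+ 2 by rewrite ltr_pwDl// sqr_ge0.
have E : (u - v) ^+ 2 = ((u / (1 + u ^+ 2) - v / (1 + v ^+ 2)) ^+ 2 +
    ((1 + u ^+ 2)^-1 - (1 + v ^+ 2)^-1) ^+ 2) * ((1 + u ^+ 2) * (1 + v ^+ 2)).
  by field; rewrite (gt_eqF u1) (gt_eqF v1).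
have sq (t : R) : `|t| <= eta -> t ^+ 2 <= eta ^+ 2.
  by move=> te; rewrite -(@real_normK _ t) ?num_real// ler_pXn2r ?nnegrE.
have le1 (t : R) : 0 <= 1 + t ^+ 2 <= (1 + `|t|) ^+ 2.
  rewrite -(@real_normK _ t) ?num_real//; have := normr_ge0 t; have := sqr_ge0 `|t|.
  by move=> ? ?; apply/andP; split; lra.
rewrite /close -(@ler_pXn2r _ 2%N) ?nnegrE ?mulr_ge0 ?addr_ge0//.
rewrite real_normK ?num_real// E !exprMn; apply: ler_pM.
- by rewrite addr_ge0// sqr_ge0.
- by rewrite mulr_ge0// ltW.
- by have := sq _ h1; have := sq _ h2; have := sqr_ge0 eta; lra.
- by have /andP[? ?] := le1 u; have /andP[? ?] := le1 v; rewrite ler_pM.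
Qed.

Lemma CR_set_of_resolvent_uniform F (B : R) :
  (forall x, `|F x| <= B%:C) -> resolvent_uniform F -> CR_set F.
Proof.
move=> FB UF.
have key (p : R[i] -> R) : (forall z w, p (z - w) = p z - p w) ->
    (forall z, (`|p z|)%:C <= `|z|) -> real_CR (fun x => p (F x)).
  move=> pB pn; apply: real_CR_closed => e e0.
  have e2 : 0 < e / 2 by rewrite divr_gt0.
  have [ys [delta [d0 dP]]] := UF _ e2.
  pose G (j : 'I_(size ys) + 'I_(size ys)) : X -> R := match j with
    | inl i => fun x => - complex.Re (resolvent (nth 0 ys i) 1 x)
    | inr i => fun x => - complex.Im (resolvent (nth 0 ys i) 1 x) end.
  have Gl i x : G (inl i) x = inner (nth 0 ys i) x / (1 + inner (nth 0 ys i) x ^+ 2).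
    by rewrite -[LHS]/(- complex.Re (resolvent (nth 0 ys i) 1 x)) resolventE /= opprK.
  have Gr i x : G (inr i) x = (1 + inner (nth 0 ys i) x ^+ 2)^-1.
    by rewrite -[LHS]/(- complex.Im (resolvent (nth 0 ys i) 1 x)) resolventE /= opprK.
  have CG j : real_CR (G j).
    case: j => i; apply: real_CR_ext (fun x => mulN1r _) (real_CRZ (-1) _).
      by apply: real_CR_Re; apply: CR_set_resolvent; exact: oner_neq0.
    by apply: real_CR_Im; apply: CR_set_resolvent; exact: oner_neq0.
  have d2 : 0 < delta / 2 by rewrite divr_gt0.
  have FG x x' : (forall j, `|G j x - G j x'| <= delta / 2) -> `|p (F x) - p (F x')| <= e / 2.
    move=> Gx; rewrite -lecR -pB (le_trans (pn _))// dP// => y yys.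
    have iy : (index y ys < size ys)%N by rewrite index_mem.
    rewrite (_ : delta = 2 * (delta / 2)); last by field.
    have := Gx (inl (Ordinal iy)); have := Gx (inr (Ordinal iy)).
    rewrite !Gl !Gr nth_index// => h2 h1.
    by apply: close_of_resolvents => //; exact: ltW.
  have pFB x : `|p (F x)| <= B by rewrite -lecR (le_trans (pn _)).
  have [g Cg gP] := real_CR_of_controlled CG pFB e2 d2 FG.
  by exists g => // x; apply: le_trans (gP x) _; rewrite mulrC divfK.
have CRe : real_CR (fun x => complex.Re (F x)).
  by apply: key => [[a b] [c d]//|z]; exact: normc_ge_Re.
have CIm : real_CR (fun x => complex.Im (F x)).
  apply: key => [[a b] [c d]//|z].
  by rewrite normc_def lecR -sqrtr_sqr ler_wsqrtr// lerDr sqr_ge0.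
have := CR_setD CRe (CR_setZ 'i CIm); congr CR_set; apply/funext => x.
by rewrite -[LHS]/((complex.Re (F x))%:C + 'i * (complex.Im (F x))%:C) -complexE.
Qed.

Lemma normc_resolvent_denom (l u : R) : `|'i * l%:C - u%:C| = (Num.sqrt (l ^+ 2 + u ^+ 2))%:C.
Proof.
rewrite normc_def; congr (Num.sqrt _)%:C => /=.
by ring.
Qed.

(* Resolvents are bounded below relative to one another under bounded shifts,
   which transfers closeness of [u] and [u'] to the shifted resolvents. *)
Lemma shifted_resolvent_close (l B : R) : l != 0 -> 0 <= B -> exists2 K, 0 < K &
  forall u u' b b' delta : R, `|b| <= B -> `|b'| <= B -> close delta u u' ->
  `|('i * l%:C - (u + b)%:C)^-1 - ('i * l%:C - (u' + b')%:C)^-1| <=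
    (K * (delta + `|b - b'|))%:C.
Proof.
move=> l0 B0.
have al0 : 0 < `|l| by rewrite normr_gt0.
pose q (u : R) := Num.sqrt (l ^+ 2 + u ^+ 2).
have ql u : `|l| <= q u by rewrite -sqrtr_sqr ler_wsqrtr// lerDl sqr_ge0.
have qu u : `|u| <= q u by rewrite -sqrtr_sqr ler_wsqrtr// lerDr sqr_ge0.
have q0 u : 0 < q u := lt_le_trans al0 (ql u).
pose c := 1 + (1 + B) / `|l|.
have c1 : 1 <= c by rewrite lerDl divr_ge0// addr_ge0.
have qc u b : `|b| <= B -> 1 + `|u| <= c * q (u + b).
  move=> bB; have h1 := ler_normB (u + b) b; rewrite addrK in h1.
  have h2 : 1 + B <= (1 + B) / `|l| * q (u + b).
    rewrite -mulrA ler_peMr ?addr_ge0// mulrC ler_pdivlMr// mul1r; exact: ql.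
  by rewrite /c mulrDl mul1r; have := qu (u + b); lra.
exists (c ^+ 2 + `|l| ^- 2) => [|u u' b b' delta bB b'B uu'].
  by rewrite ltr_pwDl ?exprn_gt0 ?invr_ge0 ?exprn_ge0// (lt_le_trans ltr01).
have nz (v : R) : 'i * l%:C - v%:C != 0 by rewrite -normr_gt0 normc_resolvent_denom ltcR q0.
have inv_sub (z w : R[i]) : z != 0 -> w != 0 -> z^-1 - w^-1 = (w - z) / (z * w).
  by move=> z0 w0; field; rewrite z0 w0.
rewrite inv_sub// (_ : 'i * l%:C - (u' + b')%:C - _ = ((u - u') + (b - b'))%:C); last first.
  by rewrite !rmorphD !rmorphN /=; ring.
rewrite normrM normfV normrM !normc_resolvent_denom -!rmorphM -fmorphV.
rewrite (_ : `|_%:C| = `|(u - u') + (b - b')|%:C); last first.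
  by rewrite normc_def /= expr0n addr0 sqrtr_sqr.
rewrite -rmorphM lecR -/(q (u + b)) -/(q (u' + b')).
have qq : 0 < q (u + b) * q (u' + b') by rewrite mulr_gt0.
rewrite ler_pdivrMr//.
apply: le_trans (ler_normD _ _) _.
have d0 : 0 <= delta.
  have : 0 <= delta * ((1 + `|u|) * (1 + `|u'|)) by exact: le_trans (normr_ge0 _) uu'.
  by rewrite pmulr_lge0// mulr_gt0// ltr_pwDl.
have h1 : delta * ((1 + `|u|) * (1 + `|u'|)) <= delta * (c ^+ 2 * (q (u + b) * q (u' + b'))).
  rewrite ler_wpM2l// expr2 mulrACA ler_pM ?addr_ge0 ?qc//.
have h2 : `|b - b'| <= `|b - b'| * (`|l| ^- 2 * (q (u + b) * q (u' + b'))).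
  rewrite ler_peMr// mulrC ler_pdivlMr ?exprn_gt0// mul1r expr2.
  by rewrite ler_pM.
have h3 : 0 <= `|b - b'| * (c ^+ 2 * (q (u + b) * q (u' + b'))).
  by rewrite mulr_ge0// mulr_ge0 ?(ltW qq)// exprn_ge0// (le_trans ler01).
have h4 : 0 <= delta * (`|l| ^- 2 * (q (u + b) * q (u' + b'))).
  by rewrite mulr_ge0// mulr_ge0 ?(ltW qq)// invr_ge0 exprn_ge0.
by move: (le_trans uu' h1) h2 h3 h4; lra.
Qed.

End resolvent_uniformity.

Section upper_integrals.
Context {R : realType}.
Implicit Types (phi psi : R -> R) (tau eta : R).

Lemma upper_integral_leD tau a b phi psi :
  upper_integral_le tau a phi -> upper_integral_le tau b psi ->
  upper_integral_le tau (a + b) (fun s => phi s + psi s).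
Proof.
move=> [W [w [dW w0 wP Wa]]] [Z [z [dZ z0 zP Zb]]].
exists (fun s => W s + Z s), (fun s => w s + z s); split=> [s|s|s st|].
- exact: is_derive_funD.
- exact: addr_ge0.
- by rewrite lerD ?wP ?zP.
- by lra.
Qed.

Lemma upper_integral_leZ tau a k phi : 0 <= k ->
  upper_integral_le tau a phi -> upper_integral_le tau (k * a) (fun s => k * phi s).
Proof.
move=> k0 [W [w [dW w0 wP Wa]]].
exists (fun s => k * W s), (fun s => k * w s); split=> [s|s|s st|].
- exact: is_derive_funZ.
- exact: mulr_ge0.
- by rewrite ler_wpM2l ?wP.
- by rewrite -mulrBr ler_wpM2l.
Qed.

Lemma upper_integral_le_sum (I : eqType) (r : seq I) (phi : I -> R -> R) tau eta :
  (forall i, i \in r -> upper_integral_le tau eta (phi i)) ->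
  upper_integral_le tau ((size r)%:R * eta) (fun s => \sum_(i <- r) phi i s).
Proof.
elim: r => [|i r ih] rP.
  exists (fun=> 0), (fun=> 0); split=> // [s|s _|]; rewrite ?big_nil ?mul0r ?subrr//.
  exact: is_derive_fun_cst.
have h1 := rP i (mem_head _ _).
have h2 : upper_integral_le tau ((size r)%:R * eta) (fun s => \sum_(i <- r) phi i s).
  by apply: ih => j jr; apply: rP; rewrite inE jr orbT.
rewrite (_ : _ * eta = eta + (size r)%:R * eta); last by rewrite /= -natr1 mulrDl mul1r addrC.
have := upper_integral_leD h1 h2; congr (upper_integral_le _ _ _).
by apply/funext => s; rewrite big_cons.
Qed.

Lemma upper_integral_dist tau eta c phi (f f' : R -> R) s :
  upper_integral_le tau eta phi -> (forall u : R, is_derive u 1 f (f' u)) -> 0 <= c ->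
  (forall u, `|u| <= tau -> `|f' u| <= phi u + c) -> `|s| <= tau ->
  `|f s - f 0| <= eta + c * tau.
Proof.
move=> [W [w [dW w0 wP Wa]]] df c0 fc st.
have Wle u v : u <= v -> W u <= W v by move=> uv; exact: ge0_derive_le dW _.
have dg (u : R) : is_derive u 1 (fun v => W v + c * v) (w u + c).
  by have := is_derive_funD (dW u) (is_derive_funZ c (is_derive_fun_id u)); rewrite mulr1.
have fg u : `|u| <= tau -> `|f' u| <= w u + c.
  by move=> ut; apply: le_trans (fc u ut) _; rewrite lerD2r wP.
have cs : c * `|s| <= c * tau by rewrite ler_wpM2l.
move: (st); rewrite ler_norml => /andP[ts st'].
have h0 := Wle _ _ ts; have h1 := Wle _ _ st'.
have [s0|s0] := leP 0 s.
  have t0 := Wle (- tau) 0; have := ler_dist_derive s0 df dg => H.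
  apply: le_trans (H _) _ => [u /andP[u0 us]|].
    by apply: fg; rewrite ger0_norm// (le_trans us).
  by move: cs; rewrite (ger0_norm s0) => cs; have := t0 ltac:(lra); lra.
have t0 := Wle 0 tau; have := ler_dist_derive (ltW s0) df dg => H.
rewrite distrC; apply: le_trans (H _) _ => [u /andP[us u0]|].
  by apply: fg; rewrite ler0_norm//; lra.
by move: cs; rewrite (ltr0_norm s0) => cs; have := t0 ltac:(lra); lra.
Qed.

End upper_integrals.

Section fset_sums.
Context {R : realType} {K : choiceType}.
Implicit Types (A B : {fset K}) (f g : K -> R).

Lemma fset_sum_split A B f : (B `<=` A)%fset ->
  \sum_(k <- A) f k = \sum_(k <- B) f k + \sum_(k <- (A `\` B)%fset) f k.
Proof.
move=> BA; rewrite -big_cat; apply: perm_big; apply: uniq_perm; rewrite ?fset_uniq//.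
  rewrite cat_uniq !fset_uniq andbT /=; apply/hasPn => k /=.
  by rewrite !inE => /andP[].
move=> k; rewrite mem_cat !inE.
by case: (boolP (k \in B)) => //= /(fsubsetP BA).
Qed.

Lemma ler_fset_sum A f g : (forall k, k \in A -> f k <= g k) ->
  \sum_(k <- A) f k <= \sum_(k <- A) g k.
Proof. by move=> fg; rewrite !big_seq; exact: ler_sum. Qed.

End fset_sums.

Section lattice_dynamics.
Context {R : realType} {d : nat} {Gamma : countType}.
Implicit Types (k l : Gamma) (i : 'I_d) (L : {fset Gamma}) (b : bool) (s : R).
Implicit Types (Y : bool -> Gamma -> 'I_d -> R -> R).

Variables (om mu : Gamma -> R) (g : Gamma -> Gamma -> 'I_d -> 'rV[R]_d -> R).
Variables (c : Gamma -> Gamma -> R) (M kap : R).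
Hypothesis c_ge0 : forall k l, 0 <= c k l.
Hypothesis M_gt0 : 0 < M.
Hypothesis kap_gt0 : 0 < kap.
Hypothesis mu_gt0 : forall k, 0 < mu k.
Hypothesis mu_kap : forall k, (mu k)^-1 <= kap.
Hypothesis c_sum : forall k L, \sum_(l <- L) c k l <= M.
Hypothesis c_tail : forall k (e : R), 0 < e -> exists L1 : {fset Gamma},
  forall L, [disjoint L & L1]%fset -> \sum_(l <- L) c k l <= e.
Hypothesis g_bound : forall k l i x, `|g k l i x| <= c k l.
Hypothesis g_lipschitz : forall k l i (x y : 'rV[R]_d) (e : R),
  (forall j, `|x ord0 j - y ord0 j| <= e) -> `|g k l i x - g k l i y| <= c k l * e.
Hypothesis g_vanish : forall k l i (e : R), 0 < e -> exists A : R, forall x : 'rV[R]_d,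
  (exists j, A <= `|x ord0 j|) -> `|g k l i x| <= e.

Definition force L k i (q : Gamma -> 'rV[R]_d) : R :=
  - (2 * \sum_(l <- L) g k l i (q k - q l)).

Definition rotation_factor b k s : R :=
  (if b then cos (om k * s) else - sin (om k * s)) / mu k.

Definition position Y s k : 'rV[R]_d :=
  \row_i (Y false k i s * cos (om k * s) + Y true k i s * sin (om k * s)).

(* Equations of motion in coordinates rotating with the harmonic motion:
   [Y false] and [Y true] are the cosine and sine amplitudes of the position,
   so only the interaction drives them. *)
Definition rotating_solution L Y :=
  forall k, k \in L -> forall i b s,
  is_derive s 1 (Y b k i) (rotation_factor b k s * force L k i (position Y s)).

Lemma rotation_factor_le b k s : `|rotation_factor b k s| <= kap.
Proof.
rewrite normrM normfV (gtr0_norm (mu_gt0 k)); apply: le_trans (mu_kap k).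
rewrite ler_piMl ?invr_ge0 ?(ltW (mu_gt0 k))//.
case: b; first by rewrite ler_norml cos_geN1 cos_le1.
by rewrite normrN ler_norml sin_geN1 sin_le1.
Qed.

Lemma force_le L k i q : `|force L k i q| <= 2 * M.
Proof.
rewrite normrN normrM ger0_norm// ler_wpM2l//.
apply: le_trans (ler_norm_sum _ _ _) _; apply: le_trans (c_sum k L).
by apply: ler_fset_sum => l _; exact: g_bound.
Qed.

Lemma rotating_displacement_le L Y k i b s tau : rotating_solution L Y -> k \in L ->
  `|s| <= tau -> `|Y b k i s - Y b k i 0| <= kap * (2 * M) * tau.
Proof.
move=> sY kL st.
have := ler_dist_origin (c := kap * (2 * M)) (tau := tau) (sY k kL i b) _ st.
move=> H; apply: le_trans (H _) _ => [u _|].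
  by rewrite normrM; apply: ler_pM => //; [exact: rotation_factor_le|exact: force_le].
by apply: ler_wpM2l => //; rewrite !mulr_ge0// ltW.
Qed.

Lemma position_dist_le Y Y' k i s a :
  (forall b, `|Y b k i s - Y' b k i s| <= a) ->
  `|position Y s k ord0 i - position Y' s k ord0 i| <= 2 * a.
Proof.
move=> Ya; rewrite !mxE.
rewrite (_ : _ - _ = (Y false k i s - Y' false k i s) * cos (om k * s) +
  (Y true k i s - Y' true k i s) * sin (om k * s)); last by move: (cos _) (sin _) => x y; ring.
rewrite mulr_natl mulr2n; apply: le_trans (ler_normD _ _) _; rewrite !normrM; apply: lerD.
  by rewrite (le_trans _ (Ya false))// ler_piMr// ler_norml cos_geN1 cos_le1.
by rewrite (le_trans _ (Ya true))// ler_piMr// ler_norml sin_geN1 sin_le1.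
Qed.

Section short_time.
Variable tau : R.
Hypothesis tau_gt0 : 0 < tau.
Hypothesis tau_small : 8 * kap * M * tau <= 1 / 2.

Lemma volume_comparison k (e : R) : 0 < e -> exists L1, k \in L1 /\
  forall L L' Y Y', (L1 `<=` L)%fset -> (L1 `<=` L')%fset ->
  rotating_solution L Y -> rotating_solution L' Y' ->
  (forall l b i, l \in L -> l \in L' -> Y b l i 0 = Y' b l i 0) ->
  forall b i s, `|s| <= tau -> `|Y b k i s - Y' b k i s| <= e.
Proof.
pose P (a : R) := forall k (e : R), 0 < e -> exists L1, k \in L1 /\
  forall L L' Y Y', (L1 `<=` L)%fset -> (L1 `<=` L')%fset ->
  rotating_solution L Y -> rotating_solution L' Y' ->
  (forall l b i, l \in L -> l \in L' -> Y b l i 0 = Y' b l i 0) ->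
  forall b i s, `|s| <= tau -> `|Y b k i s - Y' b k i s| <= a + e.
suff PP : forall e0, 0 < e0 -> P (2 * 0 + e0).
  move=> e0; have e2 : 0 < e / 2 by rewrite divr_gt0.
  have [L1 [kL1 L1P]] := PP _ e2 k _ e2; exists L1; split=> // L L' Y Y' h1 h2 h3 h4 h5 b i s st.
  by apply: le_trans (L1P _ _ _ _ h1 h2 h3 h4 h5 b i s st) _; lra.
move=> e0 e0_gt0; apply: (halving (a0 := 2 * (kap * (2 * M) * tau))) => // {k e e0 e0_gt0}.
- move=> k e e0; exists [fset k]%fset; split; first by rewrite inE.
  move=> L L' Y Y' kL kL' sY sY' Y0 b i s st.
  have {}kL : k \in L by apply: (fsubsetP kL); rewrite inE.
  have {}kL' : k \in L' by apply: (fsubsetP kL'); rewrite inE.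
  have h1 := rotating_displacement_le i b sY kL st.
  have h2 := rotating_displacement_le i b sY' kL' st.
  rewrite -(Y0 k b i kL kL') in h2.
  by move: h1 h2; rewrite !ler_norml; lra.
- move=> a Pa k e e0; rewrite add0r.
  have kt : 0 < kap * tau by exact: mulr_gt0.
  pose e1 := e / (8 * (kap * tau)).
  have e1_gt0 : 0 < e1 by apply: divr_gt0 => //; exact: mulr_gt0.
  have e1E : 8 * (kap * tau) * e1 = e by rewrite /e1; field; rewrite gt_eqF// gt_eqF.
  have [L2 L2P] := c_tail k e1_gt0.
  have /choice [N NP] l := Pa l e e0.
  pose L1 := (k |` L2 `|` N k `|` \bigcup_(l <- L2) N l)%fset.
  exists L1; split; first by rewrite !inE eqxx.
  move=> L L' Y Y' L1L L1L' sY sY' Y0 b i s st.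
  have kL : k \in L by apply: (fsubsetP L1L); rewrite !inE eqxx.
  have kL' : k \in L' by apply: (fsubsetP L1L'); rewrite !inE eqxx.
  have L2L1 : (L2 `<=` L1)%fset by apply/fsubsetP => l; rewrite !inE => ->; rewrite orbT.
  have NL1 l : l \in (k |` L2)%fset -> (N l `<=` L1)%fset.
    rewrite !inE => /orP[/eqP ->|l2]; apply/fsubsetP => j jN; rewrite !inE ?jN ?orbT//.
    by apply/orP; right; apply/bigfcupP; exists l; rewrite ?andbT.
  have close_at l : l \in (k |` L2)%fset -> forall b i u, `|u| <= tau ->
      `|Y b l i u - Y' b l i u| <= a + e.
    move=> lk; have [_ H] := NP l; apply: H sY sY' Y0.
      exact: fsubset_trans (NL1 l lk) L1L.
    exact: fsubset_trans (NL1 l lk) L1L'.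
  have ae : 0 <= a + e.
    by apply: le_trans (close_at k _ false i 0 _); rewrite ?inE ?eqxx// normr0 ltW.
  have dforce u : `|u| <= tau ->
      `|force L k i (position Y u) - force L' k i (position Y' u)| <= 8 * M * (a + e) + 4 * e1.
    move=> ut; rewrite /force.
    have L2L := fsubset_trans L2L1 L1L; have L2L' := fsubset_trans L2L1 L1L'.
    rewrite (fset_sum_split _ L2L) (fset_sum_split _ L2L').
    have tail (J : {fset Gamma}) q : `|\sum_(l <- (J `\` L2)%fset) g k l i (q l)| <= e1.
      apply: le_trans (ler_norm_sum _ _ _) _; apply: (le_trans _ (L2P (J `\` L2)%fset _)).
        by apply: ler_fset_sum => l _; exact: g_bound.
      by apply/fdisjointP => l; rewrite !inE => /andP[].
    have main : `|\sum_(l <- L2) g k l i (position Y u k - position Y u l) -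
        \sum_(l <- L2) g k l i (position Y' u k - position Y' u l)| <= M * (4 * (a + e)).
      rewrite -sumrB; apply: le_trans (ler_norm_sum _ _ _) _.
      apply: (@le_trans _ _ (\sum_(l <- L2) c k l * (4 * (a + e)))).
        apply: ler_fset_sum => l l2; apply: g_lipschitz => j.
        have h1 : `|position Y u k ord0 j - position Y' u k ord0 j| <= 2 * (a + e).
          by apply: position_dist_le => b'; apply: close_at => //; rewrite !inE eqxx.
        have h2 : `|position Y u l ord0 j - position Y' u l ord0 j| <= 2 * (a + e).
          by apply: position_dist_le => b'; apply: close_at => //; rewrite !inE l2 orbT.
        rewrite !mxE in h1 h2 *; move: h1 h2; rewrite !ler_norml; lra.
      by rewrite -mulr_suml ler_wpM2r// mulr_ge0.
    move: main (tail L (fun l => position Y u k - position Y u l))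
      (tail L' (fun l => position Y' u k - position Y' u l)).
    rewrite !ler_norml; lra.
  have dD (u : R) : is_derive u 1 (fun v => Y b k i v - Y' b k i v) (rotation_factor b k u *
      (force L k i (position Y u) - force L' k i (position Y' u))).
    by rewrite mulrBr; apply: is_derive_funB; [exact: sY|exact: sY'].
  have := ler_dist_origin (c := kap * (8 * M * (a + e) + 4 * e1)) (tau := tau) dD _ st.
  rewrite (Y0 k b i kL kL') subrr subr0 => H.
  apply: le_trans (H _) _ => [u ut|].
    by rewrite normrM; apply: ler_pM => //; [exact: rotation_factor_le|exact: dforce].
  have C0 : 0 <= kap * (8 * M * (a + e) + 4 * e1).
    apply: mulr_ge0; first exact: ltW.
    apply: addr_ge0; first by rewrite !mulr_ge0// ltW.
    by apply: mulr_ge0 => //; exact: ltW.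
  apply: le_trans (ler_wpM2l C0 st) _.
  have := ler_wpM2r ae tau_small.
  by move: e1E; lra.
- move=> a b ab Pa k e e0; have [L1 [kL1 L1P]] := Pa k e e0.
  exists L1; split=> // L L' Y Y' h1 h2 h3 h4 h5 b' i s st.
  by apply: le_trans (L1P _ _ _ _ h1 h2 h3 h4 h5 b' i s st) _; rewrite lerD2r.
Qed.

Definition free_relative Y k l i : nat -> R -> R :=
  relative_wave (om k) (om l) (Y false k i 0) (Y true k i 0) (Y false l i 0) (Y true l i 0).

Let free_point Y k l s : 'rV[R]_d := \row_i free_relative Y k l i 0%N s.

Let relative_displacement Y k l s : 'rV[R]_d :=
  position Y s k - position Y s l - free_point Y k l s.

Let relative_displacementE Y k l s :
  position Y s k - position Y s l = free_point Y k l s + relative_displacement Y k l s.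
Proof. by rewrite [RHS]addrC subrK. Qed.

Let displacement_coord Y k l s i : relative_displacement Y k l s ord0 i =
  ((Y false k i s - Y false k i 0) * cos (om k * s) + (Y true k i s - Y true k i 0) * sin (om k * s)) -
  ((Y false l i s - Y false l i 0) * cos (om l * s) + (Y true l i s - Y true l i 0) * sin (om l * s)).
Proof.
rewrite !mxE /free_relative /relative_wave !wave0.
by move: (cos _) (sin _) (cos _) (sin _) => x y z w; ring.
Qed.

Let trig_combination_le (a x y t : R) : `|x| <= a -> `|y| <= a ->
  `|x * cos t + y * sin t| <= 2 * a.
Proof.
move=> xa ya; rewrite mulr_natl mulr2n; apply: le_trans (ler_normD _ _) _.
rewrite !normrM; apply: lerD.
  by rewrite (le_trans _ xa)// ler_piMr// ler_norml cos_geN1 cos_le1.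
by rewrite (le_trans _ ya)// ler_piMr// ler_norml sin_geN1 sin_le1.
Qed.

Lemma displacement_close L (e : R) : 0 < e ->
  (forall k l, k \in L -> l \in L ->
    (1 + (om k ^+ 2 + om l ^+ 2) + om k ^+ 2 * om l ^+ 2) * tau <= 1 / 4) ->
  exists2 delta, 0 < delta & forall Y Y', rotating_solution L Y -> rotating_solution L Y' ->
  (forall k l i j, k \in L -> l \in L -> (j < 4)%N ->
    close delta (free_relative Y k l i j 0) (free_relative Y' k l i j 0)) ->
  forall k b i s, k \in L -> `|s| <= tau ->
  `|(Y b k i s - Y b k i 0) - (Y' b k i s - Y' b k i 0)| <= e.
Proof.
move=> e0 tau_om.
pose n : R := (size L)%:R.
have n0 : 0 <= n by [].
pose e1 := e / (8 * kap * (n + 1)).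
have e1_gt0 : 0 < e1.
  by apply: divr_gt0 => //; apply: mulr_gt0; [exact: mulr_gt0|rewrite ltr_wpDl].
have e1E : 8 * kap * (n + 1) * e1 = e.
  have k0 := kap_gt0; have n1 : 0 < n + 1 by rewrite ltr_wpDl.
  by rewrite /e1; field; rewrite (gt_eqF k0) (gt_eqF n1).
pose B := 4 * (kap * (2 * M) * tau).
have /choice [del delP] (kli : Gamma * Gamma * 'I_d) : exists delta, 0 < delta /\
    (kli.1.1 \in L -> kli.1.2 \in L -> forall U U' : 'I_d -> nat -> R -> R,
    (forall i, oscillator (om kli.1.1 ^+ 2 + om kli.1.2 ^+ 2)
      (om kli.1.1 ^+ 2 * om kli.1.2 ^+ 2) (U i)) ->
    (forall i, oscillator (om kli.1.1 ^+ 2 + om kli.1.2 ^+ 2)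
      (om kli.1.1 ^+ 2 * om kli.1.2 ^+ 2) (U' i)) ->
    (forall i j, (j < 4)%N -> close delta (U i j 0) (U' i j 0)) ->
    forall b : R -> 'rV[R]_d, (forall s i, `|s| <= tau -> `|b s ord0 i| <= B) ->
    upper_integral_le tau e1 (fun s => `|g kli.1.1 kli.1.2 kli.2 (\row_i U i 0%N s + b s) -
      g kli.1.1 kli.1.2 kli.2 (\row_i U' i 0%N s + b s)|)).
  case: kli => [[k l] i] /=.
  have [[kL lL]|nkl] := pselect (k \in L /\ l \in L); last first.
    by exists 1; split=> // kL lL; case: nkl.
  have al0 : 0 <= om k ^+ 2 + om l ^+ 2 by rewrite addr_ge0// sqr_ge0.
  have be0 : 0 <= om k ^+ 2 * om l ^+ 2 by rewrite mulr_ge0// sqr_ge0.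
  have [delta [d0 dP]] := averaged_force_close (c_ge0 k l) (g_bound k l i)
    (@g_lipschitz k l i) (@g_vanish k l i) al0 be0 tau_gt0 (tau_om k l kL lL) B e1_gt0.
  by exists delta.
pose delta := \big[Num.min/1]_(k <- L) \big[Num.min/1]_(l <- L) \big[Num.min/1]_i del (k, l, i).
have delta_gt0 : 0 < delta.
  rewrite /delta; elim/big_rec: _ => // k x _ x0; rewrite lt_min x0 andbT.
  elim/big_rec: _ => // l y _ y0; rewrite lt_min y0 andbT.
  by elim/big_rec: _ => // i z _ z0; rewrite lt_min z0 andbT; have [] := delP (k, l, i).
have delta_le k l i : k \in L -> l \in L -> delta <= del (k, l, i).
  move=> kL lL; rewrite /delta.
  apply: (bigmin_inf_seq _ _ _ _ _ kL) => //; apply: (bigmin_inf_seq _ _ _ _ _ lL) => //.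
  exact: bigmin_le.
exists delta => // Y Y' sY sY' YY'.
have small k l i : k \in L -> l \in L -> upper_integral_le tau e1 (fun s =>
    `|g k l i (free_point Y k l s + relative_displacement Y k l s) -
      g k l i (free_point Y' k l s + relative_displacement Y k l s)|).
  move=> kL lL; have [_ H] := delP (k, l, i); apply: (H kL lL).
  - by move=> j; exact: relative_wave_oscillator.
  - by move=> j; exact: relative_wave_oscillator.
  - by move=> j u u4; apply: close_le (YY' k l j u kL lL u4); exact: delta_le.
  - move=> s j st; rewrite displacement_coord.
    have h1 := trig_combination_le (om k * s) (rotating_displacement_le j false sY kL st)
      (rotating_displacement_le j true sY kL st).
    have h2 := trig_combination_le (om l * s) (rotating_displacement_le j false sY lL st)
      (rotating_displacement_le j true sY lL st).
    by apply: le_trans (ler_normB _ _) _; rewrite /B; lra.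
pose D k b i s := (Y b k i s - Y b k i 0) - (Y' b k i s - Y' b k i 0).
pose phi k i s := \sum_(l <- L)
  `|g k l i (free_point Y k l s + relative_displacement Y k l s) -
    g k l i (free_point Y' k l s + relative_displacement Y k l s)|.
pose P a := 0 <= a /\ forall k b i s, k \in L -> `|s| <= tau -> `|D k b i s| <= a.
suff [_ PP] : P (2 * (kap * (2 * (n * e1))) + e / 2).
  move=> k b i s kL st; apply: le_trans (PP k b i s kL st) _.
  have : 0 < kap * e1 by exact: mulr_gt0.
  by move: e1E; lra.
apply: (halving (a0 := 2 * (kap * (2 * M) * tau))).
- by rewrite divr_gt0.
- split; first by rewrite !mulr_ge0// ltW.
  move=> k b i s kL st; have h1 := rotating_displacement_le i b sY kL st.
  have h2 := rotating_displacement_le i b sY' kL st.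
  by apply: le_trans (ler_normB _ _) _; lra.
- move=> a [a0 Da].
  have ne0 : 0 <= kap * (2 * (n * e1)).
    apply: mulr_ge0; first exact: ltW.
    by apply: mulr_ge0 => //; apply: mulr_ge0 => //; exact: ltW.
  split; first by apply: addr_ge0 => //; exact: divr_ge0.
  move=> k b i s kL st.
  have dforce u : `|u| <= tau -> `|force L k i (position Y u) - force L k i (position Y' u)| <=
      2 * phi k i u + 8 * M * a.
    move=> ut; rewrite /force -opprD normrN -mulrBr normrM ger0_norm// -sumrB.
    have h : `|\sum_(l <- L) (g k l i (position Y u k - position Y u l) -
        g k l i (position Y' u k - position Y' u l))| <= phi k i u + M * (4 * a).
      apply: le_trans (ler_norm_sum _ _ _) _.
      apply: (@le_trans _ _ (phi k i u + \sum_(l <- L) c k l * (4 * a))); last first.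
        by rewrite lerD2l -mulr_suml ler_wpM2r// mulr_ge0.
      rewrite -big_split; apply: ler_fset_sum => l lL; rewrite !relative_displacementE.
      apply: le_trans (ler_distD (g k l i (free_point Y' k l u + relative_displacement Y k l u)) _ _) _.
      rewrite lerD2l; apply: g_lipschitz => j.
      rewrite [X in `|X|](_ : _ = relative_displacement Y k l u ord0 j -
        relative_displacement Y' k l u ord0 j); last by rewrite !mxE; ring.
      rewrite !displacement_coord.
      have h1 := trig_combination_le (om k * u) (Da k false j u kL ut) (Da k true j u kL ut).
      have h2 := trig_combination_le (om l * u) (Da l false j u lL ut) (Da l true j u lL ut).
      have := le_trans (ler_normB _ _) (lerD h1 h2).
      rewrite (_ : 2 * a + 2 * a = 4 * a); last by ring.
      apply: le_trans; rewrite le_eqVlt; apply/orP; left; apply/eqP; congr (`|_|).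
      by rewrite /D; move: (cos _) (sin _) (cos _) (sin _) => x y z w; ring.
    by move: h; lra.
  have dD (u : R) : is_derive u 1 (D k b i) (rotation_factor b k u *
      (force L k i (position Y u) - force L k i (position Y' u))).
    rewrite mulrBr; have := is_derive_funB
      (is_derive_funB (sY k kL i b u) (is_derive_fun_cst (Y b k i 0) u))
      (is_derive_funB (sY' k kL i b u) (is_derive_fun_cst (Y' b k i 0) u)).
    by rewrite !subr0.
  have up : upper_integral_le tau (kap * (2 * (n * e1))) (fun u => kap * (2 * phi k i u)).
    apply: upper_integral_leZ; first exact: ltW.
    apply: upper_integral_leZ => //; apply: upper_integral_le_sum => l lL.
    exact: small.
  have C0 : 0 <= kap * (8 * M * a) by rewrite !mulr_ge0// ltW.
  have := upper_integral_dist up dD C0 _ st.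
  rewrite {2}/D !subrr subr0 => H; apply: le_trans (H _) _ => [u ut|].
    rewrite normrM -mulrDr; apply: ler_pM => //; [exact: rotation_factor_le|exact: dforce].
  rewrite lerD2l; have := ler_wpM2r a0 tau_small; lra.
- move=> a a' aa' [a0 Da]; split; first exact: le_trans aa'.
  by move=> k b i s kL st; apply: le_trans aa'; exact: Da.
Qed.

End short_time.

End lattice_dynamics.

Section vector_valued_derivatives.
Context {R : realType}.

Lemma is_derive_inner (X : innerProductType R) (c : R -> X) (y v : X) (s : R) :
  is_derive s 1 c v -> is_derive s 1 (fun u => inner y (c u)) (inner y v).
Proof.
move=> [dc cv].
have innerDr (x z : X) : inner y (x + z) = inner y x + inner y z.
  by rewrite innerC innerDl !(innerC y).
have innerZr a (x : X) : inner y (a *: x) = a * inner y x by rewrite innerC innerZl innerC.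
have innerNr (x : X) : inner y (- x) = - inner y x by rewrite -scaleN1r innerZr mulN1r.
pose q h := h^-1 *: ((c \o shift s) (h *: 1) - c s).
have qv : q h @[h --> 0^'] --> v by rewrite -cv; exact: dc.
have : inner y (q h) @[h --> 0^'] --> inner y v.
  by apply: continuous_cvg => //; exact: inner_continuous.
rewrite (_ : (fun h => inner y (q h)) = fun h => h^-1 *: (((fun u => inner y (c u)) \o shift s)
    (h *: 1) - inner y (c s))); last first.
  by apply/funext => h; rewrite /q innerZr innerDr innerNr.
move=> lim; split; first by apply/cvg_ex; exists (inner y v).
exact: cvg_lim lim.
Qed.

Lemma is_derive_scale (X : normedModType R) (f : R -> R) a (w : X) (s : R) :
  is_derive s 1 f a -> is_derive s 1 (fun u => f u *: w) (a *: w).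
Proof.
move=> [df <-].
have : (h^-1 *: ((f \o shift s) (h *: 1) - f s)) *: w @[h --> 0^'] --> 'D_1 f s *: w.
  by apply: cvgZr_tmp; exact: df.
rewrite (_ : (fun h => _ *: w) = fun h => h^-1 *: (((fun u => f u *: w) \o shift s)
    (h *: 1) - f s *: w)); last first.
  by apply/funext => h; rewrite -scalerA scalerBl.
move=> lim; split; first by apply/cvg_ex; eexists; exact: lim.
exact: cvg_lim lim.
Qed.

Lemma is_derive_vsum (X : normedModType R) (I : eqType) (r : seq I) (F : I -> R -> X)
    (dF : I -> X) (s : R) :
  (forall i, i \in r -> is_derive s 1 (F i) (dF i)) ->
  is_derive s 1 (fun u => \sum_(i <- r) F i u) (\sum_(i <- r) dF i).
Proof.
elim: r => [_|i r ih dFi].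
  rewrite big_nil (_ : (fun _ => _) = cst 0); last by apply/funext => u; rewrite big_nil.
  exact: is_derive_cst.
rewrite big_cons (_ : (fun _ => _) = F i + (fun u => \sum_(j <- r) F j u)).
  apply: is_deriveD; first by apply: dFi; rewrite mem_head.
  by apply: ih => j jr; apply: dFi; rewrite inE jr orbT.
by apply/funext => u; rewrite big_cons.
Qed.

End vector_valued_derivatives.

Section coordinates.
Context {R : realType} {d : nat} {Gamma : countType}.
Local Notation Omega := (Omega R d Gamma).
Implicit Types (k l : Gamma) (i j : 'I_d) (L : {fset Gamma}) (b : bool).

Definition coord b (x : Omega) k i : R := if b then (x k).1 ord0 i else (x k).2 ord0 i.

Definition coord_dir L b k i : Omega_loc R d L :=
  if b then dir_p R L k i else dir_q R L k i.

Arguments coord : simpl never.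
Arguments coord_dir : simpl never.

Lemma coordD b (x y : Omega) k i : coord b (x + y) k i = coord b x k i + coord b y k i.
Proof. by case: b; rewrite /coord -[(x + y) k]/(x k + y k) mxE. Qed.

Lemma coordZ b a (x : Omega) k i : coord b (a *: x) k i = a * coord b x k i.
Proof. by case: b; rewrite /coord -[(a *: x) k]/(a *: x k) mxE. Qed.

Lemma coord_ext (x y : Omega) : (forall b k i, coord b x k i = coord b y k i) -> x = y.
Proof.
move=> xy; apply/val_inj/funext => k; rewrite -[LHS]/(x k) -[RHS]/(y k).
apply/eqP; rewrite -pair_eqE; apply/andP; split; apply/eqP/rowP => i.
  exact: xy true k i.
exact: xy false k i.
Qed.

Lemma coord_notin L (x : Omega_loc R d L) b k i : k \notin L -> coord b x k i = 0.
Proof.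
move=> kL; have /asboolP/(_ k kL) xk := Omega_inclP x.
by case: b; rewrite /coord xk mxE.
Qed.

Lemma coord_loc_ext L (x y : Omega_loc R d L) :
  (forall b k i, k \in L -> coord b x k i = coord b y k i) -> x = y.
Proof.
move=> xy; apply/val_inj/coord_ext => b k i.
by have [|kL] := boolP (k \in L); [exact: xy|rewrite !coord_notin].
Qed.

Lemma coord_restr L (F : Gamma -> 'rV[R]_d * 'rV[R]_d) b k i : k \in L ->
  coord b (restr L F) k i = if b then (F k).1 ord0 i else (F k).2 ord0 i.
Proof. by move=> kL; case: b; rewrite /coord /= /restr_fun kL. Qed.

Lemma coord_proj L (x : Omega) b k i : k \in L -> coord b (Defs.proj L x) k i = coord b x k i.
Proof. exact: coord_restr. Qed.

Lemma coord_dirE L b k i b' l j : k \in L ->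
  coord b' (coord_dir L b k i) l j = ((b' == b) && (l == k) && (j == i))%:R.
Proof.
move=> kL; have [lL|lL] := boolP (l \in L); last first.
  rewrite coord_notin//; have [lk|] := eqVneq l k; last by rewrite andbF.
  by rewrite -lk (negbTE lL) in kL.
by case: b; case: b'; rewrite coord_restr//=; case: eqVneq => //= _; rewrite !mxE ?eqxx.
Qed.

Lemma inner_coord (L : {fset Gamma}) (x y : Omega) : (forall k, k \notin L -> x k = 0) ->
  inner x y = \sum_(k <- L) \sum_i (coord true x k i * coord true y k i +
    coord false x k i * coord false y k i).
Proof.
move=> xL; rewrite -[LHS]/(Omega_form x y) (Omega_formE y xL); apply: eq_bigr => k _.
by rewrite /dotE /dotrv big_split.
Qed.

Lemma pick_sum L (F : Gamma -> R) k : k \in L -> \sum_(l <- L) (l == k)%:R * F l = F k.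
Proof.
move=> kL; rewrite (bigD1_seq k)//= ?eqxx ?mul1r ?fset_uniq//.
by rewrite big1 ?addr0// => l /negbTE ->; rewrite mul0r.
Qed.

Lemma inner_coord_dir L (x : Omega) b k i : k \in L ->
  inner (Omega_incl (coord_dir L b k i)) x = coord b x k i.
Proof.
move=> kL; rewrite (@inner_coord L); last first.
  by move=> l lL; have /asboolP/(_ l lL) := Omega_inclP (coord_dir L b k i).
rewrite -[RHS](pick_sum (fun l => coord b x l i) kL); apply: eq_bigr => l _.
rewrite (bigD1 i)//= !coord_dirE// big1 ?addr0 => [|j /negbTE ji]; last first.
  by rewrite !coord_dirE// ji !andbF !mul0r addr0.
by case: b; rewrite !eqxx /= ?andbT ?mul0r ?addr0 ?add0r.
Qed.

Lemma coord_locD L (x y : Omega_loc R d L) b k i :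
  coord b (x + y) k i = coord b x k i + coord b y k i.
Proof. exact: coordD. Qed.

Lemma coord_locZ L a (x : Omega_loc R d L) b k i : coord b (a *: x) k i = a * coord b x k i.
Proof. exact: coordZ. Qed.

Lemma coord_loc_sum L (I : Type) (r : seq I) (F : I -> Omega_loc R d L) b k i :
  coord b (\sum_(j <- r) F j) k i = \sum_(j <- r) coord b (F j) k i.
Proof.
elim: r => [|j r ih]; last by rewrite !big_cons coord_locD ih.
by rewrite !big_nil -[0](scale0r 0) coord_locZ mul0r.
Qed.

Lemma coord_decomposition L (x : Omega_loc R d L) :
  x = \sum_(k <- L) \sum_i \sum_b coord b x k i *: coord_dir L b k i.
Proof.
apply: coord_loc_ext => b l j lL.
transitivity (\sum_(k <- L) \sum_i \sum_b' coord b' x k i * ((b == b') && (l == k) && (j == i))%:R).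
  rewrite (bigD1_seq l)//= ?fset_uniq// [X in _ + X]big1 => [|k /negbTE kl]; last first.
    by rewrite big1// => i _; rewrite big1// => b' _; rewrite [l == k]eq_sym kl andbF mulr0.
  rewrite addr0 (bigD1 j)//= [X in _ + X]big1 => [|i /negbTE ij]; last first.
    by rewrite big1// => b' _; rewrite [j == i]eq_sym ij andbF mulr0.
  rewrite addr0 (bigD1 b)//= [X in _ + X]big1 => [|b' /negbTE bb]; last first.
    by rewrite [b == b']eq_sym bb mulr0.
  by rewrite !eqxx mulr1 addr0.
rewrite coord_loc_sum; apply: eq_big_seq => k kL.
rewrite coord_loc_sum; apply: eq_bigr => i _.
by rewrite coord_loc_sum; apply: eq_bigr => b' _; rewrite coord_locZ coord_dirE.
Qed.

Lemma is_derive_coordP L (c : R -> Omega_loc R d L) (v : Omega_loc R d L) (s : R) :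
  is_derive s 1 c v <->
  (forall b k i, k \in L -> is_derive s 1 (fun u => coord b (c u) k i) (coord b v k i)).
Proof.
split=> [dc b k i kL|dc].
  have := is_derive_inner (coord_dir L b k i) dc; rewrite -[inner _ v]/(inner (Omega_incl _) (Omega_incl v)).
  rewrite inner_coord_dir// (_ : (fun u => inner _ (c u)) = fun u => coord b (c u) k i)//.
  by apply/funext => u; rewrite -[LHS]/(inner (Omega_incl _) (Omega_incl (c u))) inner_coord_dir.
rewrite [v]coord_decomposition.
rewrite (_ : c = fun u => \sum_(k <- L) \sum_i \sum_b coord b (c u) k i *: coord_dir L b k i);
  last by apply/funext => u; exact: coord_decomposition.
apply: is_derive_vsum => k kL; apply: is_derive_vsum => i _; apply: is_derive_vsum => b _.
by apply: is_derive_scale; exact: dc.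
Qed.

End coordinates.

Section hamiltonian_equations.
Context {R : realType} {d : nat} {Gamma : countType}.
Local Notation Omega := (Omega R d Gamma).
Implicit Types (k l : Gamma) (i j : 'I_d) (L : {fset Gamma}) (b : bool).

Lemma coord_line L b k i (t : R) (x : Omega_loc R d L) b' l j : k \in L ->
  coord b' (t *: coord_dir L b k i + x) l j =
  t * ((b' == b) && (l == k) && (j == i))%:R + coord b' x l j.
Proof. by move=> kL; rewrite coord_locD coord_locZ coord_dirE. Qed.

Lemma Omega_p_line L b k i (t : R) (x : Omega_loc R d L) l : k \in L ->
  Omega_p (t *: coord_dir L b k i + x) l =
  (t * (b && (l == k))%:R) *: delta_mx ord0 i + Omega_p x l.
Proof.
move=> kL; apply/rowP => j; have := coord_line b i t x true l j kL.
rewrite /coord => ->; rewrite !mxE eqxx /= -mulrA; congr (_ * _ + _).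
by rewrite -natrM mulnb; case: b.
Qed.

Lemma Omega_q_line L b k i (t : R) (x : Omega_loc R d L) l : k \in L ->
  Omega_q (t *: coord_dir L b k i + x) l =
  (t * (~~ b && (l == k))%:R) *: delta_mx ord0 i + Omega_q x l.
Proof.
move=> kL; apply/rowP => j; have := coord_line b i t x false l j kL.
rewrite /coord => ->; rewrite !mxE eqxx /= -mulrA; congr (_ * _ + _).
by rewrite -natrM mulnb; case: b.
Qed.

Lemma dotrv_line (a : R) (u : 'rV[R]_d) i :
  dotrv (a *: delta_mx ord0 i + u) (a *: delta_mx ord0 i + u) =
  dotrv u u + (2 * u ord0 i * a + a * a).
Proof.
have dd (v : 'rV[R]_d) : dotrv (delta_mx ord0 i) v = v ord0 i.
  rewrite /dotrv (bigD1 i)//= mxE !eqxx mul1r big1 ?addr0// => j ji.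
  by rewrite mxE eqxx /= (negbTE ji) mul0r.
rewrite !(dotrvDl, dotrvZl) !(dotrvC _ (_ + _)) !(dotrvDl, dotrvZl) (dotrvC u) !dd mxE !eqxx /=.
by ring.
Qed.

Lemma is_derive_quadratic (K P e w W : R) :
  is_derive (0 : R) 1 (fun t => (K + (2 * P * (t * e) + t * e * (t * e))) * w + W) (2 * P * e * w).
Proof.
have dt : is_derive (0 : R) 1 (fun t => t * e) e.
  apply: (is_derive_eq (is_derive_funM (is_derive_fun_id 0) (is_derive_fun_cst e 0))).
  by rewrite mul1r mulr0 addr0.
apply: (is_derive_eq (is_derive_funD (is_derive_funM (is_derive_funD (is_derive_fun_cst K 0)
  (is_derive_funD (is_derive_funZ (2 * P) dt) (is_derive_funM dt dt))) (is_derive_fun_cst w 0))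
  (is_derive_fun_cst W 0))).
by ring.
Qed.

Variables (m nu : Gamma -> R) (V : Gamma -> Gamma -> 'rV[R]_d -> R).
Variable g : Gamma -> Gamma -> 'I_d -> 'rV[R]_d -> R.
Hypothesis m_gt0 : forall k, 0 < m k.
Hypothesis V_derive : forall k l i x, is_derive x (delta_mx ord0 i) (V k l) (g k l i x).
Hypothesis g_odd : forall k l i x, g k l i x = - g l k i (- x).

Local Notation H L := (local_hamiltonian m nu V (L := L)).

Lemma hamiltonian_derive_p L k i (x : Omega_loc R d L) : k \in L ->
  is_derive x (dir_p R L k i) (H L) (coord true x k i / m k).
Proof.
move=> kL; apply: is_derive_line0.
have := is_derive_funD
 (is_derive_fun_sum L (fun l => is_derive_quadratic (dotrv (Omega_p x l) (Omega_p x l))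
   (Omega_p x l ord0 i) (l == k)%:R (2 * m l)^-1 (nu l * dotrv (Omega_q x l) (Omega_q x l) / 2)))
 (is_derive_fun_cst (\sum_(k <- L) \sum_(l <- L) V k l (Omega_q x k - Omega_q x l)) 0).
rewrite addr0 [X in is_derive _ _ _ X](_ : _ = coord true x k i / m k); last first.
  rewrite -(pick_sum (fun l => coord true x l i / m l) kL); apply: eq_bigr => l _.
  rewrite -[coord true x l i]/(Omega_p x l ord0 i).
  by move: (Omega_p x l ord0 i) (_ == _)%:R (m l) (m_gt0 l) => P e ml ml0; field; rewrite gt_eqF.
congr (is_derive _ _ _ _); apply/funext => t; rewrite /local_hamiltonian.
rewrite -[dir_p _ _ _ _]/(coord_dir L true k i); congr (_ + _).
  by apply: eq_bigr => l _; rewrite Omega_p_line// Omega_q_line//= mulr0 scale0r add0r dotrv_line.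
apply: eq_bigr => a _; apply: eq_bigr => b _.
by rewrite !Omega_q_line//= mulr0 scale0r !add0r.
Qed.

Lemma hamiltonian_derive_q L k i (x : Omega_loc R d L) : k \in L ->
  is_derive x (dir_q R L k i) (H L)
    (nu k * coord false x k i - force g L k i (Omega_q x)).
Proof.
move=> kL; apply: is_derive_line0.
pose e (a b : Gamma) : R := (a == k)%:R - (b == k)%:R.
have dV (a b : Gamma) : is_derive (0 : R) 1
    (fun t => V a b ((t * e a b) *: delta_mx ord0 i + (Omega_q x a - Omega_q x b)))
    (e a b * g a b i (Omega_q x a - Omega_q x b)).
  have dt : is_derive (0 : R) 1 (fun t => t * e a b) (e a b).
    apply: (is_derive_eq (is_derive_funM (is_derive_fun_id 0) (is_derive_fun_cst (e a b) 0))).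
    by rewrite mul1r mulr0 addr0.
  have dl := is_derive_line (V_derive a b i) (Omega_q x a - Omega_q x b) (0 * e a b).
  have := is_derive1_comp (g := fun t => t * e a b) dl dt.
  by rewrite mul0r scale0r add0r mulrC.
have := is_derive_funD
 (is_derive_fun_sum L (fun l => is_derive_quadratic (dotrv (Omega_q x l) (Omega_q x l))
   (Omega_q x l ord0 i) (l == k)%:R (nu l / 2) (dotrv (Omega_p x l) (Omega_p x l) / (2 * m l))))
 (is_derive_fun_sum L (fun a => is_derive_fun_sum L (fun l => dV a l))).
rewrite [X in is_derive _ _ _ X](_ : _ = nu k * coord false x k i - force g L k i (Omega_q x)); last first.
  congr (_ + _).
    rewrite -(pick_sum (fun l => nu l * coord false x l i) kL); apply: eq_bigr => l _.
    rewrite -[coord false x l i]/(Omega_q x l ord0 i).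
    by move: (Omega_q x l ord0 i) (_ == _)%:R => P e'; field.
  rewrite /force opprK.
  transitivity (\sum_(a <- L) (a == k)%:R * (\sum_(l <- L) g a l i (Omega_q x a - Omega_q x l)) -
      \sum_(l <- L) (l == k)%:R * (\sum_(a <- L) g a l i (Omega_q x a - Omega_q x l))).
    rewrite [X in _ - X](eq_bigr (fun l => \sum_(a <- L) (l == k)%:R * g a l i (Omega_q x a - Omega_q x l))).
      rewrite [X in _ = _ - X]exchange_big -sumrB; apply: eq_bigr => a _; rewrite mulr_sumr -sumrB.
      by apply: eq_bigr => b _; rewrite mulrBl.
    by move=> b _; rewrite mulr_sumr.
  rewrite (pick_sum (fun a => \sum_(l <- L) g a l i (Omega_q x a - Omega_q x l)) kL).
  rewrite (pick_sum (fun l => \sum_(a <- L) g a l i (Omega_q x a - Omega_q x l)) kL).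
  rewrite mulr_natl mulr2n; congr (_ + _); rewrite -sumrN; apply: eq_bigr => a _.
  by rewrite g_odd opprK opprB.
congr (is_derive _ _ _ _); apply/funext => t; rewrite /local_hamiltonian.
rewrite -[dir_q _ _ _ _]/(coord_dir L false k i); congr (_ + _).
  apply: eq_bigr => l _; rewrite Omega_p_line// Omega_q_line//= mulr0 scale0r add0r dotrv_line addrC.
  by congr (_ + _); ring.
apply: eq_bigr => a _; apply: eq_bigr => b _; congr (V a b _).
rewrite !Omega_q_line//= /e mulrBr scalerBl opprD addrACA.
by [].
Qed.

Lemma hamiltonian_fieldE L b k i (x : Omega_loc R d L) : k \in L ->
  coord b (hamiltonian_field (H L) x) k i =
  if b then - (nu k * coord false x k i) + force g L k i (Omega_q x) else coord true x k i / m k.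
Proof.
move=> kL; rewrite /hamiltonian_field coord_restr//; case: b; rewrite !mxE.
  by have [_ ->] := hamiltonian_derive_q i x kL; rewrite opprB addrC.
by have [_ ->] := hamiltonian_derive_p i x kL.
Qed.

Variables (c : Gamma -> Gamma -> R) (M : R).
Hypothesis M_gt0 : 0 < M.
Hypothesis c_sum : forall k L, \sum_(l <- L) c k l <= M.
Hypothesis g_lipschitz : forall k l i (x y : 'rV[R]_d) (e : R),
  (forall j, `|x ord0 j - y ord0 j| <= e) -> `|g k l i x - g k l i y| <= c k l * e.
Hypothesis nu_gt0 : forall k, 0 < nu k.

Lemma force_lipschitz L k i (q q' : Gamma -> 'rV[R]_d) (e : R) : 0 <= e ->
  k \in L -> (forall l j, l \in L -> `|q l ord0 j - q' l ord0 j| <= e) ->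
  `|force g L k i q - force g L k i q'| <= 4 * M * e.
Proof.
move=> e0 kL qe; rewrite /force -opprD normrN -mulrBr normrM ger0_norm// -sumrB.
have : `|\sum_(l <- L) (g k l i (q k - q l) - g k l i (q' k - q' l))| <= M * (2 * e).
  apply: le_trans (ler_norm_sum _ _ _) _.
  apply: (@le_trans _ _ (\sum_(l <- L) c k l * (2 * e))).
    apply: ler_fset_sum => l lL; apply: g_lipschitz => j; rewrite !mxE.
    by have := qe k j kL; have := qe l j lL; rewrite !ler_norml; lra.
  by rewrite -mulr_suml ler_wpM2r// mulr_ge0.
lra.
Qed.

Let index L : finType := (L * 'I_d * bool)%type.

Let state L (y : index L -> R) : Omega_loc R d L := restr L (fun k =>
  if insub k is Some k' then (\row_i y (k', i, true), \row_i y (k', i, false)) else 0).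

Let coord_state L (y : index L -> R) b (k : L) i :
  coord b (state y) (fsval k) i = y (k, i, b).
Proof.
rewrite coord_restr ?fsvalP//; case: insubP => [k' _ kk'|]; last by rewrite fsvalP.
have -> : k' = k by exact: val_inj.
by case: b; rewrite !mxE.
Qed.

Let coords L (x : Omega_loc R d L) : index L -> R :=
  fun kib => coord kib.2 x (fsval kib.1.1) kib.1.2.

Let coordsK L (x : Omega_loc R d L) : state (coords x) = x.
Proof.
by apply: coord_loc_ext => b k i kL; rewrite -[k]/(fsval [` kL]%fset) coord_state.
Qed.

Let field_coords L (y : index L -> R) : index L -> R := coords (hamiltonian_field (H L) (state y)).

Let field_lipschitz L : exists2 K : R, 0 < K & forall (y y' : index L -> R) (e : R),
  (forall u, `|y u - y' u| <= e) ->
  forall u, `|field_coords y u - field_coords y' u| <= K * e.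
Proof.
pose K := \sum_(k <- L) (nu k + (m k)^-1) + (4 * M + 1).
have nm k : 0 < nu k + (m k)^-1 by rewrite addr_gt0 ?invr_gt0.
have S0 : 0 <= \sum_(k <- L) (nu k + (m k)^-1) by apply: sumr_ge0 => k _; exact: ltW.
exists K; first by rewrite ltr_wpDl// addr_gt0// mulr_gt0.
move=> y y' e ye [[k i] b]; have e0 : 0 <= e by exact: le_trans (ye (k, i, b)).
have kS : nu (fsval k) + (m (fsval k))^-1 <= \sum_(k <- L) (nu k + (m k)^-1).
  by rewrite (bigD1_seq (fsval k))//= ?fsvalP ?fset_uniq// lerDl sumr_ge0// => l _; exact: ltW.
have mk : 0 <= (m (fsval k))^-1 by rewrite invr_ge0 ltW.
have nk : 0 <= nu (fsval k) by exact: ltW.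
have M0 : 0 <= M := ltW M_gt0.
rewrite /field_coords /coords /= !hamiltonian_fieldE ?fsvalP// !coord_state.
case: b.
  have fl : `|force g L (fsval k) i (Omega_q (state y)) - force g L (fsval k) i (Omega_q (state y'))|
      <= 4 * M * e.
    apply: force_lipschitz => // l j lL.
    have := ye ([` lL]%fset, j, false); rewrite -!coord_state.
    by [].
  have h1 : `|nu (fsval k) * (y (k, i, false) - y' (k, i, false))| <= nu (fsval k) * e.
    by rewrite normrM (ger0_norm nk) ler_wpM2l.
  have h2 : (nu (fsval k) + (m (fsval k))^-1) * e <= (\sum_(k <- L) (nu k + (m k)^-1)) * e.
    by rewrite ler_wpM2r.
  have h3 : 0 <= (m (fsval k))^-1 * e by rewrite mulr_ge0.
  by move: fl h1 h2 h3; rewrite /K !ler_norml; lra.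
rewrite -mulrBl normrM (ger0_norm mk) mulrC.
apply: (@le_trans _ _ ((m (fsval k))^-1 * e)); first by rewrite ler_wpM2l.
rewrite ler_wpM2r// /K.
by move: (\sum_(k <- L) _) kS => S; lra.
Qed.

Lemma hamiltonian_curve_coordsP L (x : Omega_loc R d L) (z : R -> Omega_loc R d L) :
  hamiltonian_curve (H L) x z <->
  z 0 = x /\ forall u (s : R), is_derive s 1 (fun r => coords (z r) u) (field_coords (coords (z s)) u).
Proof.
have fE s : hamiltonian_field (H L) (z s) = hamiltonian_field (H L) (state (coords (z s))).
  by rewrite coordsK.
split=> -[z0 dz]; split=> //.
  move=> [[k i] b] s; have /is_derive_coordP/(_ b (fsval k) i (fsvalP k)) := dz s.
  by rewrite fE.
move=> s; rewrite fE; apply/is_derive_coordP => b k i kL.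
exact: dz ([` kL]%fset, i, b) s.
Qed.

Lemma hamiltonian_curve_exists L (x : Omega_loc R d L) :
  exists z, hamiltonian_curve (H L) x z.
Proof.
have [K K0 KP] := field_lipschitz L.
have [y [y0 dy]] := lipschitz_flow_exists K0 KP (coords x).
exists (fun s => state (y s)); apply/hamiltonian_curve_coordsP; split.
  by rewrite y0 coordsK.
have cs s : coords (state (y s)) = y s.
  by apply/funext => -[[k i] b]; exact: coord_state.
move=> u s; rewrite cs (_ : (fun r => _) = y^~ u)//.
by apply/funext => v /=; rewrite cs.
Qed.

Lemma hamiltonian_curve_unique L (x : Omega_loc R d L) z z' :
  hamiltonian_curve (H L) x z -> hamiltonian_curve (H L) x z' -> z = z'.
Proof.
move=> /hamiltonian_curve_coordsP[z0 dz] /hamiltonian_curve_coordsP[z0' dz'].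
have [K K0 KP] := field_lipschitz L.
have E : (fun s => coords (z s)) = (fun s => coords (z' s)).
  apply: (lipschitz_flow_unique KP (c1 := fun s => coords (z s))
    (c2 := fun s => coords (z' s)) dz dz').
  by rewrite z0 z0'.
by apply/funext => s; rewrite -[z s]coordsK -[z' s]coordsK (congr1 (@^~ s) E).
Qed.

Lemma hamiltonian_flow_curve L (x : Omega_loc R d L) :
  hamiltonian_curve (H L) x (fun t => hamiltonian_flow (H L) t x).
Proof.
have := xgetPex (cst x) (hamiltonian_curve_exists x).
by [].
Qed.

Lemma hamiltonian_flowD L t t' (x : Omega_loc R d L) :
  hamiltonian_flow (H L) (t + t') x = hamiltonian_flow (H L) t (hamiltonian_flow (H L) t' x).
Proof.
have [x0 dx] := hamiltonian_flow_curve x.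
have h := hamiltonian_flow_curve (hamiltonian_flow (H L) t' x).
have h' : hamiltonian_curve (H L) (hamiltonian_flow (H L) t' x)
    (fun s => hamiltonian_flow (H L) (s + t') x).
  split=> [|s]; first by rewrite add0r.
  apply/is_derive_coordP => b k i kL.
  have /is_derive_coordP/(_ b k i kL) ds := dx (s + t').
  have dt := is_derive_funD (is_derive_fun_id s) (is_derive_fun_cst t' s).
  by have := is_derive1_comp (g := fun u => u + t') ds dt; rewrite addr0 mulr1.
exact: (congr1 (@^~ t) (hamiltonian_curve_unique h' h)).
Qed.

Lemma hamiltonian_flow0 L (x : Omega_loc R d L) : hamiltonian_flow (H L) 0 x = x.
Proof. by have [] := hamiltonian_flow_curve x. Qed.

End hamiltonian_equations.

Section local_evolutions_of_resolvents.
Context {R : realType} {d : nat} {Gamma : countType}.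
Local Notation Omega := (Omega R d Gamma).
Implicit Types (k l : Gamma) (i : 'I_d) (L : {fset Gamma}) (b : bool) (x y : Omega).

Variables (m nu : Gamma -> R) (V : Gamma -> Gamma -> 'rV[R]_d -> R).
Variable g : Gamma -> Gamma -> 'I_d -> 'rV[R]_d -> R.
Variables (c : Gamma -> Gamma -> R) (M kap : R).
Hypothesis m_gt0 : forall k, 0 < m k.
Hypothesis nu_gt0 : forall k, 0 < nu k.
Hypothesis V_derive : forall k l i v, is_derive v (delta_mx ord0 i) (V k l) (g k l i v).
Hypothesis g_odd : forall k l i v, g k l i v = - g l k i (- v).
Hypothesis c_ge0 : forall k l, 0 <= c k l.
Hypothesis M_gt0 : 0 < M.
Hypothesis kap_gt0 : 0 < kap.
Hypothesis mu_kap : forall k, (Num.sqrt (m k * nu k))^-1 <= kap.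
Hypothesis c_sum : forall k L, \sum_(l <- L) c k l <= M.
Hypothesis c_tail : forall k (e : R), 0 < e -> exists L1 : {fset Gamma},
  forall L, [disjoint L & L1]%fset -> \sum_(l <- L) c k l <= e.
Hypothesis g_bound : forall k l i v, `|g k l i v| <= c k l.
Hypothesis g_lipschitz : forall k l i (v w : 'rV[R]_d) (e : R),
  (forall j, `|v ord0 j - w ord0 j| <= e) -> `|g k l i v - g k l i w| <= c k l * e.
Hypothesis g_vanish : forall k l i (e : R), 0 < e -> exists A : R, forall v : 'rV[R]_d,
  (exists j, A <= `|v ord0 j|) -> `|g k l i v| <= e.

Let mu k := Num.sqrt (m k * nu k).
Let om k := mu k / m k.
Local Notation H L := (local_hamiltonian m nu V (L := L)).
Local Notation flow L t x := (hamiltonian_flow (H L) t (Defs.proj L x)).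

Let mu_gt0 k : 0 < mu k.
Proof. by rewrite sqrtr_gt0 mulr_gt0. Qed.

Let om_mu k : om k * mu k = nu k.
Proof.
have := m_gt0 k; have := sqr_sqrtr (ltW (mulr_gt0 (m_gt0 k) (nu_gt0 k))); rewrite -/(mu k).
by move=> h mk; rewrite /om mulrAC -expr2 h; field; rewrite gt_eqF.
Qed.

Let amplitude L x b k i s : R :=
  if b then coord false (flow L s x) k i * sin (om k * s) + coord true (flow L s x) k i / mu k * cos (om k * s)
  else coord false (flow L s x) k i * cos (om k * s) - coord true (flow L s x) k i / mu k * sin (om k * s).

Let amplitude0 L x b k i : k \in L ->
  amplitude L x b k i 0 = if b then coord true x k i / mu k else coord false x k i.
Proof.
move=> kL; rewrite /amplitude (hamiltonian_flow0 m_gt0 V_derive g_odd M_gt0 c_sum g_lipschitz nu_gt0).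
rewrite !coord_proj// mulr0 sin0 cos0 !mulr0 !mulr1.
by case: b; rewrite ?add0r ?subr0.
Qed.

Let amplitude_position L x s k i :
  coord false (flow L s x) k i =
    amplitude L x false k i s * cos (om k * s) + amplitude L x true k i s * sin (om k * s).
Proof.
rewrite /amplitude; have := cos2Dsin2 (om k * s).
move: (cos _) (sin _) (coord _ _ _ _) (_ / _) => C S q p CS.
by transitivity (q * (C ^+ 2 + S ^+ 2)); [rewrite CS mulr1|ring].
Qed.

Let amplitude_momentum L x s k i :
  coord true (flow L s x) k i =
    mu k * (amplitude L x true k i s * cos (om k * s) - amplitude L x false k i s * sin (om k * s)).
Proof.
rewrite /amplitude; have := cos2Dsin2 (om k * s); have mk := mu_gt0 k.
move: (cos _) (sin _) (coord false _ _ _) (coord true _ _ _) => C S q p CS.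
transitivity (p * (C ^+ 2 + S ^+ 2)); first by rewrite CS mulr1.
by field; rewrite gt_eqF.
Qed.

Let rotating_amplitude L x : rotating_solution om mu g L (amplitude L x).
Proof.
move=> k kL i b s.
have [_ dz] := hamiltonian_flow_curve m_gt0 V_derive g_odd M_gt0 c_sum g_lipschitz nu_gt0
  (Defs.proj L x).
have /is_derive_coordP dc := dz s.
have dq := dc false k i kL; have dp := dc true k i kL.
rewrite !(hamiltonian_fieldE nu m_gt0 V_derive g_odd)// in dq dp.
have -> : force g L k i (position om (amplitude L x) s) = force g L k i (Omega_q (flow L s x)).
  have pE l : position om (amplitude L x) s l = Omega_q (flow L s x) l.
    by apply/rowP => j; rewrite mxE -amplitude_position.
  by rewrite /force !pE; congr (- (2 * _)); apply: eq_bigr => l _; rewrite pE.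
have dcos := is_derive_fun_cos (om k) 0 s; have dsin := is_derive_fun_sin (om k) 0 s.
have c0 : (fun u => cos (om k * u + 0)) = fun u => cos (om k * u) by apply/funext => u; rewrite addr0.
have s0 : (fun u => sin (om k * u + 0)) = fun u => sin (om k * u) by apply/funext => u; rewrite addr0.
rewrite c0 addr0 in dcos; rewrite s0 addr0 in dsin.
have m0 := m_gt0 k; have nuE := om_mu k; have muk := mu_gt0 k.
have mE : (m k)^-1 = om k / mu k by rewrite /om; field; rewrite !gt_eqF.
case: b.
  have := is_derive_funD (is_derive_funM dq dsin)
    (is_derive_funM (is_derive_funM dp (is_derive_fun_cst (mu k)^-1 s)) dcos).
  move/is_derive_eq; apply; rewrite /rotation_factor -nuE mE.
  move: (cos _) (sin _) (coord false _ _ _) (coord true _ _ _) (force _ _ _ _ _) => C S q p f.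
  by field; rewrite gt_eqF.
have := is_derive_funB (is_derive_funM dq dcos)
  (is_derive_funM (is_derive_funM dp (is_derive_fun_cst (mu k)^-1 s)) dsin).
move/is_derive_eq; apply; rewrite /rotation_factor -nuE mE.
move: (cos _) (sin _) (coord false _ _ _) (coord true _ _ _) (force _ _ _ _ _) => C S q p f.
by field; rewrite gt_eqF.
Qed.

(* Coefficients of [inner y] at time [s] with respect to the amplitudes. *)
Let weight y s b k i : R :=
  if b then coord false y k i * sin (om k * s) + coord true y k i * mu k * cos (om k * s)
  else coord false y k i * cos (om k * s) - coord true y k i * mu k * sin (om k * s).

Let weighted_sum L y s (Y : bool -> Gamma -> 'I_d -> R) : R :=
  \sum_(k <- L) \sum_i \sum_b weight y s b k i * Y b k i.

Let weighted_sum_flow L (K : {fset Gamma}) y s x :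
  ((forall k, k \notin K -> y k = 0) \/ K = L) ->
  inner y (flow L s x) = weighted_sum K y s (fun b k i => amplitude L x b k i s).
Proof.
move=> KL; have -> : inner y (flow L s x) = \sum_(k <- K) \sum_i
    (coord true y k i * coord true (flow L s x) k i + coord false y k i * coord false (flow L s x) k i).
  case: KL => [yK|->]; first exact: inner_coord.
  rewrite innerC (@inner_coord _ _ _ L).
    by apply: eq_bigr => k _; apply: eq_bigr => i _; rewrite mulrC [_ * coord false y _ _]mulrC.
  by move=> k kL; have /asboolP/(_ k kL) := Omega_inclP (flow L s x).
apply: eq_bigr => k _; apply: eq_bigr => i _.
rewrite amplitude_position amplitude_momentum big_bool /weight /=.
by move: (cos _) (sin _) => C S; ring.
Qed.

Let weighted_sumB L y s Y Y' : weighted_sum L y s Y - weighted_sum L y s Y' =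
  weighted_sum L y s (fun b k i => Y b k i - Y' b k i).
Proof.
rewrite /weighted_sum -sumrB; apply: eq_bigr => k _; rewrite -sumrB; apply: eq_bigr => i _.
by rewrite -sumrB; apply: eq_bigr => b _; rewrite mulrBr.
Qed.

Let weight_norm L y s : R := 1 + \sum_(k <- L) \sum_i \sum_b `|weight y s b k i|.

Let weight_norm_ge1 L y s : 1 <= weight_norm L y s.
Proof. by rewrite lerDl !sumr_ge0// => k _; rewrite sumr_ge0// => i _; rewrite sumr_ge0. Qed.

Let weighted_sum_le L y s Y a : 0 <= a -> (forall k b i, k \in L -> `|Y b k i| <= a) ->
  `|weighted_sum L y s Y| <= weight_norm L y s * a.
Proof.
move=> a0 Ya; rewrite /weight_norm mulrDl mul1r.
apply: (@le_trans _ _ ((\sum_(k <- L) \sum_i \sum_b `|weight y s b k i|) * a)); last by rewrite lerDr.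
rewrite mulr_suml; apply: le_trans (ler_norm_sum _ _ _) _; apply: ler_fset_sum => k kL.
rewrite mulr_suml; apply: le_trans (ler_norm_sum _ _ _) _; apply: ler_sum => i _.
rewrite mulr_suml; apply: le_trans (ler_norm_sum _ _ _) _; apply: ler_sum => b _.
by rewrite normrM ler_wpM2l// Ya.
Qed.

Let inner_sum (I : Type) (r : seq I) (F : I -> Omega) x :
  inner (\sum_(j <- r) F j) x = \sum_(j <- r) inner (F j) x.
Proof.
elim: r => [|j r ih]; last by rewrite !big_cons innerDl ih.
by rewrite !big_nil -[X in inner X x](scale0r 0) innerZl mul0r.
Qed.

Let initial_functional L b k i : Omega :=
  (if b then (mu k)^-1 else 1) *: Omega_incl (coord_dir L b k i).

Let initial_functionalE L b k i x : k \in L ->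
  inner (initial_functional L b k i) x = amplitude L x b k i 0.
Proof.
move=> kL; rewrite innerZl inner_coord_dir// amplitude0//.
by case: b; rewrite ?mul1r// mulrC.
Qed.

Let free_functional L y s : Omega :=
  \sum_(k <- L) \sum_i \sum_b weight y s b k i *: initial_functional L b k i.

Let free_functionalE L y s x :
  inner (free_functional L y s) x = weighted_sum L y s (fun b k i => amplitude L x b k i 0).
Proof.
rewrite inner_sum; apply: eq_big_seq => k kL; rewrite inner_sum; apply: eq_bigr => i _.
by rewrite inner_sum; apply: eq_bigr => b _; rewrite innerZl initial_functionalE.
Qed.

Let wave_functional L k i j : Omega :=
  om k ^+ j *: (cos (om k * 0 + j%:R * (pi / 2)) *: initial_functional L false k i +
    sin (om k * 0 + j%:R * (pi / 2)) *: initial_functional L true k i).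

Let relative_functional L k l i j : Omega :=
  wave_functional L k i j - wave_functional L l i j.

Let relative_functionalE L k l i j x : k \in L -> l \in L ->
  inner (relative_functional L k l i j) x = free_relative om (amplitude L x) k l i j 0.
Proof.
have wE h : h \in L -> inner (wave_functional L h i j) x =
    wave (om h) (amplitude L x false h i 0) (amplitude L x true h i 0) j 0.
  move=> hL; rewrite innerZl innerDl (innerZl (cos _)) (innerZl (sin _)) !initial_functionalE// /wave.
  by rewrite [cos _ * _]mulrC [sin _ * _]mulrC.
move=> kL lL; rewrite innerDl -[- wave_functional _ _ _ _]scaleN1r (innerZl (-1)) mulN1r !wE//.
Qed.

Let short_time_exists L : exists2 tau : R, 0 < tau & 8 * kap * M * tau <= 1 / 2 /\
  forall k l, k \in L -> l \in L ->
    (1 + (om k ^+ 2 + om l ^+ 2) + om k ^+ 2 * om l ^+ 2) * tau <= 1 / 4.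
Proof.
pose w k l := 1 + (om k ^+ 2 + om l ^+ 2) + om k ^+ 2 * om l ^+ 2.
have w0 k l : 0 <= w k l by rewrite !addr_ge0 ?sqr_ge0// mulr_ge0 ?sqr_ge0.
pose S := 16 * kap * M + 4 * \sum_(k <- L) \sum_(l <- L) w k l.
have W0 : 0 <= \sum_(k <- L) \sum_(l <- L) w k l.
  by apply: sumr_ge0 => k _; apply: sumr_ge0.
have kM : 0 < kap * M by rewrite mulr_gt0.
have S0 : 0 < S by rewrite /S; move: kM W0; lra.
exists S^-1; first by rewrite invr_gt0.
split=> [|k l kL lL].
  by rewrite ler_pdivrMr// /S; move: W0; lra.
have kl : w k l <= \sum_(k <- L) \sum_(l <- L) w k l.
  rewrite (bigD1_seq k)//= ?fset_uniq// (bigD1_seq l)//= ?fset_uniq//.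
  rewrite -addrA lerDl addr_ge0 ?sumr_ge0// => h _; exact: sumr_ge0.
by rewrite ler_pdivrMr// -/(w k l) /S; move: kl kM; lra.
Qed.

Let resolvent_bounded y (lam : R) : lam != 0 -> exists B : R, forall x, `|resolvent y lam x| <= B%:C.
Proof.
move=> l0; have /CbP [_ [B BP]] : Cb (resolvent y lam : Omega -> R[i]).
  by apply: resolvents_Cb; exists y, lam.
by exists B.
Qed.

Let close0 (u : R) : close 0 u u.
Proof. by rewrite /close subrr normr0 mul0r. Qed.

Lemma local_evolution_resolvent_short L : exists2 tau : R, 0 < tau &
  forall (t : R) y (lam : R), `|t| <= tau -> lam != 0 ->
  CR_set (local_evolution m nu V L t (resolvent y lam)).
Proof.
have [tau tau0 [tau1 tau2]] := short_time_exists L; exists tau => // t y lam tt lam0.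
have [B BP] := resolvent_bounded y lam0.
apply: (@CR_set_of_resolvent_uniform _ _ _ B) => [x|e e0]; first exact: BP.
pose W := weight_norm L y t; have W1 := weight_norm_ge1 L y t.
have W0 : 0 < W by apply: lt_le_trans W1.
pose a := kap * (2 * M) * tau.
have a0 : 0 <= a by rewrite /a !mulr_ge0// ltW.
have Wa : 0 <= W * a by apply: mulr_ge0 => //; exact: ltW.
have [K K0 KP] := shifted_resolvent_close lam0 Wa.
pose e1 := e / (2 * K * W).
have e1_gt0 : 0 < e1 by apply: divr_gt0 => //; apply: mulr_gt0 => //; exact: mulr_gt0.
have e1E : K * (W * e1) = e / 2.
  by rewrite /e1; field; rewrite (gt_eqF K0) (gt_eqF W0).
have [delta delta0 deltaP] := displacement_close c_ge0 M_gt0 kap_gt0 mu_gt0 mu_kap c_sum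
  g_bound g_lipschitz g_vanish tau0 tau1 e1_gt0 tau2.
pose delta' := Num.min delta (e / (2 * K)).
have eK : 0 < e / (2 * K) by apply: divr_gt0 => //; exact: mulr_gt0.
have delta'0 : 0 < delta' by rewrite lt_min delta0 eK.
pose rel (u : L * L * 'I_d * 'I_4) :=
  relative_functional L (fsval u.1.1.1) (fsval u.1.1.2) u.1.2 u.2.
exists (free_functional L y t :: [seq rel u | u <- enum {: L * L * 'I_d * 'I_4}]), delta'.
split=> // x x' cl.
have flowE z : inner y (flow L t z) = inner (free_functional L y t) z +
    weighted_sum L y t (fun b k i => amplitude L z b k i t - amplitude L z b k i 0).
  rewrite (weighted_sum_flow _ _ (or_intror erefl)) free_functionalE -weighted_sumB.
  by rewrite addrC subrK.
have disp z k b i : k \in L -> `|amplitude L z b k i t - amplitude L z b k i 0| <= a.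
  move=> kL; exact: (rotating_displacement_le M_gt0 kap_gt0 mu_gt0 mu_kap c_sum g_bound
    i b (@rotating_amplitude L z) kL tt).
have dclose : `|weighted_sum L y t (fun b k i => amplitude L x b k i t - amplitude L x b k i 0) -
    weighted_sum L y t (fun b k i => amplitude L x' b k i t - amplitude L x' b k i 0)| <= W * e1.
  rewrite weighted_sumB; apply: weighted_sum_le; first exact: ltW.
  move=> k b i kL; apply: (deltaP _ _ (@rotating_amplitude L x) (@rotating_amplitude L x')) => //.
  move=> k' l' i' j k'L l'L j4; rewrite -!relative_functionalE//.
  apply: (close_le (d1 := delta')); first by rewrite ge_min lexx.
  apply: cl; rewrite inE; apply/orP; right.
  by apply/mapP; exists ([` k'L]%fset, [` l'L]%fset, i', Ordinal j4); rewrite ?mem_enum.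
have cl0 : close delta' (inner (free_functional L y t) x) (inner (free_functional L y t) x').
  by apply: cl; rewrite mem_head.
have b1 z : `|weighted_sum L y t (fun b k i => amplitude L z b k i t - amplitude L z b k i 0)| <= W * a.
  by apply: weighted_sum_le => // k b i kL; exact: disp.
rewrite /local_evolution /resolvent !flowE.
apply: le_trans (KP _ _ _ _ _ (b1 x) (b1 x') cl0) _; rewrite lecR.
have dK : K * delta' <= e / 2.
  have : delta' <= e / (2 * K) by rewrite ge_min lexx orbT.
  rewrite ler_pdivlMr ?mulr_gt0//; lra.
have := ler_wpM2l (ltW K0) dclose.
by move: dK e1E; lra.
Qed.

Lemma local_evolution_resolvent_cauchy : exists2 tau : R, 0 < tau &
  forall (t : R) y (lam e : R), `|t| <= tau -> lam != 0 -> 0 < e ->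
  exists L1, forall L L', (L1 `<=` L)%fset -> (L1 `<=` L')%fset -> forall x,
  `|local_evolution m nu V L t (resolvent y lam) x -
    local_evolution m nu V L' t (resolvent y lam) x| <= e%:C.
Proof.
have [tau tau0 [tau1 _]] := short_time_exists fset0; exists tau => // t y lam e tt lam0 e0.
pose S := Omega_supp y; pose W := weight_norm S y t; have W1 := weight_norm_ge1 S y t.
have W0 : 0 < W by apply: lt_le_trans W1.
have [K K0 KP] := shifted_resolvent_close lam0 ler01.
pose e1 := Num.min 1 (e / K) / W.
have e1_gt0 : 0 < e1 by apply: divr_gt0 => //; rewrite lt_min ltr01 divr_gt0.
have We1 : W * e1 = Num.min 1 (e / K) by rewrite /e1 mulrC divfK// gt_eqF.
have /choice [N NP] k := volume_comparison om M_gt0 kap_gt0 mu_gt0 mu_kap c_sum c_tail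
  g_bound g_lipschitz tau0 tau1 k e1_gt0.
exists (S `|` \bigcup_(k <- S) N k)%fset => L L' SL SL' x.
have NS k : k \in S -> (N k `<=` S `|` \bigcup_(k <- S) N k)%fset.
  move=> kS; apply/fsubsetP => l lN; rewrite inE; apply/orP; right.
  by apply/bigfcupP; exists k; rewrite ?andbT.
have yS k : k \notin S -> y k = 0 by exact: Omega_suppP.
have dclose : `|inner y (flow L t x) - inner y (flow L' t x)| <= W * e1.
  rewrite !(weighted_sum_flow _ _ (or_introl yS)) weighted_sumB.
  apply: weighted_sum_le; first exact: ltW.
  move=> k b i kS; have [_ H] := NP k.
  apply: (H L L' _ _ _ _ (@rotating_amplitude L x) (@rotating_amplitude L' x)) => //.
  - exact: fsubset_trans (NS k kS) SL.
  - exact: fsubset_trans (NS k kS) SL'.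
  - by move=> l b' j lL lL'; rewrite !amplitude0.
rewrite We1 in dclose.
have b1 : `|inner y (flow L' t x) - inner y (flow L t x)| <= 1.
  by rewrite distrC; apply: le_trans dclose _; rewrite ge_min lexx.
have z1 : `|0 : R| <= 1 by rewrite normr0.
have := KP _ _ _ _ _ z1 b1 (close0 (inner y (flow L t x))).
rewrite addr0 [inner y _ + _]addrC subrK /local_evolution /resolvent => /le_trans; apply.
rewrite lecR add0r sub0r opprB.
have : `|inner y (flow L t x) - inner y (flow L' t x)| <= e / K.
  by apply: le_trans dclose _; rewrite ge_min lexx orbT.
by rewrite ler_pdivlMr// mulrC.
Qed.

End local_evolutions_of_resolvents.

Section star_homomorphisms_contract.
Context {R : realType} {X : innerProductType R}.

Lemma CR_set_inverse (f : X -> R[i]) (e : R) (z : R[i]) : CR_set f ->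
  (forall x, `|f x| <= e%:C) -> e%:C < `|z| -> CR_set (fun x => (z - f x)^-1).
Proof.
move=> Cf fe ez.
have e0 : 0 <= e by rewrite -ler0c; exact: le_trans (fe 0).
have [r zr] : exists r : R, `|z| = r%:C by rewrite normc_def; eexists.
have er : e < r by move: ez; rewrite zr ltcR.
have r0 : 0 < r by exact: le_lt_trans er.
have z0 : z != 0 by rewrite -normr_gt0 zr ltcR.
pose q := e / r.
have q0 : 0 <= q by apply: divr_ge0 => //; exact: ltW.
have q1 : q < 1 by rewrite /q ltr_pdivrMr// mul1r.
pose w x := f x / z.
have wq x : `|w x| <= q%:C.
  by rewrite /w normrM normfV zr /q rmorphM fmorphV ler_wpM2r// invr_ge0 lecR ltW.
have w1 x : (1 - q)%:C <= `|1 - w x|.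
  by rewrite rmorphB rmorph1 lerBlDr -[leLHS]normr1 -{1}(subrK (w x) 1)
    (le_trans (ler_normD _ _))// lerD2l.
have w10 x : 1 - w x != 0.
  by rewrite -normr_gt0 (lt_le_trans _ (w1 x))// ltcR subr_gt0.
pose S n : X -> R[i] := iter n (fun g => 1 + (z^-1 *: f) * g) 0.
have CS n : CR_set (S n).
  elim: n => [|n ih]; first by apply/set_mem; have [] := CR_submod_subproof X.
  by apply: CR_setD; [exact: CR_set1|apply: CR_setM => //; exact: CR_setZ].
have SE n x : (1 - w x)^-1 - S n x = w x ^+ n * (1 - w x)^-1.
  elim: n => [|n ih]; first by rewrite /S /= subr0 expr0 mul1r.
  rewrite exprS -mulrA -ih -[S n.+1 x]/(1 + (z^-1 * f x) * S n x) [z^-1 * _]mulrC -/(w x).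
  by move: (w x) (S n x) (w10 x) => v t v1; field.
have : CR_set (fun x => (1 - w x)^-1).
  apply: CR_set_closed => e' e'0.
  have q10 : 0 < 1 - q by rewrite subr_gt0.
  have [n qn] : exists n, q ^+ n <= e' * (1 - q).
    have : q ^+ n @[n --> \oo] --> (0 : R) by apply: cvg_expr; rewrite ger0_norm.
    move=> /cvgrPdist_le/(_ (e' * (1 - q))); rewrite mulr_gt0// => /(_ isT) [n _ nP].
    exists n; have := nP n (leqnn n); rewrite sub0r normrN ger0_norm// exprn_ge0//.
  exists (S n) => // x; rewrite SE normrM normfV normrX.
  rewrite ler_pdivrMr ?normr_gt0//; apply: (@le_trans _ _ (q%:C ^+ n)).
    by rewrite lerXn2r ?nnegrE ?normr_ge0// ler0c.
  apply: (@le_trans _ _ (e' * (1 - q))%:C); first by rewrite -rmorphXn lecR.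
  by rewrite rmorphM ler_wpM2l// ler0c ltW.
move=> /(CR_setZ z^-1); congr CR_set; apply/funext => x.
rewrite -[LHS]/(z^-1 * (1 - f x / z)^-1) -invfM; congr (_^-1).
by rewrite mulrBr mulr1 mulrC divfK.
Qed.

Lemma star_isomorphism_contractive (phi : CR X -> CR X) : star_isomorphism phi ->
  forall (f : CR X) (e : R), (forall x, `|f x| <= e%:C) -> forall x, `|phi f x| <= e%:C.
Proof.
move=> [phil phiM _ [psi _ phiK]] f e fe x.
have phi1 : phi 1 = 1 by rewrite -[LHS]mulr1 -{2}(phiK 1) -phiM mul1r phiK.
have [r zr] : exists r : R, `|phi f x| = r%:C by rewrite normc_def; eexists.
rewrite zr lecR leNgt; apply/negP => er.
have ez : e%:C < `|phi f x| by rewrite zr ltcR.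
have := CR_set_inverse (set_mem (CR_funP f)) fe ez => /mem_set Ch.
pose h := MkCR Ch.
have phi0 : phi 0 = 0.
  by have := phil (-1) 0 0; rewrite !scaleN1r !addNr.
pose u : CR X := phi f x *: (1 : CR X).
have phiu : phi u = u by have := phil (phi f x) 1 0; rewrite phi0 !addr0 phi1.
have E : ((-1) *: f + u : CR X) * h = 1.
  apply/val_inj/funext => y.
  rewrite -[LHS]/((-1 * f y + phi f x * 1) * (phi f x - f y)^-1).
  rewrite mulN1r mulr1 addrC divff// subr_eq0; apply: contraTneq ez => ->.
  by rewrite le_gtF ?fe.
have {}E : ((-1) *: phi f + u : CR X) * phi h = 1 by rewrite -phi1 -E phiM phil phiu.
have E1 : (-1 * phi f x + phi f x * 1) * phi h x = 1 :> R[i].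
  exact: (congr1 (fun a : CR X => a x) E).
by move/eqP: E1; rewrite mulN1r mulr1 addNr mul0r eq_sym oner_eq0.
Qed.

End star_homomorphisms_contract.

Section limits_of_flows.
Context {R : realType} {X : innerProductType R} {Gamma : choiceType}.
Implicit Types (L : {fset Gamma}) (f g : X -> R[i]) (t s : R).

Lemma uniform_limit_of_cauchy (F : {fset Gamma} -> X -> R[i]) :
  (forall L, CR_set (F L)) ->
  (forall e : R, 0 < e -> exists L1, forall L L', (L1 `<=` L)%fset -> (L1 `<=` L')%fset ->
    forall x, `|F L x - F L' x| <= e%:C) ->
  exists2 g, CR_set g & forall e : R, 0 < e ->
    exists L1, forall L, (L1 `<=` L)%fset -> forall x, `|F L x - g x| <= e%:C.
Proof.
move=> CF FF.
have /choice [N NP] n := FF (1 / 2 ^+ n) (divr_gt0 ltr01 (exprn_gt0 n (ltr0Sn R 1))).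
pose T n := (\bigcup_(i <- iota 0 n.+1) N i)%fset.
have NT i n : (i <= n)%N -> (N i `<=` T n)%fset.
  move=> lin; apply/fsubsetP => k kN; apply/bigfcupP; exists i => //.
  by rewrite mem_iota /= add0n ltnS lin.
have step n x : `|F (T n.+1) x - F (T n) x| <= (1 / 2 ^+ n)%:C.
  by apply: NP; apply: NT.
have part (p : R[i] -> R) : (forall z w, p (z - w) = p z - p w) ->
    (forall z, (`|p z|)%:C <= `|z|) -> exists h : X -> R, forall x n,
    `|h x - p (F (T n) x)| <= 2 * 1 / 2 ^+ n.
  move=> pB pn; have /choice [h hP] x : exists l, forall n, `|l - p (F (T n) x)| <= 2 * 1 / 2 ^+ n.
    apply: (@geometric_limit _ (fun n => p (F (T n) x))) => n.
    by rewrite -pB -lecR (le_trans (pn _)).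
  by exists h.
have [a aP] : exists h : X -> R, forall x n,
    `|h x - complex.Re (F (T n) x)| <= 2 * 1 / 2 ^+ n.
  by apply: part => [[u v] [u' v']//|z]; exact: normc_ge_Re.
have [b bP] : exists h : X -> R, forall x n,
    `|h x - complex.Im (F (T n) x)| <= 2 * 1 / 2 ^+ n.
  apply: part => [[u v] [u' v']//|z].
  by rewrite normc_def lecR -sqrtr_sqr ler_wsqrtr// lerDr sqr_ge0.
pose g x : R[i] := (a x)%:C + 'i * (b x)%:C.
have gT n x : `|F (T n) x - g x| <= (2 * 1 / 2 ^+ n + 2 * 1 / 2 ^+ n)%:C.
  rewrite [F (T n) x]complexE /g opprD addrACA -mulrBr -!rmorphB [leRHS]rmorphD.
  apply: le_trans (ler_normD _ _) _; apply: lerD.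
    rewrite normc_def /= expr0n addr0 sqrtr_sqr lecR distrC; exact: aP.
  rewrite normrM normc_def /= expr0n expr1n add0r sqrtr1 mul1r.
  by rewrite normc_def /= expr0n addr0 sqrtr_sqr lecR distrC; exact: bP.
have lim e : 0 < e -> exists L1, forall L, (L1 `<=` L)%fset -> forall x, `|F L x - g x| <= e%:C.
  move=> e0; have [n hn] : exists n : nat, 5 / e < n%:R.
    exists (Num.bound `|5 / e|); apply: le_lt_trans (ler_norm _) _; exact: archi_boundP.
  have small : 5 / 2 ^+ n <= e.
    rewrite ler_pdivrMr ?exprn_gt0// [leRHS]mulrC -ler_pdivrMr//.
    by apply/ltW/(lt_le_trans hn); rewrite -natrX ler_nat ltnW// ltn_expl.
  exists (T n) => L TL x; rewrite -(subrK (F (T n) x) (F L x)) -addrA.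
  apply: le_trans (ler_normD _ _) _.
  have h1 : `|F L x - F (T n) x| <= (1 / 2 ^+ n)%:C.
    by apply: NP; [exact: fsubset_trans (NT n n (leqnn n)) TL|exact: NT].
  apply: le_trans (lerD h1 (gT n x)) _; rewrite -rmorphD lecR.
  by move: small; lra.
exists g => //; apply: CR_set_closed => e e0.
have [L1 L1P] := lim e e0; exists (F L1); first exact: CF.
by move=> x; rewrite distrC; exact: L1P.
Qed.

Variable Phi : {fset Gamma} -> R -> X -> X.

Definition flow_limit t f g := forall e : R, 0 < e ->
  exists L1, forall L, (L1 `<=` L)%fset -> forall x, `|f (Phi L t x) - g x| <= e%:C.

Lemma flow_limit_unique t f g g' : flow_limit t f g -> flow_limit t f g' -> g = g'.
Proof.
move=> fg fg'; apply/funext => x; apply/eqP; rewrite -subr_eq0 -normr_le0.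
have [r gr] : exists r : R, `|g x - g' x| = r%:C by rewrite normc_def; eexists.
rewrite gr lecR; apply/ler_addgt0Pr => e e0; rewrite add0r.
have e2 : 0 < e / 2 by rewrite divr_gt0.
have [L1 P1] := fg _ e2; have [L2 P2] := fg' _ e2.
have h1 := P1 _ (fsubsetUl L1 L2) x; have h2 := P2 _ (fsubsetUr L1 L2) x.
rewrite -lecR -gr -(subrK (f (Phi (L1 `|` L2)%fset t x)) (g x)) -addrA.
apply: le_trans (ler_normD _ _) _; rewrite [e]splitr rmorphD lerD//.
by rewrite distrC.
Qed.

Lemma flow_limitD t a f f' g g' : flow_limit t f g -> flow_limit t f' g' ->
  flow_limit t (a *: f + f') (a *: g + g').
Proof.
move=> fg fg' e e0.
have [r ar] : exists r : R, `|a| = r%:C by rewrite normc_def; eexists.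
have r0 : 0 <= r by rewrite -ler0c -ar.
have e1 : 0 < e / (2 * (r + 1)).
  by apply: divr_gt0 => //; apply: mulr_gt0 => //; rewrite ltr_wpDl.
have e2 : 0 < e / 2 by rewrite divr_gt0.
have [L1 P1] := fg _ e1; have [L2 P2] := fg' _ e2.
exists (L1 `|` L2)%fset => L; rewrite fsubUset => /andP[L1L L2L] x.
rewrite -[X in `|X|]/(a * f (Phi L t x) + f' (Phi L t x) - (a * g x + g' x)).
rewrite opprD addrACA -mulrBr; apply: le_trans (ler_normD _ _) _.
rewrite [e]splitr rmorphD lerD ?P2//.
rewrite normrM ar; apply: le_trans (ler_wpM2l _ (P1 L L1L x)) _; first by rewrite ler0c.
rewrite -rmorphM lecR.
have r1 : 0 < r + 1 by rewrite ltr_wpDl.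
have -> : e / 2 = (r + 1) * (e / (2 * (r + 1))) by field; rewrite gt_eqF.
by rewrite ler_wpM2r ?(ltW e1)// lerDl.
Qed.

Lemma flow_limitM t f f' g g' : CR_set f' -> CR_set g ->
  flow_limit t f g -> flow_limit t f' g' -> flow_limit t (f * f') (g * g').
Proof.
move=> /CR_set_bounded [A A0 fA] /CR_set_bounded [B B0 gB] fg fg' e e0.
have eA : 0 < e / (2 * A) by apply: divr_gt0 => //; exact: mulr_gt0.
have eB : 0 < e / (2 * B) by apply: divr_gt0 => //; exact: mulr_gt0.
have [L1 P1] := fg _ eA; have [L2 P2] := fg' _ eB.
exists (L1 `|` L2)%fset => L; rewrite fsubUset => /andP[L1L L2L] x.
rewrite -[X in `|X|]/(f (Phi L t x) * f' (Phi L t x) - g x * g' x).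
have -> : f (Phi L t x) * f' (Phi L t x) - g x * g' x =
   (f (Phi L t x) - g x) * f' (Phi L t x) + g x * (f' (Phi L t x) - g' x) by ring.
apply: le_trans (ler_normD _ _) _; rewrite [e]splitr rmorphD; apply: lerD; rewrite normrM.
  apply: (@le_trans _ _ ((e / (2 * A))%:C * A%:C)); first by rewrite ler_pM// P1.
  by rewrite -rmorphM lecR le_eqVlt; apply/orP; left; apply/eqP; field; rewrite gt_eqF.
apply: (@le_trans _ _ (B%:C * (e / (2 * B))%:C)); first by rewrite ler_pM// P2.
by rewrite -rmorphM lecR le_eqVlt; apply/orP; left; apply/eqP; field; rewrite gt_eqF.
Qed.

Lemma flow_limit_conj t f g : flow_limit t f g -> flow_limit t (fconj f) (fconj g).
Proof.
move=> fg e /fg [L1 P1]; exists L1 => L L1L x.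
by rewrite /fconj -rmorphB normcJ P1.
Qed.

Lemma flow_limit_closed t f : (forall e : R, 0 < e -> exists f' g', [/\
    forall x, `|f x - f' x| <= e%:C, forall x, `|f x - g' x| <= e%:C & flow_limit t f' g']) ->
  flow_limit t f f.
Proof.
move=> fP e e0; have e3 : 0 < e / 3 by rewrite divr_gt0.
have [f' [g' [h1 h2 lim]]] := fP _ e3; have [L1 P1] := lim _ e3; exists L1 => L L1L x.
have -> : f (Phi L t x) - f x = (f (Phi L t x) - f' (Phi L t x)) +
   ((f' (Phi L t x) - g' x) - (f x - g' x)) by ring.
apply: le_trans (ler_normD _ _) _; apply: le_trans (lerD (h1 _) (ler_normB _ _)) _.
apply: le_trans (lerD (lexx _) (lerD (P1 L L1L x) (h2 x))) _.
by rewrite -!rmorphD lecR; lra.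
Qed.

Hypothesis Phi_add : forall L t s x, Phi L (t + s) x = Phi L t (Phi L s x).
Hypothesis Phi_resolvent : forall L, exists2 tau : R, 0 < tau & forall t y (lam : R),
  `|t| <= tau -> lam != 0 -> CR_set (fun x => resolvent y lam (Phi L t x)).
Hypothesis Phi_cauchy : exists2 tau : R, 0 < tau & forall t y (lam e : R),
  `|t| <= tau -> lam != 0 -> 0 < e -> exists L1, forall L L',
  (L1 `<=` L)%fset -> (L1 `<=` L')%fset -> forall x,
  `|resolvent y lam (Phi L t x) - resolvent y lam (Phi L' t x)| <= e%:C.
Hypothesis Phi_zero : forall y, exists L1, forall L, (L1 `<=` L)%fset ->
  forall x, inner y (Phi L 0 x) = inner y x.

Lemma CR_set_pullback (phi : X -> X) :
  (forall y (lam : R), lam != 0 -> CR_set (fun x => resolvent y lam (phi x))) ->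
  forall f, CR_set f -> CR_set (fun x => f (phi x)).
Proof.
move=> phiR f Cf.
have [CbR [Cb0 CbD] CbM Cbc /closed_uniformP Cbcl] : cstar_subalgebra (@Cb R X) := Cb_cstar_subalgebra X.
suff [] : [set f | Cb f /\ CR_set (fun x => f (phi x))] f by [].
apply: CR_set_ind Cf => [|y lam lam0]; last first.
  by split; [apply: resolvents_Cb; exists y, lam|exact: phiR].
split.
- by move=> h [].
- split; first by split=> //; apply/set_mem; have [] := CR_submod_subproof X.
  move=> a h h' [Ch Ph] [Ch' Ph']; split; first exact: CbD.
  by apply: (CR_setD (CR_setZ a Ph) Ph').
- by move=> h h' [Ch Ph] [Ch' Ph']; split; [exact: CbM|exact: (CR_setM Ph Ph')].
- by move=> h [Ch Ph]; split; [exact: Cbc|exact: (CR_set_conj Ph)].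
- apply/closed_uniformP => h hA; split.
    by apply: Cbcl => e /hA [h' [? _] ?]; exists h'.
  apply: CR_set_closed => e /hA [h' [_ Ph'] hh']; by exists (fun x => h' (phi x)).
Qed.

Lemma subdivide_time (tau t : R) : 0 < tau -> exists (n : nat) (s : R), `|s| <= tau /\ t = n%:R * s.
Proof.
move=> tau0; pose n := Num.bound (`|t| / tau).
have n0 : 0 < n.+1%:R :> R by [].
exists n.+1, (t / n.+1%:R); split; last by rewrite mulrC divfK// gt_eqF.
rewrite normrM normfV (gtr0_norm n0) ler_pdivrMr// mulrC -ler_pdivrMr//.
have h : `|t| / tau < n%:R by apply: archi_boundP; rewrite divr_ge0// ltW.
by apply/ltW/(lt_trans h); rewrite ltr_nat.
Qed.

Lemma CR_set_flow L t f : CR_set f -> CR_set (fun x => f (Phi L t x)).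
Proof.
have [tau tau0 tauP] := Phi_resolvent L.
have [n [s [st ->]]] := subdivide_time t tau0.
have short u : `|u| <= tau -> forall h, CR_set h -> CR_set (fun x => h (Phi L u x)).
  by move=> ut h; apply: CR_set_pullback => y lam; exact: tauP.
elim: n f => [|n ih] f Cf.
  by rewrite mul0r; apply: short; rewrite ?normr0 ?(ltW tau0).
rewrite -natr1 mulrDl mul1r addrC (_ : (fun x => _) = fun x => f (Phi L s (Phi L (n%:R * s) x))).
  by apply: (ih (fun x => f (Phi L s x))); exact: short.
by apply/funext => x; rewrite Phi_add.
Qed.

Lemma flow_limit_exists_short : exists2 tau : R, 0 < tau & forall t f, `|t| <= tau -> CR_set f ->
  exists2 g, CR_set g & flow_limit t f g.
Proof.
have [tau tau0 tauP] := Phi_cauchy; exists tau => // t f tt Cf.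
apply: (@uniform_limit_of_cauchy (fun L x => f (Phi L t x))) => [L|]; first exact: CR_set_flow.
pose P := [set f | CR_set f /\ forall e : R, 0 < e -> exists L1, forall L L',
  (L1 `<=` L)%fset -> (L1 `<=` L')%fset -> forall x,
  `|f (Phi L t x) - f (Phi L' t x)| <= e%:C].
suff [] : P f by [].
apply: CR_set_ind Cf => [|y lam lam0]; last first.
  by split; [exact: CR_set_resolvent|move=> e; exact: tauP].
have [CRb [CR0 CRD] CRM CRc /closed_uniformP CRcl] := @CR_set_cstar R X.
split.
- by move=> h [] /CRb.
- split; first by split=> // e e0; exists fset0 => L L' _ _ x; rewrite subrr normr0 ler0c ltW.
  move=> a h h' [Ch Ph] [Ch' Ph']; split; first exact: CRD.
  move=> e e0; have [r ar] : exists r : R, `|a| = r%:C by rewrite normc_def; eexists.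
  have r0 : 0 <= r by rewrite -ler0c -ar.
  have r1 : 0 < r + 1 by rewrite ltr_wpDl.
  have e1 : 0 < e / (2 * (r + 1)) by apply: divr_gt0 => //; exact: mulr_gt0.
  have e2 : 0 < e / 2 by rewrite divr_gt0.
  have [L1 P1] := Ph _ e1; have [L2 P2] := Ph' _ e2.
  exists (L1 `|` L2)%fset => L L'; rewrite !fsubUset => /andP[L1L L2L] /andP[L1L' L2L'] x.
  rewrite -[X in `|X|]/(a * h (Phi L t x) + h' (Phi L t x) - (a * h (Phi L' t x) + h' (Phi L' t x))).
  rewrite opprD addrACA -mulrBr; apply: le_trans (ler_normD _ _) _.
  rewrite [e]splitr rmorphD lerD ?P2//.
  rewrite normrM ar; apply: le_trans (ler_wpM2l _ (P1 L L' L1L L1L' x)) _; first by rewrite ler0c.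
  rewrite -rmorphM lecR.
  have -> : e / 2 = (r + 1) * (e / (2 * (r + 1))) by field; rewrite gt_eqF.
  by rewrite ler_wpM2r ?(ltW e1)// lerDl.
- move=> h h' [Ch Ph] [Ch' Ph']; split; first exact: CRM.
  have [A A0 hA] := CR_set_bounded Ch'; have [B B0 hB] := CR_set_bounded Ch.
  move=> e e0.
  have eA : 0 < e / (2 * A) by apply: divr_gt0 => //; exact: mulr_gt0.
  have eB : 0 < e / (2 * B) by apply: divr_gt0 => //; exact: mulr_gt0.
  have [L1 P1] := Ph _ eA; have [L2 P2] := Ph' _ eB.
  exists (L1 `|` L2)%fset => L L'; rewrite !fsubUset => /andP[L1L L2L] /andP[L1L' L2L'] x.
  rewrite -[X in `|X|]/(h (Phi L t x) * h' (Phi L t x) - h (Phi L' t x) * h' (Phi L' t x)).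
  have -> : h (Phi L t x) * h' (Phi L t x) - h (Phi L' t x) * h' (Phi L' t x) =
    (h (Phi L t x) - h (Phi L' t x)) * h' (Phi L t x) +
    h (Phi L' t x) * (h' (Phi L t x) - h' (Phi L' t x)) by ring.
  apply: le_trans (ler_normD _ _) _; rewrite [e]splitr rmorphD; apply: lerD; rewrite normrM.
    apply: (@le_trans _ _ ((e / (2 * A))%:C * A%:C)); first by rewrite ler_pM// P1.
    by rewrite -rmorphM lecR le_eqVlt; apply/orP; left; apply/eqP; field; rewrite gt_eqF.
  apply: (@le_trans _ _ (B%:C * (e / (2 * B))%:C)); first by rewrite ler_pM// P2.
  by rewrite -rmorphM lecR le_eqVlt; apply/orP; left; apply/eqP; field; rewrite gt_eqF.
- move=> h [Ch Ph]; split; first exact: CRc.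
  move=> e /Ph [L1 P1]; exists L1 => L L' L1L L1L' x.
  by rewrite /fconj -rmorphB normcJ P1.
- apply/closed_uniformP => h hP; split.
    by apply: CRcl => e /hP [h' [? _] ?]; exists h'.
  move=> e e0; have e3 : 0 < e / 3 by rewrite divr_gt0.
  have [h' [_ Ph'] hh'] := hP _ e3; have [L1 P1] := Ph' _ e3.
  exists L1 => L L' L1L L1L' x.
  have -> : h (Phi L t x) - h (Phi L' t x) = (h (Phi L t x) - h' (Phi L t x)) +
    ((h' (Phi L t x) - h' (Phi L' t x)) - (h (Phi L' t x) - h' (Phi L' t x))) by ring.
  apply: le_trans (ler_normD _ _) _; apply: le_trans (lerD (hh' _) (ler_normB _ _)) _.
  apply: le_trans (lerD (lexx _) (lerD (P1 L L' L1L L1L' x) (hh' _))) _.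
  by rewrite -!rmorphD lecR; lra.
Qed.

Lemma flow_limit_comp t s f g h : flow_limit t f g -> flow_limit s g h ->
  flow_limit (t + s) f h.
Proof.
move=> fg gh e e0; have e2 : 0 < e / 2 by rewrite divr_gt0.
have [L1 P1] := fg _ e2; have [L2 P2] := gh _ e2.
exists (L1 `|` L2)%fset => L; rewrite fsubUset => /andP[L1L L2L] x.
rewrite Phi_add -(subrK (g (Phi L s x)) (f _)) -addrA.
apply: le_trans (ler_normD _ _) _; rewrite [e]splitr rmorphD lerD//.
  exact: P1.
exact: P2.
Qed.

Lemma flow_limit0 f : CR_set f -> flow_limit 0 f f.
Proof.
move=> Cf; suff [] : [set f | CR_set f /\ flow_limit 0 f f] f by [].
apply: CR_set_ind Cf => [|y lam lam0]; last first.
  split; first exact: CR_set_resolvent.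
  move=> e e0; have [L1 P1] := Phi_zero y; exists L1 => L L1L x.
  by rewrite /resolvent P1// subrr normr0 ler0c ltW.
have [CRb [CR0 CRD] CRM CRc /closed_uniformP CRcl] := @CR_set_cstar R X.
split.
- by move=> h [] /CRb.
- split; first by split=> // e e0; exists fset0 => L _ x; rewrite subrr normr0 ler0c ltW.
  by move=> a h h' [Ch Ph] [Ch' Ph']; split; [exact: CRD|exact: flow_limitD].
- by move=> h h' [Ch Ph] [Ch' Ph']; split; [exact: CRM|exact: flow_limitM].
- by move=> h [Ch Ph]; split; [exact: CRc|exact: flow_limit_conj].
- apply/closed_uniformP => h hP; split.
    by apply: CRcl => e /hP [h' [? _] ?]; exists h'.
  by apply: flow_limit_closed => e /hP [h' [_ Ph'] hh']; exists h', h'.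
Qed.

Lemma flow_limit_exists t f : CR_set f -> exists2 g, CR_set g & flow_limit t f g.
Proof.
have [tau tau0 tauP] := flow_limit_exists_short.
have [n [s [st ->]]] := subdivide_time t tau0.
elim: n f => [|n ih] f Cf; first by exists f; rewrite ?mul0r//; exact: flow_limit0.
have [g Cg fg] := tauP s f st Cf; have [h Ch gh] := ih g Cg.
by exists h => //; rewrite -natr1 mulrDl mul1r addrC; exact: flow_limit_comp fg gh.
Qed.

Theorem limit_automorphism : exists alpha : R -> CR X -> CR X,
  [/\ forall t, star_isomorphism (alpha t), forall t (f : CR X), flow_limit t f (alpha t f) &
      one_parameter_group alpha].
Proof.
have /choice [al alP] (tf : R * CR X) : exists g : CR X, flow_limit tf.1 tf.2 g.
  have [g Cg lim] := flow_limit_exists tf.1 (set_mem (CR_funP tf.2)).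
  by exists (MkCR (mem_set Cg)).
pose alpha t (f : CR X) := al (t, f).
have aP t (f : CR X) : flow_limit t f (alpha t f) := alP (t, f).
have inj (f g : CR X) : (f = g :> (X -> R[i])) -> f = g by exact: val_inj.
have Cf (f : CR X) : CR_set f := set_mem (CR_funP f).
have a0 (f : CR X) : alpha 0 f = f by apply/inj/(flow_limit_unique (aP 0 f))/flow_limit0.
have aD t s (f : CR X) : alpha (t + s) f = alpha s (alpha t f).
  by apply/inj/(flow_limit_unique (aP _ f)); exact: flow_limit_comp (aP t f) (aP s _).
exists alpha; split=> // [t|]; last first.
  split; first exact/funext.
  by move=> t s; apply/funext => f; rewrite addrC aD.
split.
- move=> a f g; apply/inj/(flow_limit_unique (aP t _)).
  exact: flow_limitD (aP t f) (aP t g).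
- move=> f g; apply/inj/(flow_limit_unique (aP t _)).
  exact: flow_limitM (Cf _) (Cf _) (aP t f) (aP t g).
- move=> f; apply/inj/(flow_limit_unique (aP t _)).
  exact: flow_limit_conj (aP t f).
- exists (alpha (- t)) => f; first by rewrite -aD subrr a0.
  by rewrite -aD addNr a0.
Qed.

End limits_of_flows.

Section summable_couplings.
Context {R : realType} {Gamma : choiceType}.
Implicit Types (L : {fset Gamma}) (a : Gamma -> R).
Local Open Scope ereal_scope.

Lemma fset_sum_le_esum a L : (forall k, 0 <= a k)%R ->
  (\sum_(k <- L) a k)%:E <= \esum_(k in [set: Gamma]) (a k)%:E.
Proof.
move=> a0; apply: esum_ge; exists [set` L]; first by split=> //; exact: finite_fset.
by rewrite fsbig_finite ?set_fsetK ?sumEFin//; exact: finite_fset.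
Qed.

Lemma esum_tail a (e : R) : (forall k, 0 <= a k)%R -> (0 < e)%R ->
  \esum_(k in [set: Gamma]) (a k)%:E < +oo ->
  exists L1, forall L, [disjoint L & L1]%fset -> (\sum_(k <- L) a k <= e)%R.
Proof.
move=> a0 e0 afin.
have fin : \esum_(k in [set: Gamma]) (a k)%:E \is a fin_num.
  by rewrite ge0_fin_numE// esum_ge0// => k _; rewrite lee_fin.
have [_ [A [Afin _] <-]] := ub_ereal_sup_adherent e0 fin.
rewrite -/(esum _ _) fsbig_finite// sumEFin => close.
exists (fset_set A) => L dLA; rewrite leNgt; apply/negP => big.
have uL : (\sum_(k <- (L `|` fset_set A)%fset) a k =
    \sum_(k <- L) a k + \sum_(k <- fset_set A) a k)%R.
  rewrite -big_cat; apply: perm_big; apply: uniq_perm; rewrite ?fset_uniq//.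
    rewrite cat_uniq !fset_uniq andbT /=; apply/hasPn => k kA; apply/negP => kL.
    by have /fdisjointP/(_ k kL) := dLA; rewrite kA.
  by move=> k; rewrite mem_cat inE.
have := fset_sum_le_esum (L `|` fset_set A)%fset a0; rewrite uL.
move: close fin; case: (esum _ _) => [r| |]//=; rewrite -EFinB lte_fin lee_fin => close _.
lra.
Qed.

End summable_couplings.

Section limit_dynamics.
Context {R : realType} {d : nat} {Gamma : countType}.
Local Notation Omega := (Omega R d Gamma).
Variables (m nu : Gamma -> R) (V : Gamma -> Gamma -> 'rV[R]_d -> R).

Let Phi (L : {fset Gamma}) (t : R) (x : Omega) : Omega :=
  Omega_incl (hamiltonian_flow (local_hamiltonian m nu V (L := L)) t (Defs.proj L x)).

Lemma uniform_flow_limitP t (f g : Omega -> R[i]) :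
  {uniform, local_evolution m nu V L t f @[L --> totally] --> g} <-> flow_limit Phi t f g.
Proof.
have FF : Filter (@totally Gamma) by exact: totally_filter.
rewrite uniform_cvgP; split=> H e /H [L1].
  by move=> _ L1P; exists L1 => L L1L x; rewrite distrC; exact: L1P.
by move=> L1P; exists L1 => // L /= L1L x; rewrite distrC; exact: L1P.
Qed.

Lemma inner_proj (L : {fset Gamma}) (x y : Omega) : (forall k, k \notin L -> y k = 0) ->
  inner y (Omega_incl (Defs.proj L x)) = inner y x.
Proof.
move=> yL; rewrite !(inner_coord _ yL); apply: eq_big_seq => k kL.
by apply: eq_bigr => i _; rewrite !coord_proj.
Qed.

Lemma resolvent_local (y : Omega) (lam : R) :
  resolvent y lam = resolvent (Defs.proj (Omega_supp y) y) lam \o Defs.proj (Omega_supp y)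
  :> (Omega -> R[i]).
Proof.
apply/funext => x; rewrite /resolvent /=; congr ((_ - _%:C)^-1).
set S := Omega_supp y; have yS k : k \notin S -> y k = 0 by exact: Omega_suppP.
rewrite -[RHS]/(inner (Omega_incl (Defs.proj S y)) (Omega_incl (Defs.proj S x))).
have -> : Omega_incl (Defs.proj S y) = y.
  apply/val_inj/funext => k /=; rewrite /restr_fun.
  by case: ifPn => // /yS ->.
by rewrite (inner_proj x yS).
Qed.

Lemma is_limit_unique t (alpha beta : CR Omega -> CR Omega) :
  star_isomorphism alpha -> (forall f : CR Omega, flow_limit Phi t f (alpha f)) ->
  star_isomorphism beta -> is_limit_of_local_evolutions m nu V t beta -> alpha = beta.
Proof.
move=> sa la sb lb; apply/funext => f.
have [al aM ac _] := sa; have [bl bM bc _] := sb.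
have inj (g h : CR Omega) : (g = h :> (Omega -> R[i])) -> g = h by exact: val_inj.
pose P : set (Omega -> R[i]) := [set h | exists2 g : CR Omega, g = h :> (Omega -> R[i]) & alpha g = beta g].
suff [g gf ab] : P f by rewrite -(inj _ _ gf).
have lin0 (phi : CR Omega -> CR Omega) : linear phi -> phi 0 = 0.
  by move=> pl; have := pl (-1) 0 0; rewrite !scaleN1r !addNr.
apply: CR_set_ind (set_mem (CR_funP f)) => [|y lam lam0]; last first.
  have Cr := resolvent_CR y lam0; pose r := MkCR Cr; exists r => //.
  pose S := Omega_supp y; pose g := MkCR (resolvent_CR (Defs.proj S y) lam0).
  have rg : r = g \o Defs.proj S :> (Omega -> R[i]) by exact: resolvent_local.
  have /uniform_flow_limitP lr := lb S g r rg.
  exact/inj/(flow_limit_unique (la r) lr).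
split.
- by move=> _ [g <- _]; exact: CR_sub_Cb.
- split; first by exists 0 => //; rewrite !lin0.
  move=> a _ _ [g <- abg] [h <- abh]; exists (a *: g + h) => //.
  by rewrite al bl abg abh.
- by move=> _ _ [g <- abg] [h <- abh]; exists (g * h) => //; rewrite aM bM abg abh.
- by move=> _ [g <- abg]; exists (CR_conj g) => //; rewrite ac bc abg.
- apply/closed_uniformP => h hP.
  have Ch : CR_set h.
    by apply: CR_set_closed => e /hP [_ [g <- _] hg]; exists g => //; exact: (set_mem (CR_funP g)).
  pose hC := MkCR (mem_set Ch); exists hC => //; apply/inj/funext => x.
  have [r gr] : exists r : R, `|alpha hC x - beta hC x| = r%:C by rewrite normc_def; eexists.
  apply/eqP; rewrite -subr_eq0 -normr_le0 gr lecR; apply/ler_addgt0Pr => e e0; rewrite add0r.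
  have e2 : 0 < e / 2 by rewrite divr_gt0.
  have [_ [g <- abg] hg] := hP _ e2.
  have bound (phi : CR Omega -> CR Omega) : star_isomorphism phi ->
      `|phi hC x - phi g x| <= (e / 2)%:C.
    move=> sphi; have [pl _ _ _] := sphi.
    have -> : phi hC x - phi g x = phi ((-1) *: g + hC) x.
      by rewrite pl -[RHS]/(-1 * phi g x + phi hC x) mulN1r addrC.
    apply: star_isomorphism_contractive => // z.
    by rewrite -[X in `|X|]/(-1 * g z + h z) mulN1r addrC.
  rewrite -lecR -gr (_ : _ - _ = (alpha hC x - alpha g x) - (beta hC x - beta g x)).
    by apply: le_trans (ler_normB _ _) _; rewrite [e]splitr rmorphD lerD ?bound.
  by rewrite abg; ring.
Qed.

End limit_dynamics.

Theorem theorem14 (R : realType) (d : nat) (d_gt0 : (0 < d)%N)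
  (Gamma : countType) (m nu : Gamma -> R)
  (m_gt0 : forall k, 0 < m k) (nu_gt0 : forall k, 0 < nu k)
  (V : Gamma -> Gamma -> 'rV[R]_d -> R)
  (V_sym : forall k l x, V k l x = V l k (- x))
  (V_smooth : forall k l, C0_smooth (V k l))
  (C : R) (Ckl : Gamma -> Gamma -> R)
  (C_ge0 : 0 <= C) (Ckl_ge0 : forall k l, 0 <= Ckl k l)
  (V_bound : forall k l (beta : {ffun 'I_d -> nat}) x,
    `|mpartial beta (V k l) x| <= Ckl k l * C ^+ (\sum_i beta i)%N)
  (Ckl_sum : (ereal_sup [set \esum_(l in [set: Gamma]) (Ckl k l)%:E
                        | k in [set: Gamma]] < +oo)%E)
  (mnu_sup : (ereal_sup ([set (m k * nu k)%:E | k in [set: Gamma]] `|`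
                         [set (1 / (m k * nu k))%:E | k in [set: Gamma]])
              < +oo)%E) :
  (forall t : R, exists! alpha : CR (Omega R d Gamma) -> CR (Omega R d Gamma),
     star_isomorphism alpha /\ is_limit_of_local_evolutions m nu V t alpha)
  /\
  (forall alpha : R -> CR (Omega R d Gamma) -> CR (Omega R d Gamma),
     (forall t, star_isomorphism (alpha t) /\
                is_limit_of_local_evolutions m nu V t (alpha t)) ->
     one_parameter_group alpha).
Proof.
have real_bound (x : \bar R) : (x < +oo)%E -> exists2 b : R, 0 <= b & (x <= b%:E)%E.
  by case: x => [r _| |_]//; [exists `|r|; rewrite // lee_fin ler_norm|exists 0; rewrite // leNye].
have [S S0 SP] := real_bound _ Ckl_sum.
have [B B0 BP] := real_bound _ mnu_sup.
pose D := C + d%:R * C ^+ 2.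
have D0 : 0 <= D by rewrite addr_ge0// mulr_ge0// exprn_ge0.
pose c k l := Ckl k l * D.
pose g k l i := partial i (V k l).
have c_ge0 k l : 0 <= c k l by rewrite mulr_ge0.
have facts k l i := C0_smooth_partial (V_smooth k l) (Ckl_ge0 k l) C_ge0 (V_bound k l) i.
have V_derive k l i x : is_derive x (delta_mx ord0 i) (V k l) (g k l i x).
  by have [/(_ x)] := facts k l i.
have g_odd k l i x : g k l i x = - g l k i (- x).
  exact: (partial_reflection (V_derive k l i) (V_derive l k i) (V_sym k l)).
have g_bound k l i x : `|g k l i x| <= c k l.
  have [_ /(_ x) gb _ _] := facts k l i; apply: le_trans gb _.
  by rewrite /c /D ler_wpM2l// lerDl mulr_ge0// exprn_ge0.
have g_lipschitz k l i (x y : 'rV[R]_d) (e : R) : (forall j, `|x ord0 j - y ord0 j| <= e) ->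
    `|g k l i x - g k l i y| <= c k l * e.
  move=> xy; have e0 : 0 <= e by exact: le_trans (xy (Ordinal d_gt0)).
  have [_ _ gl _] := facts k l i; apply: le_trans (gl x y e xy) _.
  rewrite /c /D ler_wpM2r// mulrCA ler_wpM2l// lerDr//.
have g_vanish k l i (e : R) : 0 < e -> exists A : R, forall x : 'rV[R]_d,
    (exists j, A <= `|x ord0 j|) -> `|g k l i x| <= e.
  by have [_ _ _] := facts k l i; exact.
have Ck k : (\esum_(l in [set: Gamma]) (Ckl k l)%:E <= S%:E)%E.
  by apply: le_trans SP; apply: ereal_sup_ubound; exists k.
pose M := S * D + 1.
have M_gt0 : 0 < M by rewrite ltr_wpDl// mulr_ge0.
have c_sum k (L : {fset Gamma}) : \sum_(l <- L) c k l <= M.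
  rewrite -mulr_suml; apply: (@le_trans _ _ (S * D)); last by rewrite lerDl.
  rewrite ler_wpM2r// -lee_fin; apply: le_trans (Ck k).
  exact: fset_sum_le_esum.
have c_tail k (e : R) : 0 < e -> exists L1 : {fset Gamma},
    forall L, [disjoint L & L1]%fset -> \sum_(l <- L) c k l <= e.
  move=> e0; have D1 : 0 < D + 1 by rewrite ltr_wpDl.
  have e1 : 0 < e / (D + 1) by rewrite divr_gt0.
  have fin : (\esum_(l in [set: Gamma]) (Ckl k l)%:E < +oo)%E.
    by apply: le_lt_trans (Ck k) _; rewrite ltry.
  have [L1 L1P] := esum_tail (Ckl_ge0 k) e1 fin; exists L1 => L LL1.
  rewrite -mulr_suml; apply: (@le_trans _ _ (e / (D + 1) * D)).
    by rewrite ler_wpM2r// L1P.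
  by rewrite mulrAC ler_pdivrMr// ler_wpM2l ?(ltW e0)// lerDl.
pose kap := Num.sqrt B + 1.
have kap_gt0 : 0 < kap by rewrite ltr_wpDl// sqrtr_ge0.
have mu_kap k : (Num.sqrt (m k * nu k))^-1 <= kap.
  have mn : (m k * nu k)^-1 <= B.
    rewrite -lee_fin -[_^-1]mul1r; apply: le_trans BP; apply: ereal_sup_ubound.
    by right; exists k.
  have mn0 : 0 <= m k * nu k by apply: mulr_ge0; exact: ltW.
  rewrite -sqrtrV//; apply: (@le_trans _ _ (Num.sqrt B)); last by rewrite lerDl.
  by rewrite ler_wsqrtr.
pose Phi (L : {fset Gamma}) (t : R) (x : Omega R d Gamma) : Omega R d Gamma :=
  Omega_incl (hamiltonian_flow (local_hamiltonian m nu V (L := L)) t (Defs.proj L x)).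
have Phi_add L t s x : Phi L (t + s) x = Phi L t (Phi L s x).
  rewrite /Phi Omega_inclK.
  by rewrite (hamiltonian_flowD m_gt0 V_derive g_odd M_gt0 c_sum g_lipschitz nu_gt0).
have Phi_zero y : exists L1 : {fset Gamma}, forall L, (L1 `<=` L)%fset ->
    forall x, inner y (Phi L 0 x) = inner y x.
  exists (Omega_supp y) => L SL x.
  rewrite /Phi (hamiltonian_flow0 m_gt0 V_derive g_odd M_gt0 c_sum g_lipschitz nu_gt0).
  apply: inner_proj => k kL; apply: Omega_suppP; apply: contra kL; exact: (fsubsetP SL).
have Phi_resolvent L : exists2 tau : R, 0 < tau & forall (t : R) y (lam : R),
    `|t| <= tau -> lam != 0 -> CR_set (fun x => resolvent y lam (Phi L t x)).
  exact: (local_evolution_resolvent_short m_gt0 nu_gt0 V_derive g_odd c_ge0 M_gt0 kap_gt0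
    mu_kap c_sum g_bound g_lipschitz g_vanish L).
have Phi_cauchy := local_evolution_resolvent_cauchy m_gt0 nu_gt0 V_derive g_odd M_gt0 kap_gt0
    mu_kap c_sum c_tail g_bound g_lipschitz.
have [alpha [sa la ga]] := limit_automorphism Phi_add Phi_resolvent Phi_cauchy Phi_zero.
split=> [t|beta bP].
  exists (alpha t); split=> [|beta [sb lb]]; last exact: is_limit_unique (sa t) (la t) sb lb.
  split=> // L0 g0 f _; exact/uniform_flow_limitP.
have -> : beta = alpha.
  apply/funext => t; have [sb lb] := bP t.
  by apply/esym; exact: is_limit_unique (sa t) (la t) sb lb.
exact: ga.
Qed.
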